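(* Let $k=\mathbb{F}_2$, and let $K$ be a subgroup of even order and of index $n$ of a finite group $G$. (1) For all $i\ge0$ and all $x\in H^i(K)$ one has $Q_{ni}^*(x^{\otimes n})=(Q_i^*(x))^{\otimes n}$ in $H^0(\Sigma_n\wr K)$; that is, the square formed by $Q_i^*:H^i(K)\to H^0(K)$, $Q_{ni}^*:H^{ni}(\Sigma_n\wr K)\to H^0(\Sigma_n\wr K)$ and the maps $(-)^{\otimes n}:H^i(K)\to H^{ni}(\Sigma_n\wr K)$, $(-)^{\otimes n}:H^0(K)\to H^0(\Sigma_n\wr K)$ commutes. (2) If $K$ is a central factor of $G$ (e.g. a central subgroup or a direct factor), then for $x\in H^i(K)$ we have $\mathrm{norm}_{K,G}\,Q_i^*(x)=Q_{ni}^*(\mathrm{norm}_{K,G}\,x)$. (3) For $x\in H^i(K)$ we have $Q_i^*(x)=Q_{ni}^*(x^n)\in H^0(K)$.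
   Context: $K$ is a central factor of $G$ if $G=K\cdot C_G(K)$, with $C_G(K)$ the centralizer of $K$ in $G$. Evens norm: let $x\in H^i(K)=\mathrm{Ext}^i_{kK}(k,k)$ be represented by an exact sequence $k=E_i\to E_{i-1}\to\cdots\to E_0\to k$, seen as an augmented complex $E\to k$. Then $x^{\otimes n}\in H^{ni}(\Sigma_n\wr K)$ is the class of the exact augmented complex $E^{\otimes n}\to k$ of $k(\Sigma_n\wr K)$-modules (on $H^0=k$ the map $(-)^{\otimes n}$ is $c\mapsto c^n$). Choose coset representatives $g_1,\dots,g_n$ of $K$ in $G$; for $g\in G$ write $gg_j=g_{\sigma(j)}k_j$ with $\sigma\in\Sigma_n$, $k_j\in K$, and let $\iota:G\hookrightarrow\Sigma_n\wr K$, $g\mapsto(\sigma;k_1,\dots,k_n)$. Then $\mathrm{norm}_{K,G}(x)=\iota^*(x^{\otimes n})\in H^{ni}(G)$. Dual operations: for a finite group $L$ of even order, Tate duality (the perfect pairing $\hat H^{-1-i}(L)\times\hat H^i(L)\to\hat H^{-1}(L)\cong k$ given by the product) identifies $H^i(L)$, $i\ge0$, with the dual of $\hat H^{-1-i}(L)$, and $Q_i^*:H^{i+j}(L)\to H^j(L)$ is the dual of $Q_i:\hat H^{-1-j}(L)\to\hat H^{-1-i-j}(L)$. Operations $Q_s$ on $\hat H^*(L)$ for $p=2$: let $P$ be a complete projective resolution of $k$ by finitely generated right $kL$-modules: an exact complex $\cdots\leftarrow P_{-1}\leftarrow P_0\leftarrow P_1\leftarrow\cdots$ with $\varepsilon:P_0\to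 k$ a cokernel of $P_1\to P_0$. Put $(P^{\boxtimes2})_n=\prod_{s+t=n}P_s\otimes P_t$ with the tensor differential, diagonal action, and $\Sigma_2$ acting by the twist. For complexes $X,Y$ of $kL$-modules, $\mathrm{Hom}^n(X,Y)=\prod_j\mathrm{Hom}_{kL}(X_{n+j},Y_j)$ with $df=\partial f+f\partial$; $\hat H^*(L)=H^*\mathrm{Hom}^*(P,k)$. Let $\mathcal C(2)\subseteq\mathrm{Hom}^*(P,P^{\boxtimes2})$ be the subcomplex which is $0$ in positive degrees, consists of the cocycles in degree $0$, and in degrees $m<0$ consists of all $f$ whose components $P_i\to P_s\otimes P_t$ vanish whenever $i<0$ and $s,t\ge0$; it is augmented over $k$ by $f\mapsto c$ where $\varepsilon^{\boxtimes2}f=c\,\varepsilon$ (a quasi-isomorphism). Let $W$ be the standard free resolution of $k$ over $k\Sigma_2$ with one generator $e_i$ in each homological degree $i\ge0$ and $de_i=(1+\tau)e_{i-1}$, and choose a $\Sigma_2$-equivariant chain map $\vartheta:W\to\mathcal C(2)$ over $\mathrm{id}_k$. For $x$ represented by a cocycle $a$, $Q_s(x)\in\hat H^{|x|-s}(L)$ is the class of $(a\boxtimes a)\circ\vartheta(e_{s+|x|})$ if $s+|x|\ge0$, and $Q_s(x)=0$ otherwise. *)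

(* Defs.v *)
From HB Require Import structures.
From mathcomp Require Import all_boot all_order all_algebra all_fingroup.
From mathcomp Require Import ring_quotient mxrepresentation.
From mathcomp Require classical_sets.

Set Implicit Arguments.
Unset Strict Implicit.
Unset Printing Implicit Defensive.

Import GRing.Theory.
Local Open Scope ring_scope.

(* Conventions.
   - k = 'F_2, so no signs appear.  Finitely generated right kL-modules are
     matrix representations acting on row vectors from the right.
   - V (x) W for V = k^p and W = k^q is 'M_(p, q), with v (x) w = v^T *m w.
     Hence linear maps A, B act by M |-> A^T *m M *m B, and the twist is the
     transpose.
   - Families of modules and maps are indexed by all integers.  An operation of
     degree r takes its source and target degrees as separate arguments, and is
     only meaningful if they differ by r; this avoids casts along equalities
     between degrees.
   - Objects that are defined after a choice (of a cocycle, of a chain map,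
     ...) are introduced as the class y with the stated property, by means of
     [xget 0]. *)

Notation xget := classical_sets.xget.

(* Projectivity with respect to finite dimensional modules, which for a
   finite dimensional module is projectivity. *)
Definition projective (gT : finGroupType) (L : {group gT}) (d : nat)
    (rP : mx_representation 'F_2 L d) : Prop :=
  forall (u v : nat) (rU : mx_representation 'F_2 L u)
    (rV : mx_representation 'F_2 L v) (p : 'M['F_2]_(u, v)) (f : 'M_(d, v)),
  {in L, forall g, rU g *m p = p *m rV g} -> row_full p ->
  {in L, forall g, rP g *m f = f *m rV g} ->
  exists2 h : 'M_(d, u), {in L, forall g, rP g *m h = h *m rU g} & h *m p = f.

(* [cdiff (i + 1) i] is the differential P_(i + 1) -> P_i. *)
Record complete_resolution (gT : finGroupType) (L : {group gT}) :=
  CompleteResolution {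
  cdim : int -> nat;
  crep : forall i, mx_representation 'F_2 L (cdim i);
  cdiff : forall i j : int, 'M['F_2]_(cdim i, cdim j);
  ceps : 'cV['F_2]_(cdim 0%:Z);
  crep_projective : forall i, projective (crep i);
  cdiff_off : forall i j, i != j + 1 -> cdiff i j = 0;
  cdiff_equivariant : forall i j,
    {in L, forall g, crep i g *m cdiff i j = cdiff i j *m crep j g};
  cdiff_exact : forall i, (kermx (cdiff i (i - 1)) == cdiff (i + 1) i)%MS;
  ceps_equivariant : {in L, forall g, crep 0%:Z g *m ceps = ceps};
  ceps_neq0 : ceps != 0;
  ceps_exact : (kermx ceps == cdiff 1%:Z 0%:Z)%MS
}.

Section Cohomology.
Variables (gT : finGroupType) (L : {group gT}) (P : complete_resolution L).

(* Hom_{kL}(P_m, k). *)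
Definition cochain (m : int) : pred 'cV['F_2]_(cdim P m) :=
  fun a => [forall g in L, crep P m g *m a == a].

Definition is_cocycle (m : int) : pred 'cV['F_2]_(cdim P m) :=
  fun a => cochain a && (cdiff P (m + 1) m *m a == 0).

(* The Tate theory \hat H^m uses Hom(P, k).  The ordinary theory H^m = Ext^m(k, k),
   m >= 0, uses the projective resolution P_{>= 0}, so that there are no
   coboundaries in degree 0. *)
Variant theory := ordinary | tate.

Definition is_coboundary_vec (t : theory) (m : int) :
    pred 'cV['F_2]_(cdim P m) :=
  fun a => if t is ordinary then
    if m == 0 then a == 0
    else [exists b, @cochain (m - 1) b && (a == cdiff P m (m - 1) *m b)]
  else [exists b, @cochain (m - 1) b && (a == cdiff P m (m - 1) *m b)].

Lemma cochain0 m : @cochain m 0.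
Proof. by apply/forall_inP => g gL; rewrite mulmx0. Qed.

Lemma cochainB m a b : @cochain m a -> @cochain m b -> @cochain m (a - b).
Proof.
move=> /forall_inP ha /forall_inP hb; apply/forall_inP => g gL.
by rewrite mulmxBr (eqP (ha g gL)) (eqP (hb g gL)).
Qed.

Lemma is_cocycle_zmod m : zmod_closed (@is_cocycle m).
Proof.
split=> [|a b]; rewrite !unfold_in.
  by rewrite /is_cocycle cochain0 mulmx0 eqxx.
case/andP=> ha /eqP da /andP[hb /eqP db].
by rewrite /is_cocycle cochainB // mulmxBr da db subrr eqxx.
Qed.

HB.instance Definition _ m := GRing.isZmodClosed.Build
  'cV['F_2]_(cdim P m) (@is_cocycle m) (@is_cocycle_zmod m).

Record cocycle (m : int) := Cocycle {
  cocycle_val :> 'cV['F_2]_(cdim P m);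
  cocycleP : cocycle_val \in @is_cocycle m }.

HB.instance Definition _ m := [isSub for @cocycle_val m].
HB.instance Definition _ m := [Choice of cocycle m by <:].
HB.instance Definition _ m := [SubChoice_isSubZmodule of cocycle m by <:].

Definition is_coboundary (t : theory) (m : int) : pred (cocycle m) :=
  fun z => is_coboundary_vec t (val z).

Lemma is_coboundary_zmod t m : zmod_closed (@is_coboundary t m).
Proof.
have H : forall a b : 'cV['F_2]_(cdim P m),
  let B a := [exists c, @cochain (m - 1) c && (a == cdiff P m (m - 1) *m c)] in
  B 0 /\ (B a -> B b -> B (a - b)).
  move=> a b /=; split.
    by apply/existsP; exists 0; rewrite cochain0 mulmx0 eqxx.
  move=> /existsP[c /andP[hc /eqP->]] /existsP[c' /andP[hc' /eqP->]].
  apply/existsP; exists (c - c').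
  by rewrite cochainB // mulmxBr eqxx.
split=> [|x y]; rewrite !unfold_in /is_coboundary /is_coboundary_vec ?raddf0.
  by case: t; [case: ifP => _ //|]; case: (H 0 0).
rewrite !raddfB /=; case: t; last by case: (H (val x) (val y)).
case: ifP => _; last by case: (H (val x) (val y)).
by move=> /eqP-> /eqP->; rewrite subr0 eqxx.
Qed.

HB.instance Definition _ t m := GRing.isZmodClosed.Build
  (cocycle m) (@is_coboundary t m) (@is_coboundary_zmod t m).

Definition cohomology (t : theory) (m : int) : zmodType :=
  Quotient.quot (GRing.ZmodClosed.clone (cocycle m) (@is_coboundary t m) _).

Definition represented (t : theory) (m : int) (x : cohomology t m)
    (a : 'cV['F_2]_(cdim P m)) : Prop :=
  exists2 z : cocycle m, val z = a & x = (\pi_(cohomology t m) z)%qT.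

(* [f i s t] is the component P_i -> P_s (x) P_t of an element of
   prod_j Hom_k(P_(r + j), (P [x] P)_j). *)
Definition hom_family :=
  forall i s t : int,
    {linear 'rV['F_2]_(cdim P i) -> 'M['F_2]_(cdim P s, cdim P t)}.

Definition in_hom (r : int) (f : hom_family) : Prop :=
  [/\ forall i s t, i != r + s + t -> forall v, f i s t v = 0
    & forall i s t, {in L, forall g v,
        f i s t (v *m crep P i g) = (crep P s g)^T *m f i s t v *m crep P t g}].

(* The component P_i -> P_s (x) P_t of the differential (d f) = (partial f)
   + (f partial). *)
Definition hom_diff (f : hom_family) (i s t : int) (v : 'rV_(cdim P i)) :
    'M['F_2]_(cdim P s, cdim P t) :=
  (cdiff P (s + 1) s)^T *m f i (s + 1) t v
  + f i s (t + 1) v *m cdiff P (t + 1) t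
  + f (i - 1) s t (v *m cdiff P i (i - 1)).

(* Degree 0 cocycles of augmentation 1, i.e. complete diagonals. *)
Definition diagonal (f : hom_family) : Prop :=
  [/\ in_hom 0 f,
      forall i s t v, @hom_diff f i s t v = 0
    & forall v, (ceps P)^T *m f 0%:Z 0%:Z 0%:Z v *m ceps P = v *m ceps P].

(* A chain map W -> C(2) over k is determined by the images
   [theta r] of the generators e_r of W. *)
Record dual_power_system := DualPowerSystem {
  theta :> nat -> hom_family;
  theta0 : diagonal (theta 0);
  theta_hom : forall r : nat, in_hom (- r%:Z) (theta r);
  theta_diff : forall (r : nat) i s t v,
    @hom_diff (theta r.+1) i s t v = theta r i s t v + (theta r i t s v)^T;
  theta_vanish : forall (r : nat) (i s t : int), (0 < r)%N ->
    i < 0 -> 0 <= s -> 0 <= t -> forall v, theta r i s t v = 0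
}.

(* The component P_r -> k of (a [x] b) o f, for a : P_m -> k, b : P_q -> k. *)
Definition pairing_after (f : hom_family) (m q r : int)
    (a : 'cV['F_2]_(cdim P m)) (b : 'cV['F_2]_(cdim P q)) :
    'cV['F_2]_(cdim P r) :=
  lin1_mx (fun v : 'rV_(cdim P r) => a^T *m f r m q v *m b).

(* The product, for r = m + q.  With t1 = tate and t2 = ordinary, say, it is the
   product of x with the image of y in Tate cohomology. *)
Definition cup (t1 t2 t : theory) (m q r : int)
    (x : cohomology t1 m) (y : cohomology t2 q) : cohomology t r :=
  xget 0 (fun z : cohomology t r => exists f a b,
    [/\ diagonal f, represented x a, represented y b
      & represented z (pairing_after f r a b)]).

(* Q_s : \hat H^m -> \hat H^r, for r = m - s. *)
Definition Q_op (th : dual_power_system) (s m r : int)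
    (x : cohomology tate m) : cohomology tate r :=
  if s + m is Posz l then
    xget 0 (fun y : cohomology tate r => exists2 a,
      represented x a & represented y (pairing_after (th l) r a a))
  else 0.

(* Q_s^* : H^m -> H^j, for m = s + j, is adjoint to
   Q_s : \hat H^(-1-j) -> \hat H^(-1-m) under the Tate duality pairings
   with values in \hat H^(-1). *)
Definition Q_dual (th : dual_power_system) (s m j : nat)
    (x : cohomology ordinary m%:Z) : cohomology ordinary j%:Z :=
  xget 0 (fun z : cohomology ordinary j%:Z =>
    forall y : cohomology tate (- 1 - j%:Z),
      cup tate (- 1) y z =
      cup tate (- 1) (Q_op th s%:Z (- 1 - m%:Z) y) x).

Definition one_class : cohomology ordinary 0%:Z :=
  xget 0 (fun z : cohomology ordinary 0%:Z => represented z (ceps P)).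

Fixpoint power (n i : nat) (x : cohomology ordinary i%:Z) :
    cohomology ordinary (n * i)%N%:Z :=
  if n is n'.+1 then cup ordinary (n'.+1 * i)%N%:Z x (power n' x)
  else one_class.

End Cohomology.

(* iota^* along a group homomorphism iota : L1 -> L2. *)
Definition restrict (gT1 gT2 : finGroupType) (L1 : {group gT1})
    (L2 : {group gT2}) (P1 : complete_resolution L1)
    (P2 : complete_resolution L2) (iota : gT1 -> gT2) (m : nat)
    (x : cohomology P2 ordinary m%:Z) : cohomology P1 ordinary m%:Z :=
  xget 0 (fun y : cohomology P1 ordinary m%:Z =>
    exists (phi : forall j : nat, 'M['F_2]_(cdim P1 j%:Z, cdim P2 j%:Z)) b,
    [/\ forall j, {in L1, forall g,
          crep P1 j%:Z g *m phi j = phi j *m crep P2 j%:Z (iota g)},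
        forall j, cdiff P1 j.+1%:Z j%:Z *m phi j =
          phi j.+1 *m cdiff P2 j.+1%:Z j%:Z,
        phi 0 *m ceps P2 = ceps P1,
        represented x b
      & represented y (phi m *m b)]).

(* A complex of modules with augmentation to k: [arep] is the total module,
   whose basis is homogeneous of degrees [adeg]. *)
Record augmented_complex (gT : finGroupType) (L : {group gT}) :=
  AugmentedComplex {
  adim : nat;
  arep : mx_representation 'F_2 L adim;
  adeg : 'I_adim -> nat;
  adiff : 'M['F_2]_adim;
  aeps : 'cV['F_2]_adim;
  atop : 'I_adim
}.

(* E is an exact sequence k = E_i -> ... -> E_0 -> k, with E_i spanned by the
   basis vector [atop E]. *)
Definition yoneda_extension (gT : finGroupType) (L : {group gT}) (i : nat)
    (E : augmented_complex L) : Prop :=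
  [/\ [/\ {in L, forall g a b, arep E g a b != 0 -> adeg a = adeg b},
          forall a b, adiff E a b != 0 -> adeg a = (adeg b).+1
        & forall a, aeps E a 0 != 0 -> adeg a = 0%N],
      {in L, forall g, arep E g *m adiff E = adiff E *m arep E g},
      {in L, forall g, arep E g *m aeps E = aeps E},
      aeps E != 0 /\ (kermx (row_mx (adiff E) (aeps E)) == adiff E)%MS
    & [/\ forall a : 'I_(adim E), (adeg a <= i)%N,
          forall a : 'I_(adim E), (adeg a == i) = (a == atop E)
        & {in L, forall g, arep E g (atop E) (atop E) = 1}]].

(* The cocycle a : P_i -> k is the top component of a chain map
   P_{>= 0} -> E over the identity of k. *)
Definition extension_cocycle (gT : finGroupType) (L : {group gT})
    (P : complete_resolution L) (E : augmented_complex L) (i : nat)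
    (a : 'cV['F_2]_(cdim P i%:Z)) : Prop :=
  exists phi : forall j : nat, 'M['F_2]_(cdim P j%:Z, adim E),
  [/\ forall j u b, phi j u b != 0 -> adeg b = j,
      forall j, {in L, forall g, crep P j%:Z g *m phi j = phi j *m arep E g},
      forall j, cdiff P j.+1%:Z j%:Z *m phi j = phi j.+1 *m adiff E,
      phi 0 *m aeps E = ceps P
    & a = col (atop E) (phi i)].

Section Wreath.
Variables (n : nat) (gT : finGroupType).

(* (sigma; k_1, ..., k_n) in Sigma_n \wr gT. *)
Definition wreath : Type := ('S_n * {ffun 'I_n -> gT})%type.
HB.instance Definition _ := Finite.on wreath.

(* (sigma; k) (tau; l) = (sigma o tau; j |-> k_(tau j) l_j), so that
   g |-> (sigma; k) given by g g_j = g_(sigma j) k_j is a homomorphism; the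
   product tau * sigma of permutations is the composite sigma o tau. *)
Definition wreath_mul (x y : wreath) : wreath :=
  ((y.1 * x.1)%g, [ffun j => (x.2 (y.1 j) * y.2 j)%g]).
Definition wreath_one : wreath := (1%g, [ffun=> 1%g]).
Definition wreath_inv (x : wreath) : wreath :=
  ((x.1^-1)%g, [ffun j => ((x.2 ((x.1^-1)%g j))^-1)%g]).

Lemma wreath_mulA : associative wreath_mul.
Proof.
move=> x y z; congr (_, _); first by rewrite /= mulgA.
by apply/ffunP=> j; rewrite !ffunE permM mulgA.
Qed.

Lemma wreath_mul1 : left_id wreath_one wreath_mul.
Proof.
move=> [s k]; congr (_, _); first by rewrite /= mulg1.
by apply/ffunP=> j; rewrite !ffunE mul1g.
Qed.

Lemma wreath_mulV : left_inverse wreath_one wreath_inv wreath_mul.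
Proof.
move=> [s k]; congr (_, _); first by rewrite /= mulgV.
by apply/ffunP=> j; rewrite !ffunE /= permK mulVg.
Qed.

HB.instance Definition _ := Finite_isGroup.Build wreath
  wreath_mulA wreath_mul1 wreath_mulV.

Definition wreath_set (K : {set gT}) : {set wreath} :=
  [set x : wreath | [forall j, x.2 j \in K]].

Lemma wreath_group_set (K : {group gT}) : group_set (wreath_set K).
Proof.
apply/group_setP; split=> [|x y].
  by rewrite inE; apply/forallP=> j; rewrite ffunE group1.
rewrite !inE => /forallP hx /forallP hy.
by apply/forallP=> j; rewrite ffunE groupM.
Qed.

Canonical wreath_group (K : {group gT}) := Group (wreath_group_set K).

End Wreath.

Section TensorPower.
Variables (n : nat) (gT : finGroupType) (K : {group gT}).
Variable E : augmented_complex K.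

(* The basis of E^(x n): the tensors of n basis vectors of E. *)
Definition tensor_index := {ffun 'I_n -> 'I_(adim E)}.
Definition tensor_val (u : 'I_#|{: tensor_index}|) : tensor_index :=
  enum_val u.

(* (e . (sigma; k))_j = e_(sigma j) . k_j is the right action associated to the
   left action putting k_j e_j in position sigma j. *)
Definition tensor_rep (w : wreath n gT) : 'M['F_2]_#|{: tensor_index}| :=
  \matrix_(u, v)
    \prod_(j < n) arep E (w.2 j) (tensor_val u (w.1 j)) (tensor_val v j).

Lemma tensor_rep_repr : mx_repr (wreath_group n K) tensor_rep.
Proof.
split=> [|x y].
  apply/matrixP=> u v; rewrite !mxE.
  under eq_bigr => j _ do rewrite ffunE perm1 repr_mx1 mxE.
  have [->|ne] := eqVneq u v; first by rewrite big1 // => j _; rewrite eqxx.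
  have [j hj]: exists j, tensor_val u j != tensor_val v j.
    apply/existsP; rewrite -negb_forall; apply: contra ne => /forallP h.
    by apply/eqP/enum_val_inj/ffunP=> j; apply/eqP.
  by rewrite (bigD1 j) //= (negPf hj) mul0r.
rewrite !inE => /forallP hx /forallP hy; apply/matrixP=> u v; rewrite !mxE.
under [RHS]eq_bigr => w _ do rewrite !mxE.
rewrite [RHS](reindex (@enum_rank tensor_index)); last first.
  exact/onW_bij/enum_rank_bij.
under [RHS]eq_bigr => f _ do rewrite /tensor_val enum_rankK.
under [RHS]eq_bigr => f _ do
  rewrite (reindex_inj (@perm_inj _ y.1)) /= -big_split /=
          (reindex_inj (@perm_inj _ (y.1^-1)%g)) /=.
under [RHS]eq_bigr => f _ do under eq_bigr => j _ do rewrite permKV.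
rewrite -(bigA_distr_bigA (fun j a =>
  arep E (x.2 j) (tensor_val u (x.1 j)) a *
  arep E (y.2 ((y.1^-1)%g j)) a (tensor_val v ((y.1^-1)%g j)))).
rewrite [RHS](reindex_inj (@perm_inj _ y.1)) /=.
apply: eq_bigr => j _; rewrite ffunE permM permK.
by rewrite repr_mxM // mxE.
Qed.

Definition tensor_power : augmented_complex (wreath_group n K) := {|
  adim := #|{: tensor_index}|;
  arep := MxRepresentation tensor_rep_repr;
  adeg := fun u => \sum_(j < n) adeg (tensor_val u j);
  adiff := \matrix_(u, v) \sum_(j < n)
    adiff E (tensor_val u j) (tensor_val v j) *
    \prod_(l < n | l != j) (tensor_val u l == tensor_val v l)%:R;
  aeps := \col_u \prod_(j < n) aeps E (tensor_val u j) 0;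
  atop := enum_rank [ffun=> atop E]
|}.

End TensorPower.

(* x |-> x^(x n).  The degree is i * n rather than n * i, because 0 * n
   reduces to 0. *)
Definition tensor_power_class (n : nat) (gT : finGroupType) (K : {group gT})
    (PK : complete_resolution K) (PW : complete_resolution (wreath_group n K))
    (i : nat) : cohomology PK ordinary i%:Z ->
    cohomology PW ordinary (i * n)%N%:Z :=
  match i return
    cohomology PK ordinary i%:Z -> cohomology PW ordinary (i * n)%N%:Z
  with
  | 0 => fun x => xget 0 (fun y : cohomology PW ordinary 0%:Z =>
      exists2 c : 'F_2, represented x (c *: ceps PK)
                      & represented y (c ^+ n *: ceps PW))
  | i'.+1 => fun x => xget 0 (fun y : cohomology PW ordinary (i'.+1 * n)%N%:Z =>
      exists (E : augmented_complex K) a b,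
      [/\ yoneda_extension i'.+1 E,
          extension_cocycle E a, represented x a,
          extension_cocycle (tensor_power n E) b
        & represented y b])
  end.

Definition coset_representatives (gT : finGroupType) (G K : {group gT})
    (n : nat) (r : 'I_n -> gT) : Prop :=
  (forall j, r j \in G) /\
  {in G, forall x, exists! j, (x \in r j *: K)%g}.

(* The element (sigma; k) of Sigma_n \wr K with g g_j = g_(sigma j) k_j. *)
Definition wreath_embedding (gT : finGroupType) (K : {group gT}) (n : nat)
    (r : 'I_n -> gT) (g : gT) : wreath n gT :=
  odflt 1%g [pick w in wreath_group n K |
    [forall j, (g * r j)%g == (r (w.1 j) * w.2 j)%g]].

Definition evens_norm (gT : finGroupType) (G K : {group gT}) (n : nat)
    (PG : complete_resolution G) (PK : complete_resolution K)
    (PW : complete_resolution (wreath_group n K)) (r : 'I_n -> gT) (i : nat)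
    (x : cohomology PK ordinary i%:Z) :
    cohomology PG ordinary (i * n)%N%:Z :=
  restrict PG (wreath_embedding K r) (tensor_power_class PW x).

Definition central_factor (gT : finGroupType) (G K : {group gT}) : Prop :=
  G = (K * 'C_G(K))%g :> {set gT}.

(* Main.v *)
(* For a finite group L of even order and x in H^i(L), the element Q_i^*(x) of
   H^0(L) = k is the sum, over all k in L with k^2 = 1, of the restriction of x to
   the subgroup generated by k, read in H^i(Z/2) = k (for i = 0 the sum is 0, the
   number of such k being even).  Indeed, represent the generator of \hat H^(-1)(L)
   by the trace of a linear form l with delta l = eps; then
   a (x) a = sum_k tr (k l (x) l), the terms of k and k^-1 cancel, and the term of an
   involution k is evaluated by a descending chain of identities along a chain map
   from the standard resolution of Z/2.

   The theorem then follows from properties of restriction to involutions.  It is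
   multiplicative, which gives (3).  The restriction of x^(x n) to (sigma; k_1, ...)
   is the product of the restrictions of x to the k_j if sigma = 1, and 0 otherwise
   (for i > 0), which gives (1).  For a central factor K, an element of G fixes all
   cosets of K only if it is in K, and the k_j are then conjugate to it in K, which
   gives (2). *)
Require Import Defs.
From mathcomp Require Import all_boot all_order all_algebra all_fingroup.
From HB Require Import structures.
From mathcomp Require Import ring_quotient mxrepresentation cyclic pgroup zify.
From mathcomp Require classical_sets.

Set Implicit Arguments.
Unset Strict Implicit.
Unset Printing Implicit Defensive.

Import GRing.Theory.

(** Cup products, operations, restrictions and tensor powers are choices [xget 0] of a class with a
    given property, so each needs a proof that such a class exists. This is the costly part: it
    takes equivariant chain maps, a Yoneda extension for every cocycle of positive degree, and
    exactness of its tensor power. Independence of the choices is bypassed: whichever extension,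
    diagonal or chain map lies behind the chosen class, its values on involutions are computed, and
    these values determine the elements of H^0 to be compared. No resolution of the subgroup
    generated by k is formed. A string consists of the images of the standard generators in a
    complex of L-modules; chain maps, slant products and translations carry strings to strings, and
    each of these gives a property of restriction. Evenness of the order enters twice more: it makes
    a trace functional on P_(-1) a cocycle that generates \hat H^(-1), and it cancels the
    contribution common to all k with k^2 = 1. Over F_2, c^n = c for n > 0 removes the exponents in
    (2) and (3). *)

Section CharTwo.
Local Open Scope ring_scope.

Lemma F2_double (V : lmodType 'F_2) (x : V) : x + x = 0.
Proof. by rewrite -[x]scale1r -scalerDl (_ : 1 + 1 = 0) ?scale0r //; apply/eqP. Qed.

Lemma F2_addK (V : lmodType 'F_2) (x y : V) : x + y + y = x.
Proof. by rewrite -addrA F2_double addr0. Qed.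

Lemma F2_opp (V : lmodType 'F_2) (x : V) : - x = x.
Proof. by apply/eqP; rewrite eq_sym -addr_eq0 F2_double. Qed.

Lemma F2_oppr (c : 'F_2) : - c = c.
Proof. exact: (@F2_opp ('F_2)^o). Qed.

Lemma F2_addrr (c : 'F_2) : c + c = 0.
Proof. exact: (@F2_double ('F_2)^o). Qed.

Lemma F2_addKr (a b c : 'F_2) : a + b = c -> b = a + c.
Proof. by move=> <-; rewrite addrA F2_addrr add0r. Qed.

Lemma F2_cancel_outer (a b c : 'F_2) : a + b + (c + a) = c + b.
Proof. by rewrite addrC -addrA [a + (a + b)]addrA F2_addrr add0r. Qed.

Lemma F2_case (c : 'F_2) : c = 0 \/ c = 1.
Proof. by case: c => [[|[|//]] h]; [left | right]; apply/val_inj. Qed.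

Lemma F2_exp (c : 'F_2) n : (0 < n)%N -> c ^+ n = c.
Proof.
by case: n => // n _; case: (F2_case c) => ->; rewrite ?expr0n ?expr1n.
Qed.

Lemma F2_natr n : (n%:R : 'F_2) = (odd n)%:R.
Proof.
elim: n => // n IH; rewrite [LHS]mulrS IH /=.
by case: (odd n); apply/eqP.
Qed.

(** The terms of k and k^-1 cancel; comparing ranks selects one element of each pair. *)
Lemma F2_sum_inv (gT : finGroupType) (L : {group gT}) (V : lmodType 'F_2)
    (F : gT -> V) :
  {in L, forall k, F k^-1%g = F k} ->
  \sum_(k in L) F k = \sum_(k in L | (k * k == 1)%g) F k.
Proof.
move=> FV; rewrite (bigID (fun k => k * k == 1)%g) /= [X in _ + X](_ : _ = 0) ?addr0 //.
rewrite (bigID (fun k => enum_rank k < enum_rank k^-1%g)%N) /=.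
rewrite [X in _ + X](reindex_inj invg_inj) /=.
rewrite -[RHS](F2_double
  (\sum_(k | (k \in L) && (k * k != 1)%g && (enum_rank k < enum_rank k^-1%g)%N) F k)).
congr (_ + _); apply: eq_big => [k|k /andP[/andP[kL _] _]]; last by rewrite FV // -groupV.
rewrite groupV invgK -invMg invg_eq1 -leqNgt leq_eqVlt.
case: (k \in L) => //=; case: eqP => //= ne.
case: eqP => // /val_inj/enum_rank_inj e; case: ne.
by rewrite {1}e mulVg.
Qed.

Lemma even_card_sqr1 (gT : finGroupType) (L : {group gT}) :
  ~~ odd #|L| -> \sum_(k in L | (k * k == 1)%g) (1 : ('F_2)^o) = 0.
Proof.
move=> ev; rewrite -(@F2_sum_inv _ _ _ (fun=> 1)) //.
by rewrite sumr_const F2_natr (negbTE ev).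
Qed.

End CharTwo.

(** * Projective modules: trace decompositions and averaging *)

Section Projective.
Local Open Scope ring_scope.
Variables (gT : finGroupType) (L : {group gT}).

Section Free.
Variable d : nat.

(** The whole type, rather than L, indexes the basis: under right multiplication by L this is a free
    module with d generators for each left coset of L. *)
Definition free_index := ('I_d * gT)%type.

Definition free_mx (g : gT) : 'M['F_2]_#|{: free_index}| :=
  \matrix_(u, v) (enum_val v == ((enum_val u).1, ((enum_val u).2 * g)%g))%:R.

Lemma free_mx_mul m g (A : 'M_(_, m)) u j :
  (free_mx g *m A) u j =
  A (enum_rank ((enum_val u).1, ((enum_val u).2 * g)%g)) j.
Proof.
rewrite mxE (bigD1 (enum_rank ((enum_val u).1, ((enum_val u).2 * g)%g))) //=.
rewrite !mxE enum_rankK eqxx mul1r big1 ?addr0 // => v ne.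
by rewrite mxE -(inj_eq enum_rank_inj) enum_valK (negPf ne) mul0r.
Qed.

Lemma free_mx_repr : mx_repr L free_mx.
Proof.
split=> [|g h gL hL]; apply/matrixP => u v.
  rewrite !mxE mulg1 -surjective_pairing (inj_eq enum_val_inj) eq_sym.
  by [].
by rewrite free_mx_mul !mxE enum_rankK /= mulgA.
Qed.

Definition free_repr := MxRepresentation free_mx_repr.

End Free.

(* Higman's criterion. *)
Lemma projective_trace d (rP : mx_representation 'F_2 L d) :
  projective rP ->
  exists t : 'M_d, \sum_(g in L) rP g *m t *m rP g^-1%g = 1%:M.
Proof.
pose p : 'M['F_2]_(#|{: free_index d}|, d) :=
  \matrix_(u, j) if (enum_val u).2 \in L then rP (enum_val u).2 (enum_val u).1 j
                 else 0.
move=> prj; have [||g gL|h hE hp] := prj _ _ (free_repr d) rP p 1%:M.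
- move=> g gL; apply/matrixP => u j; rewrite free_mx_mul.
  rewrite !mxE enum_rankK /= groupMr //; case: ifP => hL.
    by rewrite repr_mxM // mxE; apply: eq_bigr => i _; rewrite !mxE hL.
  by rewrite big1 // => i _; rewrite mxE hL mul0r.
- rewrite -sub1mx; apply/submxP.
  exists (\matrix_(i, u) ((enum_val u) == (i, 1%g))%:R).
  apply/matrixP => i j; rewrite [RHS]mxE (bigD1 (enum_rank ((i, 1%g) : free_index d))) //= !mxE enum_rankK.
  rewrite eqxx mul1r group1 repr_mx1 mxE big1 ?addr0 // => u ne.
  by rewrite mxE -(inj_eq enum_rank_inj) enum_valK (negPf ne) mul0r.
- by rewrite mul1mx mulmx1.
(* For the equivariant section h of p, t reads off the coefficients at the identity. Equivariance
   recovers the others, so the trace of t is [h *m p]. *)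
exists (\matrix_(i, j) h i (enum_rank (j, 1%g))).
rewrite -hp; apply/matrixP => i j; rewrite summxE [RHS]mxE.
rewrite (reindex (@enum_rank (free_index d))) /=; last exact/onW_bij/enum_rank_bij.
under [RHS]eq_bigr do rewrite mxE enum_rankK.
rewrite (eq_bigr (fun a : free_index d => if a.2 \in L then
   h i (enum_rank (a.1, a.2)) * rP a.2 a.1 j else 0)); last first.
  by move=> [a1 a2] _ /=; case: ifP => // _; rewrite mulr0.
rewrite -(pair_bigA _ (fun a1 a2 => if a2 \in L then
   h i (enum_rank (a1, a2)) * rP a2 a1 j else 0)) /= exchange_big /=.
rewrite [RHS](bigID (mem L)) /= [X in _ = _ + X]big1 ?addr0; last first.
  by move=> g /negPf gL; apply: big1 => a _; rewrite gL.
rewrite (reindex_inj invg_inj) /=; apply: eq_big => [g|g gL]; first by rewrite groupV.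
rewrite groupV in gL; rewrite mxE gL invgK; apply: eq_bigr => a _; congr (_ * _).
have := hE _ (groupVr gL) => /matrixP /(_ i (enum_rank (a, 1%g))).
rewrite !mxE => e; rewrite -[LHS]/(\sum_j _ _ _ * _ _ _) in e *.
under eq_bigr do rewrite mxE.
rewrite e (bigD1 (enum_rank (a, g))) //= big1 ?addr0; last first.
  move=> v ne; rewrite mxE enum_rankK.
  rewrite xpair_eqE; case: eqP => [e1|]; last by rewrite mulr0.
  case: eqP => [e2|]; last by rewrite mulr0.
  case/eqP: ne; apply: enum_val_inj; rewrite enum_rankK.
  by rewrite [enum_val v]surjective_pairing -e1; congr (_, _); rewrite -(mulgKV g (_).2) -e2 mul1g.
by rewrite !mxE !enum_rankK /= mulgV eqxx mulr1.
Qed.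

End Projective.

Section Averaging.
Local Open Scope ring_scope.
Variables (gT : finGroupType) (L : {group gT}) (d : nat).
Variables (rP : mx_representation 'F_2 L d).

Definition trace_mx : 'M['F_2]_d :=
  odflt 0 [pick t | \sum_(g in L) rP g *m t *m rP g^-1%g == 1%:M].

Hypothesis prP : projective rP.

Lemma trace_mxP : \sum_(g in L) rP g *m trace_mx *m rP g^-1%g = 1%:M.
Proof.
rewrite /trace_mx; case: pickP => [t /eqP //|none].
by have [t /eqP] := projective_trace prP; rewrite none.
Qed.

(** On a projective module the norm from coinvariants to invariants is surjective;
    [norm0_functional] expresses its injectivity. *)
Lemma invariant_norm (v : 'rV_d) : {in L, forall g, v *m rP g = v} ->
  exists w, \sum_(g in L) w *m rP g = v.
Proof.
move=> inv; exists (v *m trace_mx).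
rewrite -[RHS]mulmx1 -trace_mxP mulmx_sumr (reindex_inj invg_inj) /=.
by apply: eq_big => [g|g gL]; rewrite ?groupV // !mulmxA inv // -groupV.
Qed.

Lemma norm0_functional (m : 'rV_d) (a : 'cV_d) :
  {in L, forall g, rP g *m a = a} -> \sum_(g in L) m *m rP g = 0 -> m *m a = 0.
Proof.
move=> inv m0; rewrite -[m]mulmx1 -trace_mxP mulmx_sumr mulmx_suml.
rewrite (eq_bigr (fun g => m *m rP g *m (trace_mx *m a))); last first.
  by move=> g gL; rewrite !mulmxA -[LHS]mulmxA inv ?groupV // !mulmxA.
by rewrite -mulmx_suml m0 mul0mx.
Qed.

Lemma invariant_functional_trace (a : 'cV_d) :
  {in L, forall g, rP g *m a = a} -> a = \sum_(g in L) rP g *m (trace_mx *m a).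
Proof.
move=> inv; rewrite -[LHS]mul1mx -trace_mxP mulmx_suml.
by apply: eq_bigr => g gL; rewrite -mulmxA inv ?groupV // mulmxA.
Qed.

(** Makes a linear map equivariant without dividing by the order of L: the trace identity for
    [trace_mx] takes the place of the division. A solution h of h D = f found by linear algebra
    remains one if D and f are equivariant. *)
Definition average c (act : gT -> 'M['F_2]_c) (h : 'M_(d, c)) : 'M_(d, c) :=
  \sum_(g in L) rP g *m trace_mx *m h *m act g^-1%g.

Lemma average_equivariant c (act : gT -> 'M_c) h :
  {in L &, forall g k, act (g * k)%g = act g *m act k} ->
  {in L, forall g, rP g *m average act h = average act h *m act g}.
Proof.
move=> actM g gL; rewrite mulmx_sumr mulmx_suml [RHS](reindex_inj (mulgI g)) /=.
apply: eq_big => [k|k kL]; first by rewrite groupMl.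
rewrite -[RHS]mulmxA -actM ?groupV ?groupM // invMg mulgKV.
by rewrite repr_mxM // !mulmxA.
Qed.

Lemma average_comp c c' (act : gT -> 'M_c) (act' : gT -> 'M_c') h
    (D : 'M_(c, c')) f :
  {in L, forall g, act g *m D = D *m act' g} ->
  {in L, forall g, rP g *m f = f *m act' g} ->
  h *m D = f -> average act h *m D = f.
Proof.
move=> actD fE hD; rewrite mulmx_suml -[RHS]mul1mx -trace_mxP mulmx_suml.
apply: eq_bigr => g gL; have gVL := groupVr gL.
by rewrite -[LHS]mulmxA (actD _ gVL) -[RHS]mulmxA (fE _ gVL) -hD !mulmxA.
Qed.

Lemma average_sub c c' (act : gT -> 'M_c) (B : 'M_(c', c)) h :
  {in L, forall g, (B *m act g <= B)%MS} -> (h <= B)%MS ->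
  (average act h <= B)%MS.
Proof.
move=> actB hB; apply: summx_sub => g gL; apply: submx_trans (actB g^-1%g _).
  by apply: submxMr; apply: mulmx_sub.
by rewrite groupV.
Qed.

End Averaging.

(** * Lifting in complete resolutions, and strings *)

Section Resolution.
Local Open Scope ring_scope.
Variables (gT : finGroupType) (L : {group gT}) (P : complete_resolution L).

Lemma cdiff_cdiff i j h : cdiff P i j *m cdiff P j h = 0.
Proof.
have [->|ne] := eqVneq i (j + 1); last by rewrite cdiff_off ?mul0mx.
have [e|ne] := eqVneq j (h + 1); last by rewrite (cdiff_off P ne) mulmx0.
have eh : h = j - 1 by rewrite e addrK.
have /andP[_ le] := cdiff_exact P j.
by rewrite eh; apply/eqP; rewrite -sub_kermx.
Qed.

(** Degrees are tied by equations instead of being written as sums, so that the lemma applies to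
    indices such as [j.+1%:Z] without casts. *)
Lemma cdiff_lift h i j m (x : 'M_(m, cdim P i)) : i = j + 1 -> h = i + 1 ->
  x *m cdiff P i j = 0 -> (x <= cdiff P h i)%MS.
Proof.
move=> ei -> /eqP; have -> : j = i - 1 by rewrite ei addrK.
rewrite -sub_kermx.
have /andP[le _] := cdiff_exact P i.
by move=> /submx_trans; apply.
Qed.

Lemma cdiff_eps i : cdiff P i 0%:Z *m ceps P = 0.
Proof.
have [->|ne] := eqVneq i (0%:Z + 1); last by rewrite cdiff_off ?mul0mx.
have /andP[_ le] := ceps_exact P.
by apply/eqP; rewrite -sub_kermx.
Qed.

Lemma ceps_lift h m (x : 'M_(m, cdim P 0%:Z)) : h = 1%:Z ->
  x *m ceps P = 0 -> (x <= cdiff P h 0%:Z)%MS.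
Proof.
move=> -> /eqP; rewrite -sub_kermx.
have /andP[le _] := ceps_exact P.
by move=> /submx_trans; apply.
Qed.

Lemma exists_augmentation1 : exists u : 'rV_(cdim P 0%:Z), u *m ceps P = 1%:M.
Proof.
have := ceps_neq0 P; move: (ceps P) => e e0.
suff : (1%:M <= e)%MS by case/submxP=> u ->; exists u.
rewrite sub1mx.
have: \rank e != 0%N by rewrite mxrank_eq0.
by rewrite /row_full; have := rank_leq_col e; case: (\rank e) => [|[|]].
Qed.

End Resolution.

Section Strings.
Local Open Scope ring_scope.

(* A string for an operator k of square 1 is the image of the standard
   generators under a chain map from the standard resolution of the group of
   order two, multiplied by c. *)
Definition is_string (C : nat -> nat) (d : forall j, 'M['F_2]_(C j.+1, C j))
    (eps : 'cV['F_2]_(C 0)) (k : forall j, 'M['F_2]_(C j)) (c : 'F_2)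
    (U : forall j, 'rV['F_2]_(C j)) : Prop :=
  U 0 *m eps = c%:M /\ forall j, U j.+1 *m d j = U j + U j *m k j.

(* Exactness of the subcomplex formed by the row spaces of the B j. *)
Definition exact_on (C : nat -> nat) (d : forall j, 'M['F_2]_(C j.+1, C j))
    (eps : 'cV['F_2]_(C 0)) (B : forall j, 'M['F_2]_(C j)) : Prop :=
  (forall m (x : 'M_(m, C 0)), (x <= B 0)%MS -> x *m eps = 0 ->
     (x <= B 1 *m d 0)%MS) /\
  forall j m (x : 'M_(m, C j.+1)), (x <= B j.+1)%MS -> x *m d j = 0 ->
     (x <= B j.+2 *m d j.+1)%MS.

Variables (C : nat -> nat) (d : forall j, 'M['F_2]_(C j.+1, C j)).
Variables (eps : 'cV['F_2]_(C 0)) (B : forall j, 'M['F_2]_(C j)).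
Hypothesis ex : exact_on d eps B.

Section Operator.
Variables (k : forall j, 'M['F_2]_(C j)).
Hypothesis kd : forall j, d j *m k j = k j.+1 *m d j.
Hypothesis kB : forall j, (B j *m k j <= B j)%MS.
Hypothesis kk : forall j, k j *m k j = 1%:M.

(** Two chain maps out of a free resolution with the same augmentation are homotopic: Z is the
    homotopy on e_j and Y the one on e_(j-1). An invariant cocycle kills Y (1 + k) and Z d, so it
    cannot tell U from V. *)
Lemma string_sub_homotopy c U V :
  is_string d eps k c U -> (forall j, (U j <= B j)%MS) ->
  is_string d eps k c V -> (forall j, (V j <= B j)%MS) ->
  forall j, exists Y Z, [/\ (Y <= B j)%MS, (Z <= B j.+1)%MS &
    U j + V j = Y + Y *m k j + Z *m d j].
Proof.
move=> [U0 dU] UB [V0 dV] VB.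
have lift j (x : 'rV_(C j)) : (x <= B j.+1 *m d j)%MS ->
    exists2 Z, (Z <= B j.+1)%MS & x = Z *m d j.
  by case/submxP=> y ->; exists (y *m B j.+1); rewrite ?submxMl // mulmxA.
elim=> [|j [Y [Z [YB ZB e]]]].
  have [] := lift 0 (U 0 + V 0).
    by apply: ex.1; rewrite ?addmx_sub // mulmxDl U0 V0 F2_double.
  move=> Z ZB ->; exists 0, Z; split; rewrite ?sub0mx //.
  by rewrite mul0mx !add0r.
have [] := lift j.+1 (U j.+1 + V j.+1 + (Z + Z *m k j.+1)).
  apply: ex.2.
    rewrite !addmx_sub // (submx_trans _ (kB _)) // submxMr //.
  rewrite !mulmxDl dU dV -mulmxA -kd mulmxA.
  rewrite [X in X + _]addrACA -mulmxDl (_ : _ + _ *m k j = Z *m d j + Z *m d j *m k j) ?F2_double //.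
  rewrite e !mulmxDl -[Y *m _ *m _]mulmxA kk mulmx1.
  by rewrite [Y *m k j + Y]addrC addrACA F2_double add0r.
move=> Z' Z'B e'; exists Z, Z'; split=> //.
by rewrite -e' [RHS]addrC F2_addK.
Qed.

End Operator.

End Strings.

Lemma Posz_succ j : j.+1%:Z%R = (j%:Z + 1)%R.
Proof. by rewrite -addn1 PoszD. Qed.

(** * Classes and their restrictions to involutions *)

Section Classes.
Local Open Scope ring_scope.
Variables (gT : finGroupType) (L : {group gT}) (P : complete_resolution L).

Lemma cochainP m (a : 'cV_(cdim P m)) :
  reflect {in L, forall g, crep P m g *m a = a} (cochain a).
Proof. by apply: (iffP forall_inP) => h g gL; apply/eqP; apply: h. Qed.

Lemma is_cocycleE m h (a : 'cV_(cdim P m)) : h = m + 1 ->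
  is_cocycle a = cochain a && (cdiff P h m *m a == 0).
Proof. by move=> ->. Qed.

Lemma is_cocycleP m (a : 'cV_(cdim P m)) :
  reflect ({in L, forall g, crep P m g *m a = a} /\
           forall h, cdiff P h m *m a = 0) (is_cocycle a).
Proof.
apply: (iffP andP) => [[/cochainP ha /eqP da]|[ha da]]; split=> //.
- move=> h; have [->//|ne] := eqVneq h (m + 1).
  by rewrite cdiff_off ?mul0mx.
- by apply/cochainP.
- by rewrite da eqxx.
Qed.

Lemma is_coboundary_tateP m (a : 'cV_(cdim P m)) :
  reflect (exists2 b : 'cV_(cdim P (m - 1)), {in L, forall g, crep P (m - 1) g *m b = b}
              & a = cdiff P m (m - 1) *m b) (is_coboundary_vec tate a).
Proof.
apply: (iffP existsP) => [[b /andP[/cochainP hb /eqP e]]|[b hb e]].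
  by exists b.
by exists b; rewrite e eqxx andbT; apply/cochainP.
Qed.

(** Treats both theories at once: in ordinary degree 0 only 0 is a coboundary, and in all other
    cases a is d b. *)
Lemma is_coboundary_mul0 t m (a : 'cV_(cdim P m)) (v : 'rV_(cdim P m)) :
  is_coboundary_vec t a ->
  (forall b : 'cV_(cdim P (m - 1)), {in L, forall g, crep P (m - 1) g *m b = b} ->
     v *m cdiff P m (m - 1) *m b = 0) ->
  v *m a = 0.
Proof.
move=> cob h.
have B : [exists b, cochain b && (a == cdiff P m (m - 1) *m b)] -> v *m a = 0.
  by case/existsP=> b /andP[/cochainP hb /eqP->]; rewrite mulmxA h.
by move: cob; case: t => //=; case: ifP => // _ /eqP->; rewrite mulmx0.
Qed.

Variable t : theory.

Lemma represented_cocycle m (x : cohomology P t m) a :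
  represented x a -> is_cocycle a.
Proof. by case=> z <- _; exact: cocycleP z. Qed.

Lemma represented_ex m (x : cohomology P t m) : exists a, represented x a.
Proof. by exists (val (generic_quotient.repr x)), (generic_quotient.repr x); rewrite ?generic_quotient.reprK. Qed.

Lemma cocycle_represents m (a : 'cV_(cdim P m)) :
  is_cocycle a -> exists x : cohomology P t m, represented x a.
Proof. by move=> ha; exists (\pi_(cohomology P t m) (Cocycle ha))%qT, (Cocycle ha). Qed.

Lemma represented_eq m (x y : cohomology P t m) a b :
  represented x a -> represented y b ->
  x = y <-> is_coboundary_vec t (a - b).
Proof.
case=> z <- -> [w <- ->].
rewrite -raddfB -[is_coboundary_vec _ _]/(z - w \in @is_coboundary _ _ P t m).
split=> [/eqP e|e]; first by rewrite Quotient.idealrBE.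
by apply/eqP; rewrite -Quotient.idealrBE.
Qed.

Lemma represented0 m : represented (0 : cohomology P t m) 0.
Proof.
by exists 0 => //; rewrite raddf0.
Qed.

Lemma represented_fun m (x y : cohomology P t m) a :
  represented x a -> represented y a -> x = y.
Proof.
case=> z <- -> [w e ->]; congr (\pi_(_) _)%qT.
by apply: val_inj.
Qed.

End Classes.

Section InvolutionCharacters.
Local Open Scope ring_scope.
Variables (gT : finGroupType) (L : {group gT}) (P : complete_resolution L).

Lemma resolution_exact : exact_on (C := fun j => cdim P j%:Z)
  (fun j => cdiff P j.+1%:Z j%:Z) (ceps P) (fun j => 1%:M).
Proof.
split=> [m x _|j m x _]; rewrite mul1mx; first exact: ceps_lift.
exact: cdiff_lift (Posz_succ j) (Posz_succ j.+1).
Qed.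

Definition pstring (k : gT) :=
  @is_string (fun j => cdim P j%:Z) (fun j => cdiff P j.+1%:Z j%:Z) (ceps P)
    (fun j => crep P j%:Z k).

Section Involution.
Variable k : gT.
Hypotheses (kL : k \in L) (kk : (k * k)%g = 1%g).

Lemma crep_sqr j : crep P j k *m crep P j k = 1%:M.
Proof. by rewrite -repr_mxM // kk repr_mx1. Qed.

Lemma pstring_value c U V m (b : 'cV_(cdim P m%:Z)) : is_cocycle b ->
  pstring k c U -> pstring k c V -> U m *m b = V m *m b.
Proof.
move=> /is_cocycleP[kb db] sU sV.
have [|||||Y [Z [_ _ e]]] := string_sub_homotopy resolution_exact _ _ _ sU _ sV _ m.
- by move=> j; rewrite cdiff_equivariant.
- by move=> j; exact: submx1.
- by move=> j; exact: crep_sqr.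
- by move=> j; exact: submx1.
- by move=> j; exact: submx1.
apply/eqP; rewrite -subr_eq0 F2_opp -mulmxDl e !mulmxDl -!mulmxA kb // db mulmx0.
by rewrite addr0 F2_double.
Qed.

End Involution.

Definition augmentation1 : 'rV_(cdim P 0%:Z) := 1%:M *m pinvmx (ceps P).

Lemma augmentation1P : augmentation1 *m ceps P = 1%:M.
Proof. by have [u e] := exists_augmentation1 P; rewrite mulmxKpV // -e submxMl. Qed.

Fixpoint standard_string (k : gT) (j : nat) : 'rV_(cdim P j%:Z) :=
  if j is j'.+1 then
    (standard_string k j' + standard_string k j' *m crep P j'%:Z k)
      *m pinvmx (cdiff P j'.+1%:Z j'%:Z)
  else augmentation1.

Lemma standard_stringP k : k \in L -> (k * k)%g = 1%g ->
  pstring k 1 (standard_string k).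
Proof.
move=> kL kk; split=> [|j]; rewrite /= ?augmentation1P // mulmxKpV //.
elim: j => [|j IH].
  apply: ceps_lift => //.
  by rewrite mulmxDl -[_ *m crep _ _ _ *m _]mulmxA ceps_equivariant // F2_double.
apply: (cdiff_lift (Posz_succ j) (Posz_succ j.+1)).
rewrite mulmxDl -[_ *m crep _ _ _ *m _]mulmxA cdiff_equivariant // mulmxA.
rewrite mulmxKpV // mulmxDl -!mulmxA crep_sqr // mulmx1.
by rewrite [X in _ + X]addrC F2_double.
Qed.

Lemma pstringZ k a c U : pstring k c U -> pstring k (a * c) (fun j => a *: U j).
Proof.
move=> [U0 dU]; split=> [|j]; first by rewrite -scalemxAl U0 scale_scalar_mx.
by rewrite -scalemxAl dU scalerDr scalemxAl.
Qed.

Lemma pstring_coboundary k c U m (b : 'cV_(cdim P m%:Z)) :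
  k \in L -> pstring k c U -> is_coboundary_vec ordinary b -> U m *m b = 0.
Proof.
move=> kL [_ dU] cob; case: m b cob => [b /eqP->|m b cob]; first by rewrite mulmx0.
apply: (is_coboundary_mul0 cob).
have -> : m.+1%:Z - 1 = m%:Z by rewrite Posz_succ addrK.
by move=> b' hb'; rewrite dU mulmxDl -mulmxA hb' // F2_double.
Qed.

(* The restriction of x to the subgroup generated by k, for k of square 1. *)
Definition chi (k : gT) (m : nat) (x : cohomology P ordinary m%:Z) : 'F_2 :=
  (standard_string k m *m val (generic_quotient.repr x)) 0 0.

Lemma chiE k m (x : cohomology P ordinary m%:Z) b c U :
  k \in L -> (k * k)%g = 1%g -> represented x b -> pstring k c U ->
  U m *m b = (c * chi k x)%:M.
Proof.
move=> kL kk xb sU.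
have sS := pstringZ c (standard_stringP kL kk); rewrite mulr1 in sS.
rewrite (pstring_value kL kk (represented_cocycle xb) sU sS) -scalemxAl.
rewrite -scale_scalar_mx; congr (_ *: _).
have xr : represented x (val (generic_quotient.repr x)).
  by exists (generic_quotient.repr x); rewrite ?generic_quotient.reprK.
have /(pstring_coboundary kL (standard_stringP kL kk)) := (represented_eq xb xr).1 erefl.
rewrite mulmxBr => /eqP; rewrite subr_eq0 => /eqP ->.
by rewrite /chi [LHS]mx11_scalar.
Qed.

Lemma chi_coef k m (x : cohomology P ordinary m%:Z) b U :
  k \in L -> (k * k)%g = 1%g -> represented x b -> pstring k 1 U ->
  chi k x = (U m *m b) 0 0.
Proof. by move=> kL kk xb sU; rewrite (chiE kL kk xb sU) mul1r mxE eqxx. Qed.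

Lemma chi_degree0 k (x : cohomology P ordinary 0%:Z) c :
  k \in L -> (k * k)%g = 1%g -> represented x (c *: ceps P) -> chi k x = c.
Proof.
move=> kL kk xc; rewrite (chi_coef kL kk xc (standard_stringP kL kk)).
by rewrite -scalemxAr augmentation1P !mxE eqxx mulr1.
Qed.

(** Translating a string for k by g gives a string for k^g with the same values on invariant
    functionals. *)
Lemma chi_conj k g m (x : cohomology P ordinary m%:Z) :
  k \in L -> (k * k)%g = 1%g -> g \in L -> chi (k ^ g)%g x = chi k x.
Proof.
move=> kL kk gL; have [b xb] := represented_ex x.
have sS := standard_stringP kL kk.
have sU : pstring (k ^ g)%g 1 (fun j => standard_string k j *m crep P j%:Z g).
  case: sS => S0 dS; split=> [|j]; first by rewrite -mulmxA ceps_equivariant.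
  rewrite -mulmxA cdiff_equivariant // mulmxA dS mulmxDl; congr (_ + _).
  by rewrite -!mulmxA -!repr_mxM ?groupJ // -conjgC.
rewrite (chi_coef _ _ xb sU) ?groupJ // -?conjMg ?kk ?conj1g //.
rewrite (chi_coef kL kk xb sS) -mulmxA.
by have /is_cocycleP[-> //] := represented_cocycle xb.
Qed.

Definition chi_sum (m : nat) (x : cohomology P ordinary m%:Z) : 'F_2 :=
  \sum_(k in L | (k * k == 1)%g) chi k x.

Lemma chi_sum_degree0 (x : cohomology P ordinary 0%:Z) c :
  ~~ odd #|L| -> represented x (c *: ceps P) -> chi_sum x = 0.
Proof.
move=> ev xc; rewrite /chi_sum (eq_bigr (fun=> c * 1)); last first.
  by move=> k /andP[kL /eqP kk]; rewrite mulr1 (chi_degree0 kL kk xc).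
by rewrite -mulr_sumr (even_card_sqr1 ev) mulr0.
Qed.

Lemma represented_degree0 (x : cohomology P ordinary 0%:Z) :
  exists c, represented x (c *: ceps P).
Proof.
have [a xa] := represented_ex x; have /is_cocycleP[_ da] := represented_cocycle xa.
exists ((augmentation1 *m a) 0 0); rewrite -mul_mx_scalar -mx11_scalar.
(* The image of 1 - eps u lies in the kernel of eps, hence consists of boundaries, where the cocycle
   a vanishes; so a = eps (u a). *)
have : (1%:M - ceps P *m augmentation1) *m ceps P = 0.
  by rewrite mulmxBl mul1mx -mulmxA augmentation1P mulmx1 subrr.
move/(ceps_lift (erefl 1%:Z))/submxP => [y e].
have : (1%:M - ceps P *m augmentation1) *m a = 0 by rewrite e -mulmxA da mulmx0.
by rewrite mulmxBl mul1mx -mulmxA => /eqP; rewrite subr_eq0 => /eqP <-.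
Qed.

Lemma represented_degree0_inj (x : cohomology P ordinary 0%:Z) a b :
  represented x a -> represented x b -> a = b.
Proof.
move=> xa xb; have := (represented_eq xa xb).1 erefl.
by rewrite /is_coboundary_vec eqxx subr_eq0 => /eqP.
Qed.

Lemma cocycle_ceps c : is_cocycle (c *: ceps P).
Proof.
apply/is_cocycleP; split=> [g gL|h]; rewrite -scalemxAr ?ceps_equivariant //.
by rewrite cdiff_eps scaler0.
Qed.

Lemma represented_one_class : represented (one_class P) (ceps P).
Proof.
have := cocycle_represents ordinary (cocycle_ceps 1); rewrite scale1r => ex.
exact: (classical_sets.xgetPex 0 ex).
Qed.

End InvolutionCharacters.

(** * Diagonals and slant products *)

Section Diagonals.
Local Open Scope ring_scope.

Lemma mul_slant m p (M : 'M['F_2]_(m, p)) (a : 'cV_m) (b : 'cV_p) :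
  (a^T *m M *m b)^T = (M *m b)^T *m a.
Proof. by rewrite !trmx_mul trmxK mulmxA. Qed.

Variables (gT : finGroupType) (L : {group gT}) (P : complete_resolution L).

Lemma hom_diffE (f : hom_family P) i i' s s' t t' v :
  i = i' + 1 -> s' = s + 1 -> t' = t + 1 ->
  @hom_diff _ _ _ f i s t v =
  (cdiff P s' s)^T *m f i s' t v + f i s t' v *m cdiff P t' t
    + f i' s t (v *m cdiff P i i').
Proof. by move=> ei -> ->; have -> : i' = i - 1 by rewrite ei addrK. Qed.

Variable f : hom_family P.
Hypothesis df : diagonal f.

Lemma diagonal_diff i i' s s' t t' v :
  i = i' + 1 -> s' = s + 1 -> t' = t + 1 ->
  (cdiff P s' s)^T *m f i s' t v + f i s t' v *m cdiff P t' t
    + f i' s t (v *m cdiff P i i') = 0.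
Proof. by move=> ei es et; case: df => _ h _; rewrite -(hom_diffE _ _ ei es et) h. Qed.

Lemma diagonal_equivariant i s t g v : g \in L ->
  f i s t (v *m crep P i g) = (crep P s g)^T *m f i s t v *m crep P t g.
Proof. by case: df => -[_ h] _ _ gL; apply: h. Qed.

Lemma pairing_afterE (h : hom_family P) m q r (a : 'cV_(cdim P m))
    (b : 'cV_(cdim P q)) v :
  v *m pairing_after h r a b = a^T *m h r m q v *m b.
Proof.
rewrite /pairing_after.
pose F (v : 'rV_(cdim P r)) : 'rV['F_2]_1 := a^T *m h r m q v *m b.
have lF : linear F by move=> c x y; rewrite /F linearP mulmxDr mulmxDl -scalemxAr -scalemxAl.
pose HF := GRing.isLinear.Build _ _ _ _ F lF.
pose F' : {linear _ -> _} := HB.pack F HF.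
by rewrite (mul_rV_lin1 F').
Qed.

Lemma pairing_after_cocycle m q r (a : 'cV_(cdim P m)) (b : 'cV_(cdim P q)) :
  is_cocycle a -> is_cocycle b -> is_cocycle (pairing_after f r a b).
Proof.
move=> /is_cocycleP[ka da] /is_cocycleP[kb db]; rewrite (is_cocycleE _ erefl).
apply/andP; split.
  apply/cochainP => g gL; apply/row_matrixP => i; rewrite !rowE mulmxA !pairing_afterE.
  rewrite diagonal_equivariant // !mulmxA -trmx_mul ka // -!mulmxA kb //.
apply/eqP/row_matrixP => i; rewrite !rowE mulmxA pairing_afterE mulmx0.
have := diagonal_diff (delta_mx 0 i) (erefl (r + 1)) (erefl (m + 1)) (erefl (q + 1)).
move/(congr1 (fun M => a^T *m M *m b)); rewrite mulmx0 mul0mx !mulmxDr !mulmxDl.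
by rewrite mulmxA -trmx_mul da trmx0 !mul0mx -!mulmxA db !mulmx0 !add0r.
Qed.

Section Slant.
Variables (q : int) (b : 'cV['F_2]_(cdim P q)).
Hypothesis cb : is_cocycle b.

(** Cap product along the diagonal f, with b on the second factor ([slantl]: on the first). For a
    cocycle b it is an equivariant chain map lowering degrees by q. *)
Definition slantr i s (x : 'rV_(cdim P i)) : 'rV_(cdim P s) := (f i s q x *m b)^T.

Definition slantl i s (x : 'rV_(cdim P i)) : 'rV_(cdim P s) := b^T *m f i q s x.

Lemma slantr_linear i s : linear (@slantr i s).
Proof. by move=> c x y; rewrite /slantr linearP mulmxDl -scalemxAl linearP. Qed.

Lemma slantl_linear i s : linear (@slantl i s).
Proof. by move=> c x y; rewrite /slantl linearP mulmxDr -scalemxAr. Qed.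

Lemma slantr_equivariant i s g x : g \in L ->
  @slantr i s (x *m crep P i g) = slantr s x *m crep P s g.
Proof.
move=> gL; have /is_cocycleP[kb _] := cb.
by rewrite /slantr diagonal_equivariant // -[_ *m b]mulmxA kb // -mulmxA trmx_mul trmxK.
Qed.

Lemma slantl_equivariant i s g x : g \in L ->
  @slantl i s (x *m crep P i g) = slantl s x *m crep P s g.
Proof.
move=> gL; have /is_cocycleP[kb _] := cb.
by rewrite /slantl diagonal_equivariant // !mulmxA -trmx_mul kb.
Qed.

Lemma slantr_diff i i' s s' x : i = i' + 1 -> s' = s + 1 ->
  @slantr i s' x *m cdiff P s' s = slantr s (x *m cdiff P i i').
Proof.
move=> ei es; have /is_cocycleP[_ db] := cb.
have /(congr1 (fun M => (M *m b)^T)) := diagonal_diff x ei es (erefl (q + 1)).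
rewrite mul0mx trmx0 !mulmxDl -mulmxA -[_ *m b in X in _ + X + _]mulmxA db mulmx0 addr0.
by rewrite raddfD /= trmx_mul trmxK => /eqP; rewrite addr_eq0 F2_opp => /eqP.
Qed.

Lemma slantl_diff i i' s s' x : i = i' + 1 -> s' = s + 1 ->
  @slantl i s' x *m cdiff P s' s = slantl s (x *m cdiff P i i').
Proof.
move=> ei es; have /is_cocycleP[_ db] := cb.
have /(congr1 (fun M => b^T *m M)) := diagonal_diff x ei (erefl (q + 1)) es.
rewrite mulmx0 !mulmxDr !mulmxA -trmx_mul db trmx0 mul0mx add0r.
by move=> /eqP; rewrite addr_eq0 F2_opp => /eqP.
Qed.

End Slant.

HB.instance Definition _ q b i s :=
  GRing.isLinear.Build _ _ _ _ (@slantr q b i s) (@slantr_linear q b i s).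
HB.instance Definition _ q b i s :=
  GRing.isLinear.Build _ _ _ _ (@slantl q b i s) (@slantl_linear q b i s).

Lemma ceps_cocycle : is_cocycle (ceps P).
Proof. by rewrite -[ceps P]scale1r cocycle_ceps. Qed.

Lemma slantl_ceps k c U : k \in L -> pstring k c U ->
  pstring k c (fun j => slantl (ceps P) j%:Z (U j)).
Proof.
move=> kL [U0 dU]; split=> [|j].
  by case: df => _ _ e; rewrite /slantl e U0.
rewrite (slantl_diff ceps_cocycle _ (Posz_succ j) (Posz_succ j)) dU linearD /=.
by rewrite slantl_equivariant ?ceps_cocycle.
Qed.

Lemma slantr_ceps k c U : k \in L -> pstring k c U ->
  pstring k c (fun j => slantr (ceps P) j%:Z (U j)).
Proof.
move=> kL [U0 dU]; split=> [|j].
  rewrite /slantr -mul_slant; case: df => _ _ ->.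
  by rewrite U0 tr_scalar_mx.
rewrite (slantr_diff ceps_cocycle _ (Posz_succ j) (Posz_succ j)) dU linearD /=.
by rewrite slantr_equivariant ?ceps_cocycle.
Qed.

Section Characters.
Variables (k : gT) (q : nat) (x : cohomology P ordinary q%:Z) (b : 'cV['F_2]_(cdim P q%:Z)).
Hypotheses (kL : k \in L) (kk : (k * k)%g = 1%g) (xb : represented x b).

(** The slant shifts a string by q degrees. Its augmentation is eps on the slant of U_q by b, that
    is, b on the slant of U_q by eps; and slanting with eps gives a string again, on which b
    evaluates to c times [chi]. This is the source of multiplicativity. *)
Lemma slantr_pstring c U : pstring k c U ->
  pstring k (c * chi k x) (fun j => slantr b j%:Z (U (q + j)%N)).
Proof.
have cb := represented_cocycle xb.
move=> sU; case: (sU) => U0 dU; split=> [|j]; last first.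
  by rewrite addnS (slantr_diff cb _ (Posz_succ (q + j)) (Posz_succ j)) // dU linearD /= slantr_equivariant.
rewrite /slantr -mul_slant addn0.
have := chiE kL kk xb (slantl_ceps kL sU).
by rewrite /slantl => ->; rewrite tr_scalar_mx.
Qed.

Lemma slantl_pstring c U : pstring k c U ->
  pstring k (c * chi k x) (fun j => slantl b j%:Z (U (q + j)%N)).
Proof.
have cb := represented_cocycle xb.
move=> sU; case: (sU) => U0 dU; split=> [|j]; last first.
  by rewrite addnS (slantl_diff cb _ (Posz_succ (q + j)) (Posz_succ j)) // dU linearD /= slantl_equivariant.
have := chiE kL kk xb (slantr_ceps kL sU).
by rewrite /slantr /slantl addn0 -mul_slant => /(congr1 trmx); rewrite trmxK tr_scalar_mx.
Qed.

End Characters.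
End Diagonals.

Section Power.
Local Open Scope ring_scope.
Variables (gT : finGroupType) (L : {group gT}) (P : complete_resolution L).
Variables (f0 : hom_family P) (df0 : diagonal f0).

(** f0 witnesses that the chosen class exists; the diagonal f obtained is the one behind that
    choice. *)
Lemma cup_represented t1 t2 t m q r (x : cohomology P t1 m) (y : cohomology P t2 q) :
  exists f a b, [/\ diagonal f, represented x a, represented y b
    & represented (cup t r x y) (pairing_after f r a b)].
Proof.
have [a xa] := represented_ex x; have [b yb] := represented_ex y.
have [z zp] := cocycle_represents t (pairing_after_cocycle df0 r
  (represented_cocycle xa) (represented_cocycle yb)).
rewrite /cup.
have ex : exists z : cohomology P t r, exists f a b,
  [/\ diagonal f, represented x a, represented y b
    & represented z (pairing_after f r a b)] by exists z, f0, a, b.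
exact: (classical_sets.xgetPex 0 ex).
Qed.

Lemma chi_cup k m q (x : cohomology P ordinary m%:Z) (y : cohomology P ordinary q%:Z) :
  k \in L -> (k * k)%g = 1%g ->
  chi k (cup ordinary (m + q)%N%:Z x y) = chi k x * chi k y.
Proof.
move=> kL kk; have [f [a [b [df xa yb zp]]]] := cup_represented ordinary (m + q)%N%:Z x y.
have sS := standard_stringP P kL kk.
rewrite (chi_coef kL kk zp sS) pairing_afterE.
have := chiE kL kk yb (slantl_pstring df kL kk xa sS).
by rewrite /slantl => ->; rewrite mxE eqxx mul1r.
Qed.

Lemma chi_power k n i (x : cohomology P ordinary i%:Z) :
  k \in L -> (k * k)%g = 1%g -> chi k (power n x) = chi k x ^+ n.
Proof.
move=> kL kk; elim: n => [|n IH].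
  rewrite expr0; apply: (@chi_degree0 _ _ _ k (power 0 x)) => //.
  by rewrite scale1r; apply: represented_one_class.
by rewrite exprS -IH -chi_cup.
Qed.

Lemma chi_sum_power n i (x : cohomology P ordinary i%:Z) : (0 < n)%N ->
  chi_sum (power n x) = chi_sum x.
Proof.
move=> n0; apply: eq_bigr => k /andP[kL /eqP kk].
by rewrite chi_power // F2_exp.
Qed.

End Power.

(** * The dual operations in degree 0 *)

(* w generates the kernel of the differential on the coinvariants of P_m, m = -1,
   so that evaluation at w identifies \hat H^(-1) with k. *)
Section DegreeMinusOne.
Local Open Scope ring_scope.
Variables (gT : finGroupType) (L : {group gT}) (P : complete_resolution L).
Variables (m : int) (hm : 0%:Z = m + 1).

Let u := augmentation1 P.
Let v := u *m cdiff P 0%:Z m.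

(** A complete resolution is spliced at k: P_0 -> P_(-1) is eps followed by an embedding of k, which
    sends 1 to v. *)
Lemma cdiff0_factor : cdiff P 0%:Z m = ceps P *m v.
Proof.
have /(ceps_lift (erefl 1%:Z))/submxP [y e] : (1%:M - ceps P *m u) *m ceps P = 0.
  by rewrite mulmxBl mul1mx -mulmxA augmentation1P mulmx1 subrr.
apply/eqP; rewrite -subr_eq0 /v mulmxA -[X in X - _]mul1mx -mulmxBl e.
by rewrite -mulmxA cdiff_cdiff mulmx0.
Qed.

Lemma generator_invariant : {in L, forall g, v *m crep P m g = v}.
Proof.
move=> g gL; rewrite /v -mulmxA -cdiff_equivariant // mulmxA cdiff0_factor !mulmxA.
by rewrite -[_ *m ceps P]mulmxA ceps_equivariant.
Qed.

Lemma generator_neq0 : v != 0.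
Proof.
apply/eqP => v0; have := cdiff_lift (j := m) hm (erefl (0 + 1)) v0.
case/submxP => y e; have := augmentation1P P; rewrite -/u e -mulmxA.
rewrite cdiff_eps mulmx0 => /matrixP /(_ 0 0).
by rewrite !mxE eqxx => /eqP; rewrite eq_sym oner_eq0.
Qed.

Lemma exists_norm_generator : exists w, \sum_(g in L) w *m crep P m g = v.
Proof. exact: (invariant_norm (@crep_projective _ _ P m) (v := v)) generator_invariant. Qed.

Variable w : 'rV['F_2]_(cdim P m).
Hypothesis hw : \sum_(g in L) w *m crep P m g = v.

Lemma norm_generator_cycle h (b : 'cV_(cdim P h)) :
  {in L, forall g, crep P h g *m b = b} -> w *m cdiff P m h *m b = 0.
Proof.
move=> kb; apply: (norm0_functional (@crep_projective _ _ P h)) kb _.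
rewrite (eq_bigr (fun g => w *m crep P m g *m cdiff P m h)); last first.
  by move=> g gL; rewrite -!mulmxA cdiff_equivariant.
by rewrite -mulmx_suml hw /v -mulmxA cdiff_cdiff mulmx0.
Qed.

Lemma coboundary_generator t (a : 'cV_(cdim P m)) :
  is_coboundary_vec t a -> w *m a = 0.
Proof. by move=> cob; apply: (is_coboundary_mul0 cob) => b; apply: norm_generator_cycle. Qed.

(** A functional of the form N l is invariant, so it suffices that a factor through D N, i.e. vanish
    on its kernel. If x D N = 0, then x N is a cycle, hence a multiple c v of v, which is the norm
    of c w; so x - c w has norm 0, and a takes the same value 0 on x as on c w. *)
Lemma generator_coboundary (a : 'cV_(cdim P m)) :
  is_cocycle a -> w *m a = 0 -> is_coboundary_vec tate a.
Proof.
move=> /is_cocycleP[ka da] wa.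
pose D := cdiff P m (m - 1); pose N h := \sum_(g in L) crep P h g.
have DN : D *m N (m - 1) = N m *m D.
  rewrite mulmx_sumr mulmx_suml; apply: eq_bigr => g gL.
  by rewrite cdiff_equivariant.
have ker (x : 'rV_(cdim P m)) : x *m (D *m N (m - 1)) = 0 -> x *m a = 0.
  rewrite DN mulmxA => /(cdiff_lift (etrans (esym (subrK 1 m)) erefl) hm)/submxP[y].
  rewrite cdiff0_factor mulmxA [y *m _]mx11_scalar mul_scalar_mx.
  set c := (y *m _) 0 0 => e.
  have : (x - c *: w) *m a = 0.
    apply: (norm0_functional (@crep_projective _ _ P m)) ka _.
    by rewrite -mulmx_sumr mulmxBl e -scalemxAl [w *m _]mulmx_sumr hw subrr.
  by rewrite mulmxBl -scalemxAl wa scaler0 subr0.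
apply/is_coboundary_tateP; exists (N (m - 1) *m (pinvmx (D *m N (m - 1)) *m a)).
  move=> g gL; rewrite mulmxA; congr (_ *m _).
  rewrite mulmx_sumr [RHS](reindex_inj (mulgI g)) /=.
  by apply: eq_big => [k|k kL]; rewrite ?groupMl // repr_mxM.
apply/row_matrixP => i; rewrite !rowE !mulmxA.
set M := D *m _ in ker *; set d := delta_mx _ _.
have : (d - d *m M *m pinvmx M) *m M = 0 by rewrite mulmxBl mulmxKpV ?subrr ?submxMl.
move/ker; rewrite mulmxBl => /eqP; rewrite subr_eq0 => /eqP -> .
by rewrite /M !mulmxA.
Qed.

(** a is the norm of a coordinate functional that is nonzero at v. Then w a is this coordinate of v,
    while v a is |L| times it; the latter vanishes for even |L|, which makes a a cocycle. *)
Lemma exists_generator : ~~ odd #|L| -> exists2 a : 'cV_(cdim P m),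
  is_cocycle a & w *m a = 1%:M.
Proof.
move=> evL; have [j vj] : exists j, v 0 j != 0.
  apply/existsP; rewrite -negb_forall; apply: contra generator_neq0 => /forallP h.
  by apply/eqP/rowP => j; rewrite (eqP (h j)) mxE.
pose a := \sum_(g in L) crep P m g *m delta_mx j (0 : 'I_1).
have va : v *m a = 0.
  rewrite mulmx_sumr (eq_bigr (fun=> v *m delta_mx j 0)); last first.
    by move=> g gL; rewrite mulmxA generator_invariant.
  by rewrite sumr_const -scaler_nat F2_natr (negPf evL) scale0r.
exists a.
  apply/is_cocycleP; split=> [g gL|h].
    rewrite mulmx_sumr [RHS](reindex_inj (mulgI g)) /=.
    by apply: eq_big => [k|k kL]; rewrite ?groupMl // repr_mxM ?mulmxA.
  have [->|ne] := eqVneq h 0%:Z; last by rewrite cdiff_off ?mul0mx // -hm.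
  by rewrite cdiff0_factor -mulmxA va mulmx0.
rewrite mulmx_sumr; under eq_bigr do rewrite mulmxA.
rewrite -mulmx_suml hw -colE [LHS]mx11_scalar mxE; congr (_%:M).
by case: (F2_case (v 0 j)) vj => ->; rewrite ?eqxx.
Qed.

End DegreeMinusOne.

Section Evaluation.
Local Open Scope ring_scope.

Definition bilin p q (l : 'cV['F_2]_p) (l' : 'cV['F_2]_q) (M : 'M['F_2]_(p, q)) : 'F_2 :=
  (l^T *m M *m l') 0 0.

Lemma bilinD p q (l : 'cV_p) (l' : 'cV_q) M M' :
  bilin l l' (M + M') = bilin l l' M + bilin l l' M'.
Proof. by rewrite /bilin mulmxDr mulmxDl mxE. Qed.

Lemma bilin0 p q (l : 'cV_p) (l' : 'cV_q) : bilin l l' 0 = 0.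
Proof. by rewrite /bilin mulmx0 mul0mx mxE. Qed.

Lemma bilinT p q (l : 'cV_p) (l' : 'cV_q) M : bilin l l' M^T = bilin l' l M.
Proof. by rewrite /bilin -trace_mx11 -mxtrace_tr !trmx_mul !trmxK mulmxA trace_mx11. Qed.

Lemma bilinMl p p' q (A : 'M_(p', p)) (l : 'cV_p) (l' : 'cV_q) M :
  bilin l l' (A^T *m M) = bilin (A *m l) l' M.
Proof. by rewrite /bilin trmx_mul !mulmxA. Qed.

Lemma bilinMr p q q' (A : 'M_(q', q)) (l : 'cV_p) (l' : 'cV_q) M :
  bilin l l' (M *m A) = bilin l (A *m l') M.
Proof. by rewrite /bilin !mulmxA. Qed.

Lemma bilinZl p q c (l : 'cV_p) (l' : 'cV_q) M :
  bilin (c *: l) l' M = c * bilin l l' M.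
Proof. by rewrite /bilin linearZ /= -!scalemxAl mxE. Qed.

Lemma bilinZr p q c (l : 'cV_p) (l' : 'cV_q) M :
  bilin l (c *: l') M = c * bilin l l' M.
Proof. by rewrite /bilin -scalemxAr mxE. Qed.

Lemma bilin0r p q (l : 'cV_p) M : bilin l (0 : 'cV_q) M = 0.
Proof. by rewrite /bilin mulmx0 mxE. Qed.

Lemma bilin_suml (I : finType) (R : pred I) p q (l : I -> 'cV_p) (l' : 'cV_q) M :
  bilin (\sum_(i | R i) l i) l' M = \sum_(i | R i) bilin (l i) l' M.
Proof. by rewrite /bilin raddf_sum !mulmx_suml summxE. Qed.

Lemma bilin_sumr (I : finType) (R : pred I) p q (l : 'cV_p) (l' : I -> 'cV_q) M :
  bilin l (\sum_(i | R i) l' i) M = \sum_(i | R i) bilin l (l' i) M.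
Proof. by rewrite /bilin mulmx_sumr summxE. Qed.

Lemma bilin_sum (I : finType) (R : pred I) p q (l : 'cV_p) (l' : 'cV_q) M :
  bilin l l' (\sum_(i | R i) M i) = \sum_(i | R i) bilin l l' (M i).
Proof. by rewrite /bilin mulmx_sumr mulmx_suml summxE. Qed.

End Evaluation.

(** * Evaluating the square of a trace through the homotopies theta_r *)

Section DualOperation.
Local Open Scope ring_scope.
Variables (gT : finGroupType) (L : {group gT}) (P : complete_resolution L).
Variable th : dual_power_system P.
Variables (m : int) (hm : 0%:Z = m + 1).

Let eps := ceps P.

Lemma theta_diffE r i i' s s' t t' v :
  i = i' + 1 -> s' = s + 1 -> t' = t + 1 ->
  (cdiff P s' s)^T *m th r i s' t v + th r i s t' v *m cdiff P t' t
    + th r i' s t (v *m cdiff P i i') =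
  if r is r'.+1 then th r' i s t v + (th r' i t s v)^T else 0.
Proof.
move=> ei es et; rewrite -(hom_diffE _ _ ei es et).
case: r => [|r]; last exact: theta_diff.
by case: (theta0 th) => _ h _; apply: h.
Qed.

Lemma bilin_theta_equivariant r i s t l l' g v : g \in L ->
  bilin l l' (th r i s t (v *m crep P i g)) =
  bilin (crep P s g *m l) (crep P t g *m l') (th r i s t v).
Proof.
move=> gL; have [_ h] := theta_hom th r.
by rewrite h // bilinMr bilinMl.
Qed.

Lemma crepM i p (x : 'M_(cdim P i, p)) g k : g \in L -> k \in L ->
  crep P i (g * k)%g *m x = crep P i g *m (crep P i k *m x).
Proof. by move=> gL kL; rewrite repr_mxM // mulmxA. Qed.

Lemma pairing_theta_cocycle q r I (a : 'cV_(cdim P q)) :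
  is_cocycle a -> is_cocycle (pairing_after (th I) r a a).
Proof.
move=> /is_cocycleP[ka da]; rewrite (is_cocycleE _ erefl); apply/andP; split.
  apply/cochainP => g gL; apply/row_matrixP => i; rewrite !rowE mulmxA !pairing_afterE.
  have [_ h] := theta_hom th I.
  by rewrite h // !mulmxA -trmx_mul ka // -!mulmxA ka.
apply/eqP/row_matrixP => i; rewrite !rowE mulmxA pairing_afterE mulmx0.
have := theta_diffE I (delta_mx 0 i) (erefl (r + 1)) (erefl (q + 1)) (erefl (q + 1)).
move/(congr1 (fun M => a^T *m M *m a)); rewrite !mulmxDr !mulmxDl.
rewrite mulmxA -trmx_mul da trmx0 !mul0mx -[_ *m _ *m _ in X in _ + X + _]mulmxA.
rewrite -[_ *m cdiff _ _ _ *m _]mulmxA da !mulmx0 !add0r => ->.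
case: I => [|I]; first by rewrite mulmx0 mul0mx.
rewrite mulmxDr mulmxDl.
(* a (x) a is symmetric, so it takes the same value on M and its transpose and kills (1 + tau) M. *)
set M := th _ _ _ _ _.
suff -> : a^T *m M^T *m a = a^T *m M *m a by rewrite F2_double.
rewrite [RHS]mx11_scalar -[_ 0 0]/(bilin a a M) -[in RHS]bilinT.
by rewrite [LHS]mx11_scalar.
Qed.

Section Chain.
Variables (l : 'cV['F_2]_(cdim P m)) (al : 'F_2).
Hypothesis hl : cdiff P 0%:Z m *m l = al *: eps.

Lemma cdiff_shift k : k \in L -> cdiff P 0%:Z m *m (crep P m k *m l) = al *: eps.
Proof.
by move=> kL; rewrite mulmxA -cdiff_equivariant // -mulmxA hl -scalemxAr ceps_equivariant.
Qed.

(** This is d theta_r = (1 + tau) theta_(r-1) evaluated at k l (x) l, where the differential turns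
    both l and its translate k l into al eps. *)
Lemma bilin_theta_mm r i i' (x : 'rV_(cdim P i)) k : i = i' + 1 -> k \in L ->
  bilin (crep P m k *m l) l (th r i' m m (x *m cdiff P i i')) =
  al * (bilin eps l (th r i 0%:Z m x) + bilin (crep P m k *m l) eps (th r i m 0%:Z x))
  + if r is r'.+1 then bilin (crep P m k *m l) l (th r' i m m x)
      + bilin l (crep P m k *m l) (th r' i m m x) else 0.
Proof.
move=> ei kL; set kl := crep P m k *m l.
have := theta_diffE r x ei hm hm.
move/(congr1 (fun M => bilin kl l M)); rewrite !bilinD bilinMl bilinMr hl cdiff_shift //.
rewrite bilinZl bilinZr -mulrDr => /F2_addKr ->.
congr (_ + _); case: r => [|r]; first by rewrite bilin0.
by rewrite bilinD bilinT.
Qed.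

Lemma bilin_theta_m0 r i i' (x : 'rV_(cdim P i)) : i = i' + 1 ->
  bilin l eps (th r i' m 0%:Z (x *m cdiff P i i')) =
  al * bilin eps eps (th r i 0%:Z 0%:Z x)
  + if r is r'.+1 then bilin l eps (th r' i m 0%:Z x)
      + bilin eps l (th r' i 0%:Z m x) else 0.
Proof.
move=> ei.
have := theta_diffE r x ei hm (erefl (0%:Z + 1)).
move/(congr1 (fun M => bilin l eps M)); rewrite !bilinD bilinMl bilinMr hl.
rewrite cdiff_eps bilin0r addr0 bilinZl => /F2_addKr ->.
congr (_ + _); case: r => [|r]; first by rewrite bilin0.
by rewrite bilinD bilinT.
Qed.

(* theta_I(e) is invariant and (1 + tau) theta_I(e) = d theta_(I+1)(e), so the terms
   of k and k^-1 differ by al (eps (x) l + l (x) eps) theta_(I+1)(e), which is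
   al^2 (eps (x) eps) theta_(I+2)(e) = 0 by the vanishing condition. *)
Lemma bilin_theta_inv h I (e : 'rV_(cdim P h)) k : k \in L -> h < 0 ->
  {in L, forall g, e *m crep P h g = e} -> e *m cdiff P h (h - 1) = 0 ->
  bilin (crep P m k^-1%g *m l) l (th I h m m e) =
  bilin (crep P m k *m l) l (th I h m m e).
Proof.
move=> kL h0 inv de; have eh : h = h - 1 + 1 by rewrite subrK.
have kV : bilin (crep P m k^-1%g *m l) l (th I h m m e) =
    bilin l (crep P m k *m l) (th I h m m e).
  have := bilin_theta_equivariant I (crep P m k^-1%g *m l) l e kL.
  by rewrite (inv k kL) -(crepM l kL (groupVr kL)) mulgV repr_mx1 mul1mx.
have ke : bilin (crep P m k *m l) eps (th I.+1 h m 0%:Z e) =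
    bilin l eps (th I.+1 h m 0%:Z e).
  have := bilin_theta_equivariant I.+1 l eps e kL.
  by rewrite (inv k kL) /eps (ceps_equivariant P kL).
have th_de r s t (l1 : 'cV_(cdim P s)) (l2 : 'cV_(cdim P t)) :
    bilin l1 l2 (th r (h - 1) s t (e *m cdiff P h (h - 1))) = 0.
  by rewrite de linear0 bilin0.
have v0 : bilin eps eps (th I.+2 h 0%:Z 0%:Z e) = 0.
  by rewrite theta_vanish ?bilin0.
have := bilin_theta_mm I.+1 e eh kL; have := bilin_theta_m0 I.+2 e eh.
rewrite !th_de v0 mulr0 add0r => /esym e1.
rewrite kV ke addrC [X in al * X]addrC e1 mulr0 addr0.
by move=> /esym/F2_addKr ->; rewrite addr0.
Qed.

Variables (k : gT) (I : nat).
Hypotheses (kL : k \in L) (kk : (k * k)%g = 1%g).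
Variable Y : forall r : nat, 'rV['F_2]_(cdim P (- r%:Z)).

Let T r := Y r *m cdiff P (- r%:Z) (- r.+1%:Z).
Let A r := if r is r'.+1 then
  bilin (crep P m k *m l) l (th r' (- r.+1%:Z) m m (T r)) else 0.
Let B r := bilin l eps (th r (- r.+1%:Z) m 0%:Z (T r)).

(* For k of square 1, A r + al B r does not depend on r: pushing theta_r(Y_r d)
   through d theta = theta d + (1 + tau) theta trades (1 + tau) for 1 + k, and
   Y_(r+1) (1 + k) = Y_r d. *)
Lemma bilin_theta_chain :
  (forall r, (r < I)%N -> T r = Y r.+1 + Y r.+1 *m crep P (- r.+1%:Z) k) ->
  A I + al * B I = al * (al * (Y 0 *m eps) 0 0).
Proof.
elim: I => [|r IH] hT.
  rewrite add0r /B (bilin_theta_m0 0 (Y 0)) //.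
  rewrite addr0; congr (_ * (_ * _)); rewrite /bilin.
  by case: (theta0 th) => _ _ ->.
rewrite -{}IH; last by move=> q qr; apply: hT; apply: leqW.
have {hT}hT := hT r (leqnn _); set x := Y r.+1 in hT.
have ei : - r.+1%:Z = - r.+2%:Z + 1 by lia.
have eA : A r.+1 = al * (bilin eps l (th r (- r.+1%:Z) 0%:Z m x)
     + bilin l eps (th r (- r.+1%:Z) m 0%:Z (x *m crep P _ k))) + A r.
  rewrite /A /T (bilin_theta_mm r x ei kL) bilin_theta_equivariant //.
  rewrite ceps_equivariant //; congr (_ + _); case: r @x {ei} hT => // r x hT.
  rewrite /T in hT; rewrite hT linearD bilinD; congr (_ + _).
  by rewrite (bilin_theta_equivariant _ _ _ _ kL) -(crepM l kL kL) kk repr_mx1 mul1mx.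
have eB : B r.+1 = bilin l eps (th r (- r.+1%:Z) m 0%:Z x)
     + bilin eps l (th r (- r.+1%:Z) 0%:Z m x).
  (* The eps (x) eps term vanishes: its source has negative degree and both factors have degree
     0. *)
  rewrite /B /T (bilin_theta_m0 r.+1 x ei) theta_vanish ?bilin0 ?mulr0 ?add0r //.
have eBr : B r = bilin l eps (th r (- r.+1%:Z) m 0%:Z x)
     + bilin l eps (th r (- r.+1%:Z) m 0%:Z (x *m crep P _ k)).
  by rewrite /B hT linearD bilinD.
rewrite eA eB eBr [LHS]addrAC [RHS]addrC -mulrDr; congr (_ * _ + _).
exact: F2_cancel_outer.
Qed.

End Chain.
End DualOperation.

Section DualFormula.
Local Open Scope ring_scope.
Variables (gT : finGroupType) (L : {group gT}) (P : complete_resolution L).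
Variable th : dual_power_system P.
Variables (m : int) (hm : 0%:Z = m + 1).

(** By equivariance of theta_I, the trace over g passes from k l (x) l to the argument c. *)
Lemma trace_square (a l : 'cV_(cdim P m)) h (c : 'rV_(cdim P h)) I :
  a = \sum_(g in L) crep P m g *m l ->
  bilin a a (th I h m m c) =
  \sum_(k in L) bilin (crep P m k *m l) l
    (th I h m m (\sum_(g in L) c *m crep P h g)).
Proof.
move=> ea; rewrite [in LHS]ea bilin_suml.
under eq_bigr do rewrite bilin_sumr.
rewrite exchange_big /=.
under [RHS]eq_bigr do rewrite linear_sum bilin_sum.
rewrite [RHS]exchange_big /=; apply: eq_bigr => g gL.
rewrite (reindex_inj (mulgI g)) /=; apply: eq_big => [k|k]; first by rewrite groupMl.
by rewrite groupMl // => kL; rewrite (bilin_theta_equivariant _ _ _ _ _ gL) -!crepM.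
Qed.

Variable w : 'rV['F_2]_(cdim P m).
Hypothesis hw : \sum_(g in L) w *m crep P m g = augmentation1 P *m cdiff P 0%:Z m.

Section Evaluate.
Variables (f : hom_family P) (df : diagonal f).
Variables (a : 'cV['F_2]_(cdim P m)) (ca : is_cocycle a).
Variables (I : nat) (x : cohomology P ordinary I.+1%:Z).
Variables (b : 'cV['F_2]_(cdim P I.+1%:Z)) (xb : represented x b).
Hypothesis evL : ~~ odd #|L|.

(* The terms B of [bilin_theta_chain] do not depend on k, so they cancel: the number
   of k with k^2 = 1 is even. *)
Lemma pairing_square h (q : 'cV_(cdim P h)) (z : cohomology P tate h) :
  h = -1 - I.+1%:Z ->
  represented z q -> represented z (pairing_after (th I) h a a) ->
  (w *m pairing_after f m q b) 0 0 = (w *m a) 0 0 * chi_sum x.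
Proof.
move=> eh; have {eh}eh : h = - I.+2%:Z by lia.
subst h => zq zaa; have cb := represented_cocycle xb.
set h := - I.+2%:Z in q z zq zaa *.
set al := (w *m a) 0 0.
pose l := trace_mx (crep P m) *m a.
have ea : a = \sum_(g in L) crep P m g *m l.
  have /is_cocycleP[ka _] := ca.
  exact: (invariant_functional_trace (@crep_projective _ _ P m)) ka.
have hl : cdiff P 0%:Z m *m l = al *: ceps P.
  rewrite (cdiff0_factor P m) -mulmxA -hw mulmx_suml.
  under eq_bigr do rewrite -mulmxA.
  by rewrite -mulmx_sumr -ea [w *m a]mx11_scalar mul_mx_scalar.
(* Evaluating q (x) b on the diagonal of w means evaluating q on c. The norm of c is e, the slant of
   v. *)
pose c := slantr f b h w.
pose e := slantr f b h (augmentation1 P *m cdiff P 0%:Z m).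
have ce : \sum_(g in L) c *m crep P h g = e.
  rewrite /e -hw linear_sum; apply: eq_bigr => g gL.
  by rewrite /= slantr_equivariant.
have de : e *m cdiff P h (h - 1) = 0.
  rewrite (slantr_diff df cb _ (esym (subrK 1 m)) (esym (subrK 1 h))).
  by rewrite -mulmxA cdiff_cdiff mulmx0 linear0.
have einv : {in L, forall g, e *m crep P h g = e}.
  move=> g gL; rewrite -slantr_equivariant //; congr slantr.
  exact: generator_invariant.
have -> : (w *m pairing_after f m q b) 0 0 = (c *m q) 0 0.
  rewrite pairing_afterE -[c]/(f _ _ _ _ *m b)^T -mul_slant.
  by rewrite [in RHS]mxE.
(* q may be replaced by the representative built from theta: the norm e of c is a cycle, so all
   coboundaries vanish on c. *)
have -> : c *m q = c *m pairing_after (th I) h a a.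
  apply/eqP; rewrite -subr_eq0 -mulmxBr; apply/eqP.
  apply: (is_coboundary_mul0 ((represented_eq zq zaa).1 erefl)) => b' kb'.
  apply: (norm0_functional (@crep_projective _ _ P (h - 1))) kb' _.
  rewrite (eq_bigr (fun g => c *m crep P h g *m cdiff P h (h - 1))).
    by rewrite -mulmx_suml ce.
  by move=> g gL; rewrite -!mulmxA cdiff_equivariant.
rewrite pairing_afterE -/(bilin a a _) (trace_square _ _ ea) ce.
pose S k : ('F_2)^o := bilin (crep P m k *m l) l (th I h m m e).
rewrite -[LHS]/(\sum_(k in L) S k) F2_sum_inv; last first.
  by move=> k kL; rewrite /S (bilin_theta_inv th hm hl I kL _ einv de).
pose B := bilin l (ceps P) (th I.+1 h m 0%:Z e).
rewrite (eq_bigr (fun k => al * chi k x + al * B * (1 : ('F_2)^o))); last first.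
  move=> k /andP[kL /eqP kk]; rewrite mulr1.
  pose U := standard_string P k; have sU := standard_stringP P kL kk.
  (* The slant lowers degrees by I + 1, so the string element of degree I + 1 - r lands in degree
     -r. At r = 0 the augmentation is chi k x; at r = I + 1 the element comes from [augmentation1]
     and its boundary is e. *)
  pose Y r : 'rV_(cdim P (- r%:Z)) := slantr f b (- r%:Z) (U (I.+1 - r)%N).
  have hY r : (r < I.+1)%N -> Y r *m cdiff P (- r%:Z) (- r.+1%:Z) =
      Y r.+1 + Y r.+1 *m crep P (- r.+1%:Z) k.
    move=> rI; rewrite /Y subSn // subSS.
    rewrite (slantr_diff df cb _ (Posz_succ _)); last by lia.
    by case: sU => _ ->; rewrite linearD /= slantr_equivariant.
  have := bilin_theta_chain th hm hl kL kk hY.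
  have -> : Y I.+1 *m cdiff P (- I.+1%:Z) (- I.+2%:Z) = e.
    by rewrite /Y subnn (slantr_diff df cb _ hm) //; lia.
  have -> : (Y 0 *m ceps P) 0 0 = chi k x.
    have [+ _] := slantr_pstring df kL kk xb sU.
    by rewrite addn0 /Y subn0 mul1r => ->; rewrite mxE eqxx.
  rewrite -/(S k) -/B addrC => /F2_addKr ->.
  by rewrite mulrA -expr2 F2_exp // addrC.
by rewrite big_split /= -!mulr_sumr even_card_sqr1 // mulr0 addr0.
Qed.

End Evaluate.
End DualFormula.

Section DualCharacter.
Local Open Scope ring_scope.
Variables (gT : finGroupType) (L : {group gT}) (P : complete_resolution L).
Variable th : dual_power_system P.
Hypothesis evL : ~~ odd #|L|.

Section Adjoint.
Variables (m : int) (hm : 0%:Z = m + 1).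
Variable w : 'rV['F_2]_(cdim P m).
Hypothesis hw : \sum_(g in L) w *m crep P m g = augmentation1 P *m cdiff P 0%:Z m.

Lemma represented_generator (x y : cohomology P tate m) a b :
  represented x a -> represented y b -> x = y <-> w *m a = w *m b.
Proof.
move=> xa yb; have ca := represented_cocycle xa; have cb := represented_cocycle yb.
rewrite (represented_eq xa yb); split=> [/(coboundary_generator hw)|e].
  by rewrite mulmxBr => /eqP; rewrite subr_eq0 => /eqP.
apply: (generator_coboundary hm hw); first exact: (rpredB ca cb).
by rewrite mulmxBr e subrr.
Qed.

Lemma cup_degree0 (y : cohomology P tate m) (z : cohomology P ordinary 0%:Z) a c :
  represented y a -> represented z (c *: ceps P) ->
  exists2 b, represented (cup tate m y z) b & w *m b = c *: (w *m a).
Proof.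
move=> ya zc; have [f [a' [b [df ya' zb rep]]]] := cup_represented (theta0 th) tate m y z.
exists (pairing_after f m a' b) => //.
have -> : w *m a = w *m a' by apply/(represented_generator ya ya').
rewrite (represented_degree0_inj zb zc).
have cc := ceps_cocycle P; have /is_cocycleP[ka _] := represented_cocycle ya'.
(* Slanting with eps changes w by a vector of norm 0: the norm of the slant is the slant of v, and
   this is v because the slant of a vector of augmentation 1 has augmentation 1. *)
suff e : slantr f (ceps P) m w *m a' = w *m a'.
  rewrite pairing_afterE -scalemxAr -[_ *m ceps P]trmxK mul_slant.
  by rewrite -/(slantr f (ceps P) m w) e [w *m a']mx11_scalar tr_scalar_mx.
apply/eqP; rewrite -subr_eq0 -mulmxBl; apply/eqP.
apply: (norm0_functional (@crep_projective _ _ P m)) ka _.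
rewrite -mulmx_sumr mulmxBl ![_ *m \sum_(g in L) _]mulmx_sumr hw.
under eq_bigr => g gL do rewrite -slantr_equivariant //.
rewrite -linear_sum hw /= -(slantr_diff df cc _ hm hm).
rewrite [cdiff P 0%:Z m in X in X - _]cdiff0_factor mulmxA.
suff -> : slantr f (ceps P) 0%:Z (augmentation1 P) *m ceps P = 1%:M.
  by rewrite mul1mx subrr.
have s1 := standard_stringP P (group1 L) (mulg1 _).
by have [] := slantr_ceps df (group1 L) s1.
Qed.

Lemma Q_op_represented i (y : cohomology P tate m) : 
  exists2 a, represented y a &
    represented (Q_op th i.+1%:Z (-1 - i.+1%:Z) y)
      (pairing_after (th i) (-1 - i.+1%:Z) a a).
Proof.
have [a ya] := represented_ex y.
have [z za] := cocycle_represents tate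
  (pairing_theta_cocycle th (-1 - i.+1%:Z) i (represented_cocycle ya)).
rewrite /Q_op; have -> : i.+1%:Z + m = i%:Z by lia.
have ex : exists z : cohomology P tate (-1 - i.+1%:Z), exists2 a, represented y a
   & represented z (pairing_after (th i) (-1 - i.+1%:Z) a a) by exists z, a.
exact: (classical_sets.xgetPex 0 ex).
Qed.

Lemma cup_Q_op i (x : cohomology P ordinary i%:Z) (y : cohomology P tate m) a :
  represented y a ->
  exists2 b, represented (cup tate m (Q_op th i%:Z (-1 - i%:Z) y) x) b
    & w *m b = chi_sum x *: (w *m a).
Proof.
move=> ya; have [f [q [b [df yq xb rep]]]] :=
  cup_represented (theta0 th) tate m (Q_op th i%:Z (-1 - i%:Z) y) x.
exists (pairing_after f m q b) => //.
case: i => [|i] in x q b yq xb rep *; last first.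
  have [a' ya' zq] := Q_op_represented i y.
  have -> : w *m a = w *m a' by apply/(represented_generator ya ya').
  rewrite [LHS]mx11_scalar.
  rewrite (pairing_square hm hw df (represented_cocycle ya') xb evL erefl yq zq).
  by rewrite [w *m a']mx11_scalar scale_scalar_mx mulrC !mxE eqxx.
have [c xc] := represented_degree0 x.
rewrite (chi_sum_degree0 evL xc) scale0r.
(* For i = 0 the index 0 + m = -1 is negative, so [Q_op] is 0 by definition and q is a coboundary.
   It remains to see that coboundaries vanish on the slant of w by b. *)
have q0 : represented (0 : cohomology P tate (-1 - 0%:Z)) q.
  by move: yq; rewrite /Q_op (_ : 0%:Z + m = Negz 0) //; lia.
have cob := (represented_eq q0 (represented0 _ _ _)).1 erefl.
rewrite [q - 0]subr0 in cob.
have cb := represented_cocycle xb.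
rewrite pairing_afterE -[LHS]trmxK mul_slant -/(slantr f b _ w).
have hm' : 0%:Z = -1 - 0%:Z + 1 by [].
suff -> : slantr f b (-1 - 0%:Z) w *m q = 0 by rewrite trmx0.
apply: (is_coboundary_mul0 cob) => b' kb'.
apply: (norm0_functional (@crep_projective _ _ P _)) kb' _.
rewrite (eq_bigr (fun g => slantr f b (-1 - 0%:Z) (w *m crep P m g) *m
    cdiff P (-1 - 0%:Z) (-1 - 0%:Z - 1))); last first.
  by move=> g gL; rewrite slantr_equivariant // -!mulmxA cdiff_equivariant.
rewrite -mulmx_suml -linear_sum hw /= -(slantr_diff df cb _ hm hm').
by rewrite -mulmxA cdiff_cdiff mulmx0.
Qed.

(** Evaluated at w, the two sides are c and [chi_sum x] times w a. As some class has w a = 1, the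
    scalars can be compared. *)
Lemma adjoint_iff i (x : cohomology P ordinary i%:Z) (z : cohomology P ordinary 0%:Z) c :
  represented z (c *: ceps P) ->
  (forall y : cohomology P tate m,
     cup tate m y z = cup tate m (Q_op th i%:Z (-1 - i%:Z) y) x) <-> c = chi_sum x.
Proof.
move=> zc; split=> [h|ec y].
  have [a ca wa] := exists_generator hm hw evL.
  have [y ya] := cocycle_represents tate ca.
  have [b rb wb] := cup_degree0 ya zc; have [b' rb' wb'] := cup_Q_op x ya.
  have := (represented_generator rb rb').1 (h y).
  rewrite wb wb' wa => /matrixP /(_ 0 0).
  by rewrite !mxE eqxx !mulr1.
have [a ya] := represented_ex y.
have [b rb wb] := cup_degree0 ya zc; have [b' rb' wb'] := cup_Q_op x ya.
by apply/(represented_generator rb rb'); rewrite wb wb' ec.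
Qed.

End Adjoint.

Theorem Q_dual_chi_sum i (x : cohomology P ordinary i%:Z) :
  represented (Q_dual th i 0 x) (chi_sum x *: ceps P).
Proof.
have hm : 0%:Z = -1 + 1 :> int by [].
have [w hw] := exists_norm_generator P (-1).
have [z zc] := cocycle_represents ordinary (cocycle_ceps P (chi_sum x)).
rewrite /Q_dual; have -> : -1 - 0%:Z = -1 :> int by [].
have ex : exists z : cohomology P ordinary 0%:Z, forall y : cohomology P tate (-1),
    cup tate (-1) y z = cup tate (-1) (Q_op th i%:Z (-1 - i%:Z) y) x.
  by exists z; apply/(adjoint_iff hm hw x zc).
have := classical_sets.xgetPex 0 ex; set z' := Defs.xget _ _ => h.
have [c zc'] := represented_degree0 z'.
by have <- := (adjoint_iff hm hw x zc').1 h.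
Qed.

End DualCharacter.

(** * Chain maps and restriction *)

Section Comparison.
Local Open Scope ring_scope.
Variables (gT : finGroupType) (L : {group gT}) (P : complete_resolution L).
Variables (C : nat -> nat) (d : forall j, 'M['F_2]_(C j.+1, C j)).
Variables (eps : 'cV['F_2]_(C 0)) (B : forall j, 'M['F_2]_(C j)).
Variable act : forall j, gT -> 'M['F_2]_(C j).

Definition chain_map (phi : forall j : nat, 'M['F_2]_(cdim P j%:Z, C j)) : Prop :=
  [/\ forall j, {in L, forall g, crep P j%:Z g *m phi j = phi j *m act j g},
      forall j, cdiff P j.+1%:Z j%:Z *m phi j = phi j.+1 *m d j
    & phi 0 *m eps = ceps P].

Lemma chain_map_string phi k c U : chain_map phi -> k \in L -> pstring k c U ->
  is_string d eps (fun j => act j k) c (fun j => U j *m phi j).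
Proof.
case=> kphi dphi ephi kL [U0 dU]; split=> [|j]; first by rewrite -mulmxA ephi.
by rewrite -mulmxA -dphi mulmxA dU mulmxDl -mulmxA kphi // mulmxA.
Qed.

Hypothesis ex : exact_on d eps B.
Hypothesis actM : forall j, {in L &, forall g k, act j (g * k)%g = act j g *m act j k}.
Hypothesis actd : forall j, {in L, forall g, d j *m act j g = act j.+1 g *m d j}.
Hypothesis acte : {in L, forall g, act 0 g *m eps = eps}.
Hypothesis actB : forall j, {in L, forall g, (B j *m act j g <= B j)%MS}.
Hypothesis Be : B 0 *m eps != 0.

(** Pseudo-inverses solve the lifting problem inside the row spaces of B, and averaging makes the
    solution equivariant. The same construction yields chain maps to a resolution, with B the
    identity, and to an extension, with B the projections to its degrees. *)
Fixpoint comparison (j : nat) : 'M['F_2]_(cdim P j%:Z, C j) :=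
  if j is j'.+1 then
    average (crep P j'.+1%:Z) (act j'.+1)
      (cdiff P j'.+1%:Z j'%:Z *m comparison j' *m pinvmx (B j'.+1 *m d j') *m B j'.+1)
  else average (crep P 0%:Z) (act 0) (ceps P *m pinvmx (B 0 *m eps) *m B 0).

Lemma comparison_equivariant j :
  {in L, forall g, crep P j%:Z g *m comparison j = comparison j *m act j g}.
Proof.
case: j => [|j]; apply: average_equivariant; exact: actM.
Qed.

Lemma comparison_sub j : (comparison j <= B j)%MS.
Proof. by case: j => [|j]; apply: average_sub (actB _) (submxMl _ _). Qed.

Lemma comparison_eps : comparison 0 *m eps = ceps P.
Proof.
apply: (average_comp (@crep_projective _ _ P 0%:Z) (act' := fun=> 1%:M)).
- by move=> g gL; rewrite mulmx1 acte.
- by move=> g gL; rewrite mulmx1 ceps_equivariant.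
rewrite -[_ *m B 0 *m eps]mulmxA mulmxKpV //.
apply: submx_full; have := Be; rewrite -mxrank_eq0 /row_full.
by case: (\rank _) (rank_leq_col (B 0 *m eps)) => [|[|]].
Qed.

Lemma comparison_diff j :
  cdiff P j.+1%:Z j%:Z *m comparison j = comparison j.+1 *m d j.
Proof.
have lift i : (cdiff P i.+1%:Z i%:Z *m comparison i <= B i.+1 *m d i)%MS ->
    comparison i.+1 *m d i = cdiff P i.+1%:Z i%:Z *m comparison i.
  move=> le; apply: (average_comp (@crep_projective _ _ P i.+1%:Z) (act' := act i)).
  - by move=> g gL; rewrite actd.
  - by move=> g gL; rewrite mulmxA cdiff_equivariant // -!mulmxA comparison_equivariant.
  by rewrite -[_ *m B _ *m _]mulmxA mulmxKpV.
rewrite lift //; elim: j => [|j IH].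
  apply: ex.1; first exact: mulmx_sub (comparison_sub 0).
  by rewrite -mulmxA comparison_eps cdiff_eps.
apply: ex.2; first exact: mulmx_sub (comparison_sub _).
by rewrite -mulmxA lift // mulmxA cdiff_cdiff mul0mx.
Qed.

Lemma comparison_chain_map : chain_map comparison.
Proof.
split; [exact: comparison_equivariant | exact: comparison_diff | exact: comparison_eps].
Qed.

End Comparison.

Section Restriction.
Local Open Scope ring_scope.
Variables (gT1 gT2 : finGroupType) (L1 : {group gT1}) (L2 : {group gT2}).
Variables (P1 : complete_resolution L1) (P2 : complete_resolution L2).
Variable iota : gT1 -> gT2.
Hypothesis iotaL : {in L1, forall g, iota g \in L2}.
Hypothesis iotaM : {in L1 &, {morph iota : g h / (g * h)%g}}.

Lemma restrict_represented m (x : cohomology P2 ordinary m%:Z) :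
  exists phi b, [/\ chain_map (P := P1) (C := fun j => cdim P2 j%:Z)
    (fun j => cdiff P2 j.+1%:Z j%:Z) (ceps P2) (fun j g => crep P2 j%:Z (iota g)) phi,
    represented x b & represented (restrict P1 iota x) (phi m *m b)].
Proof.
have [b xb] := represented_ex x.
have ph := comparison_chain_map P1 (C := fun j => cdim P2 j%:Z)
  (act := fun j g => crep P2 j%:Z (iota g)) (resolution_exact P2).
case: ph => [j g h gL hL|j g gL|g gL|j g gL||].
- by rewrite iotaM // repr_mxM ?iotaL.
- by rewrite cdiff_equivariant ?iotaL.
- by rewrite ceps_equivariant ?iotaL.
- exact: submx1.
- by rewrite mul1mx ceps_neq0.
set phi := comparison _ _ _ _ _ => kphi dphi ephi.
have cpb : is_cocycle (phi m *m b).
  have /is_cocycleP[kb db] := represented_cocycle xb.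
  rewrite (is_cocycleE _ (Posz_succ m)); apply/andP; split.
    by apply/cochainP => g gL; rewrite mulmxA kphi // -mulmxA kb ?iotaL.
  by rewrite mulmxA dphi -mulmxA db mulmx0.
have [y yp] := cocycle_represents ordinary cpb.
rewrite /restrict.
have ex : exists y : cohomology P1 ordinary m%:Z,
  exists (phi : forall j : nat, 'M['F_2]_(cdim P1 j%:Z, cdim P2 j%:Z)) b,
    [/\ forall j, {in L1, forall g,
          crep P1 j%:Z g *m phi j = phi j *m crep P2 j%:Z (iota g)},
        forall j, cdiff P1 j.+1%:Z j%:Z *m phi j =
          phi j.+1 *m cdiff P2 j.+1%:Z j%:Z,
        phi 0 *m ceps P2 = ceps P1,
        represented x b
      & represented y (phi m *m b)] by exists y, phi, b.
have [phi' [b' [kp dp ep xb' rep]]] := classical_sets.xgetPex 0 ex.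
by exists phi', b'.
Qed.

(** A chain map over iota carries a string for k to one for iota k. *)
Lemma chi_restrict k m (x : cohomology P2 ordinary m%:Z) :
  k \in L1 -> (k * k)%g = 1%g ->
  chi k (restrict P1 iota x) = chi (iota k) x.
Proof.
move=> kL kk; have [phi [b [ph xb rep]]] := restrict_represented x.
have sS := standard_stringP P1 kL kk.
rewrite (chi_coef kL kk rep sS) mulmxA.
have ik : (iota k * iota k = 1)%g.
  rewrite -iotaM // kk; apply: (mulgI (iota 1%g)).
  by rewrite -iotaM ?group1 // !mulg1.
by rewrite (chi_coef (iotaL kL) ik xb (chain_map_string ph kL sS)).
Qed.

Lemma restrict_degree0 (x : cohomology P2 ordinary 0%:Z) c :
  represented x (c *: ceps P2) -> represented (restrict P1 iota x) (c *: ceps P1).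
Proof.
move=> xc; have [phi [b [[_ _ ephi] xb rep]]] := restrict_represented x.
by rewrite -ephi scalemxAr -(represented_degree0_inj xb xc).
Qed.

End Restriction.

Lemma mulmx_col (R : pzRingType) m n p (A : 'M[R]_(m, n)) (B : 'M[R]_(n, p)) j :
  (A *m col j B = col j (A *m B))%R.
Proof. by rewrite !colE mulmxA. Qed.

(** * Tensor powers of extensions *)

Section Extensions.
Local Open Scope ring_scope.
Variables (gT : finGroupType) (L : {group gT}).
Variables (P : complete_resolution L) (i : nat) (E : augmented_complex L).
Hypothesis yE : yoneda_extension i E.

(** All degrees of E share one total module. These projections present E in the form expected by
    [exact_on]: constant terms, with the degree j part as a row space. *)
Definition homogeneous_mx (j : nat) : 'M['F_2]_(adim E) :=
  \matrix_(a, b) ((a == b) && (adeg b == j))%:R.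

Lemma mul_homogeneous_mx j m (x : 'M_(m, adim E)) a b :
  (x *m homogeneous_mx j) a b = x a b * (adeg b == j)%:R.
Proof.
rewrite mxE (bigD1 b) //= mxE eqxx big1 ?addr0 // => c /negPf cb.
by rewrite mxE cb mulr0.
Qed.

Lemma homogeneous_mx_mul j m (x : 'M_(adim E, m)) a b :
  (homogeneous_mx j *m x) a b = (adeg a == j)%:R * x a b.
Proof.
rewrite mxE (bigD1 a) //= mxE eqxx big1 ?addr0 // => c ca.
by rewrite mxE eq_sym (negPf ca) mul0r.
Qed.

Lemma homogeneous_sub j m (x : 'M_(m, adim E)) :
  (x <= homogeneous_mx j)%MS = (x *m homogeneous_mx j == x).
Proof.
apply/idP/eqP => [/submxP[y ->]|<-]; last exact: submxMl.
by apply/matrixP => a b; rewrite !mul_homogeneous_mx -mulrA -natrM mulnb andbb.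
Qed.

Lemma homogeneous_coef j m (x : 'M_(m, adim E)) a b :
  (x <= homogeneous_mx j)%MS -> x a b != 0 -> adeg b = j.
Proof.
rewrite homogeneous_sub => /eqP <-; rewrite mul_homogeneous_mx.
by case: (adeg b =P j) => // _; rewrite mulr0 eqxx.
Qed.

Lemma homogeneous_sub_coef j m (x : 'M_(m, adim E)) :
  (forall a b, x a b != 0 -> adeg b = j) -> (x <= homogeneous_mx j)%MS.
Proof.
move=> h; rewrite homogeneous_sub; apply/eqP/matrixP => a b.
rewrite mul_homogeneous_mx; have [->|/h ->] := eqVneq (x a b) 0; first by rewrite mul0r.
by rewrite eqxx mulr1.
Qed.

Lemma homogeneous_rep j g : g \in L ->
  homogeneous_mx j *m arep E g = arep E g *m homogeneous_mx j.
Proof.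
case: yE => -[dg _ _] _ _ _ _ gL; apply/matrixP => a b.
rewrite mul_homogeneous_mx homogeneous_mx_mul.
have [->|/(dg g gL) ->] := eqVneq (arep E g a b) 0; first by rewrite mulr0 mul0r.
by rewrite mulrC.
Qed.

Lemma homogeneous_diff j :
  homogeneous_mx j.+1 *m adiff E = adiff E *m homogeneous_mx j.
Proof.
case: yE => -[_ dd _] _ _ _ _; apply/matrixP => a b.
rewrite mul_homogeneous_mx homogeneous_mx_mul.
have [->|/dd ->] := eqVneq (adiff E a b) 0; first by rewrite mulr0 mul0r.
by rewrite mulrC eqSS.
Qed.

Lemma homogeneous0_diff : homogeneous_mx 0 *m adiff E = 0.
Proof.
case: yE => -[_ dd _] _ _ _ _; apply/matrixP => a b.
rewrite homogeneous_mx_mul mxE.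
by have [->|/dd ->] := eqVneq (adiff E a b) 0; rewrite ?mulr0 // mul0r.
Qed.

Lemma homogeneous_eps j : homogeneous_mx j *m aeps E = (j == 0)%:R *: aeps E.
Proof.
case: yE => -[_ _ de] _ _ _ _; apply/matrixP => a b; rewrite (ord1 b).
rewrite homogeneous_mx_mul !mxE.
have [->|/de ->] := eqVneq (aeps E a 0) 0; first by rewrite !mulr0.
by rewrite eq_sym.
Qed.

Lemma extension_diff_diff : adiff E *m adiff E = 0.
Proof.
case: yE => _ _ _ [_ /andP[_ h]] _; move: h; rewrite sub_kermx mul_mx_row.
by rewrite -row_mx0 => /eqP/eq_row_mx[].
Qed.

Lemma extension_diff_eps : adiff E *m aeps E = 0.
Proof.
case: yE => _ _ _ [_ /andP[_ h]] _; move: h; rewrite sub_kermx mul_mx_row.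
by rewrite -row_mx0 => /eqP/eq_row_mx[].
Qed.

Lemma extension_lift m (x : 'M_(m, adim E)) :
  x *m adiff E = 0 -> x *m aeps E = 0 -> (x <= adiff E)%MS.
Proof.
case: yE => _ _ _ [_ /andP[h _]] _ xd xe; apply: submx_trans h.
by rewrite sub_kermx mul_mx_row xd xe row_mx0.
Qed.

Lemma extension_exact :
  exact_on (C := fun=> adim E) (fun=> adiff E) (aeps E) homogeneous_mx.
Proof.
have lift j m (x : 'M_(m, adim E)) : (x <= homogeneous_mx j)%MS ->
    x *m adiff E = 0 -> x *m aeps E = 0 -> (x <= homogeneous_mx j.+1 *m adiff E)%MS.
  rewrite homogeneous_sub => /eqP xj xd xe.
  have /submxP[y e] := extension_lift xd xe.
  by apply/submxP; exists y; rewrite homogeneous_diff mulmxA -e xj.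
split=> [m x x0 xe|j m x xj xd]; apply: lift => //.
  by case/submxP: x0 => y ->; rewrite -mulmxA homogeneous0_diff mulmx0.
by case/submxP: xj => y ->; rewrite -mulmxA homogeneous_eps scale0r mulmx0.
Qed.

Lemma top_diff m (x : 'M_(m, adim E)) a : (x *m adiff E) a (atop E) = 0.
Proof.
case: yE => -[_ dd _] _ _ _ [le tp _]; rewrite mxE big1 // => b _.
have [->|/dd e] := eqVneq (adiff E b (atop E)) 0; first by rewrite mulr0.
have := le b; rewrite e; have /eqP -> : adeg (atop E) == i by rewrite tp.
by rewrite ltnn.
Qed.

Lemma top_rep m (x : 'M_(m, adim E)) g a : g \in L ->
  (x *m arep E g) a (atop E) = x a (atop E).
Proof.
case: yE => -[dg _ _] _ _ _ [_ tp t1] gL; rewrite mxE (bigD1 (atop E)) //=.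
rewrite t1 // mulr1 big1 ?addr0 // => b; rewrite -tp => nb.
have [->|/(dg g gL) e] := eqVneq (arep E g b (atop E)) 0; first by rewrite mulr0.
by case/negP: nb; rewrite e tp.
Qed.

Lemma extension_cocycle_chain_map a : extension_cocycle (P := P) (i := i) E a ->
  exists phi : forall j : nat, 'M['F_2]_(cdim P j%:Z, adim E),
  [/\ chain_map (C := fun=> adim E) (fun=> adiff E) (aeps E) (fun=> arep E) phi,
      forall j, (phi j <= homogeneous_mx j)%MS & a = col (atop E) (phi i)].
Proof.
case=> phi [dg kphi dphi ephi ea]; exists phi; split=> // j.
by apply: homogeneous_sub_coef => u b; apply: dg.
Qed.

Lemma extension_cocycle_cocycle a :
  extension_cocycle (P := P) (i := i) E a -> is_cocycle a.
Proof.
case=> phi [_ kphi dphi _ ->]; rewrite (is_cocycleE _ (Posz_succ i)); apply/andP; split.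
  apply/cochainP => g gL; apply/colP => r.
  rewrite mulmx_col kphi // mxE [RHS]mxE; exact: top_rep.
apply/eqP/colP => r; rewrite mulmx_col dphi mxE [RHS]mxE.
exact: top_diff.
Qed.

Lemma exists_extension_cocycle : exists a, extension_cocycle (P := P) (i := i) E a.
Proof.
case: (yE) => -[_ _ _] kd ke [e0 _] _.
have [||||| kphi dphi ephi] := comparison_chain_map P (C := fun=> adim E)
  (act := fun=> arep E) extension_exact.
- by move=> j g h gL hL; rewrite repr_mxM.
- by move=> j g gL; rewrite kd.
- by move=> g gL; rewrite ke.
- by move=> j g gL; rewrite homogeneous_rep // submxMl.
- by rewrite homogeneous_eps scale1r.
set phi := comparison _ _ _ _ _ in kphi dphi ephi.
exists (col (atop E) (phi i)), phi; split=> // j u b.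
by apply: homogeneous_coef; apply: comparison_sub => // h g gL; rewrite homogeneous_rep // submxMl.
Qed.

(* An element X with X k = X + d X encodes a string by its homogeneous parts. *)
Lemma chi_extension k (x : cohomology P ordinary i%:Z) a (X : 'rV_(adim E)) :
  k \in L -> (k * k)%g = 1%g -> extension_cocycle E a -> represented x a ->
  X *m arep E k = X + X *m adiff E -> X *m aeps E = 1%:M ->
  chi k x = X 0 (atop E).
Proof.
move=> kL kk /extension_cocycle_chain_map[phi [cphi hphi ->]] xa Xk Xe.
have sS := standard_stringP P kL kk.
have sU := chain_map_string cphi kL sS.
pose V j := X *m homogeneous_mx j.
have sV : is_string (C := fun=> adim E) (fun=> adiff E) (aeps E) (fun=> arep E k) 1 V.
  split=> [|j]; rewrite /V -mulmxA; first by rewrite homogeneous_eps scale1r.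
  rewrite homogeneous_diff mulmxA -[_ *m arep E k]mulmxA homogeneous_rep // mulmxA.
  by rewrite -mulmxDl Xk addrA F2_double add0r.
have [|||||Y [Z [Yi Zi e]]] := string_sub_homotopy extension_exact _ _ _ sU _ sV _ i.
- by move=> j; case: yE => _ ->.
- by move=> j; rewrite homogeneous_rep // submxMl.
- by move=> j; rewrite -repr_mxM // kk repr_mx1.
- by move=> j; apply: mulmx_sub.
- by move=> j; apply: submxMl.
have := congr1 (fun M : 'rV_(adim E) => M 0 (atop E)) e.
have addE (p q : 'rV['F_2]_(adim E)) b : (p + q) 0 b = p 0 b + q 0 b by rewrite mxE.
rewrite /= !addE top_diff top_rep // addr0 F2_addrr => /eqP.
rewrite addr_eq0 F2_oppr mul_homogeneous_mx.
have -> : adeg (atop E) == i by case: yE => _ _ _ _ [_ ->].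
rewrite mulr1 => /eqP <-; rewrite (chi_coef kL kk xa sS).
by rewrite mulmx_col mxE.
Qed.

Lemma exists_string_element k (x : cohomology P ordinary i%:Z) a :
  k \in L -> (k * k)%g = 1%g -> extension_cocycle E a -> represented x a ->
  exists X : 'rV_(adim E), [/\ X *m arep E k = X + X *m adiff E,
    X *m aeps E = 1%:M & chi k x = X 0 (atop E)].
Proof.
move=> kL kk ea xa.
have [phi [cphi hphi _]] := extension_cocycle_chain_map ea.
pose U j := standard_string P k j *m phi j.
have [U0 dU] : is_string (C := fun=> adim E) (fun=> adiff E) (aeps E)
    (fun=> arep E k) 1 U := chain_map_string cphi kL (standard_stringP P kL kk).
have hU j : (U j <= homogeneous_mx j)%MS by apply: mulmx_sub.
(* E ends in degree i, so the relations U_j k = U_j + U_(j+1) d add up without remainder. *)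
pose X := \sum_(j < i.+1) U j.
have Xk : X *m arep E k = X + X *m adiff E.
  have Ui : U i.+1 = 0.
    apply/rowP => b; rewrite [RHS]mxE; apply/eqP/negP => /negP /(homogeneous_coef (hU _)) e.
    by case: yE => _ _ _ _ [/(_ b)]; rewrite e ltnn.
  have -> : X *m adiff E = \sum_(j < i.+2) U j *m adiff E.
    by rewrite big_ord_recr /= Ui mul0mx addr0 mulmx_suml.
  rewrite big_ord_recl /=; have /submxP[y ->] := hU 0%N.
  rewrite -mulmxA homogeneous0_diff mulmx0 add0r mulmx_suml -big_split /=.
  by apply: eq_bigr => j _; rewrite dU addrA F2_double add0r.
have Xe : X *m aeps E = 1%:M.
  rewrite mulmx_suml big_ord_recl /= U0 big1 ?addr0 // => j _.
  by have /submxP[y ->] := hU (bump 0 j); rewrite -mulmxA homogeneous_eps scale0r mulmx0.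
by exists X; split=> //; apply: chi_extension ea xa Xk Xe.
Qed.

End Extensions.

Section TensorCalculus.
Local Open Scope ring_scope.
Variables (n : nat) (gT : finGroupType) (K : {group gT}) (E : augmented_complex K).

Notation T := (tensor_index n E).
Notation N := #|{: T}|.
Notation A1 := 'M['F_2]_(adim E).

(* The operator (e_j)_j |-> (e_(s j) A_j)_j on the tensor power. *)
Definition tensor_mx (s : 'S_n) (A : 'I_n -> A1) : 'M['F_2]_N :=
  \matrix_(u, v) \prod_j A j (tensor_val u (s j)) (tensor_val v j).

Definition pure_tensor (x : 'I_n -> 'rV['F_2]_(adim E)) : 'rV['F_2]_N :=
  \row_u \prod_j x j 0 (tensor_val u j).

Definition pure_cotensor (c : 'I_n -> 'cV['F_2]_(adim E)) : 'cV['F_2]_N :=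
  \col_u \prod_j c j (tensor_val u j) 0.

Lemma sum_tensor_index (F : {ffun 'I_n -> 'I_(adim E)} -> 'F_2) :
  \sum_(u < N) F (tensor_val u) = \sum_(f : T) F f.
Proof.
rewrite (reindex (@enum_rank T)) /=; last exact/onW_bij/enum_rank_bij.
by apply: eq_bigr => f _; rewrite /tensor_val enum_rankK.
Qed.

Lemma eq_tensor_mx s A B : A =1 B -> tensor_mx s A = tensor_mx s B.
Proof.
by move=> e; apply/matrixP => u v; rewrite !mxE; apply: eq_bigr => j _; rewrite e.
Qed.

Lemma eq_pure_tensor x y : x =1 y -> pure_tensor x = pure_tensor y.
Proof.
by move=> e; apply/rowP => v; rewrite !mxE; apply: eq_bigr => j _; rewrite e.
Qed.

Lemma tensor_mxM s t A B :
  tensor_mx s A *m tensor_mx t B =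
  tensor_mx (t * s)%g (fun j => A (t j) *m B j).
Proof.
apply/matrixP => u v; rewrite [LHS]mxE [RHS]mxE.
under [LHS]eq_bigr do rewrite !mxE.
rewrite (sum_tensor_index (fun f => (\prod_j A j (tensor_val u (s j)) (f j)) *
  (\prod_j B j (f (t j)) (tensor_val v j)))).
under [LHS]eq_bigr => f _ do rewrite (reindex_inj (@perm_inj _ t)) /= -big_split /=
  (reindex_inj (@perm_inj _ (t^-1)%g)) /=.
under [LHS]eq_bigr => f _ do under eq_bigr => j _ do rewrite permKV.
rewrite -(bigA_distr_bigA (fun j a =>
  A j (tensor_val u (s j)) a * B ((t^-1)%g j) a (tensor_val v ((t^-1)%g j)))).
rewrite [LHS](reindex_inj (@perm_inj _ t)) /=.
by apply: eq_bigr => j _; rewrite permM mxE permK.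
Qed.

Lemma pure_tensorM x s A :
  pure_tensor x *m tensor_mx s A = pure_tensor (fun j => x (s j) *m A j).
Proof.
apply/rowP => v; rewrite [LHS]mxE [RHS]mxE.
under [LHS]eq_bigr do rewrite !mxE.
rewrite (sum_tensor_index (fun f => (\prod_j x j 0 (f j)) *
  (\prod_j A j (f (s j)) (tensor_val v j)))).
under [LHS]eq_bigr => f _ do rewrite (reindex_inj (@perm_inj _ s)) /= -big_split /=
  (reindex_inj (@perm_inj _ (s^-1)%g)) /=.
under [LHS]eq_bigr => f _ do under eq_bigr => j _ do rewrite permKV.
rewrite -(bigA_distr_bigA (fun j a =>
  x j 0 a * A ((s^-1)%g j) a (tensor_val v ((s^-1)%g j)))).
rewrite [LHS](reindex_inj (@perm_inj _ s)) /=.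
by apply: eq_bigr => j _; rewrite mxE permK.
Qed.

Lemma pure_cotensorM s A c :
  tensor_mx s A *m pure_cotensor c =
  pure_cotensor (fun j => A ((s^-1)%g j) *m c ((s^-1)%g j)).
Proof.
apply/colP => u; rewrite [LHS]mxE [RHS]mxE.
under [LHS]eq_bigr do rewrite !mxE -big_split /=.
rewrite (sum_tensor_index (fun f => \prod_j (A j (tensor_val u (s j)) (f j) * c j (f j) 0))).
rewrite -(bigA_distr_bigA (fun j a => A j (tensor_val u (s j)) a * c j a 0)).
rewrite [LHS](reindex_inj (@perm_inj _ (s^-1)%g)) /=.
by apply: eq_bigr => j _; rewrite mxE permKV.
Qed.

Lemma pure_pairing x c :
  pure_tensor x *m pure_cotensor c = (\prod_j (x j *m c j) 0 0)%:M.
Proof.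
rewrite [LHS]mx11_scalar; congr (_%:M); rewrite mxE.
under [LHS]eq_bigr do rewrite !mxE -big_split /=.
rewrite (sum_tensor_index (fun f => \prod_j (x j 0 (f j) * c j (f j) 0))).
rewrite -(bigA_distr_bigA (fun j a => x j 0 a * c j a 0)).
by apply: eq_bigr => j _; rewrite mxE.
Qed.

Lemma tensor_mx1 : tensor_mx 1 (fun=> 1%:M) = 1%:M.
Proof.
apply/matrixP=> u v; rewrite !mxE.
under eq_bigr => j _ do rewrite perm1 mxE.
have [->|ne] := eqVneq u v; first by rewrite big1 // => j _; rewrite eqxx.
have [j hj]: exists j, tensor_val u j != tensor_val v j.
  apply/existsP; rewrite -negb_forall; apply: contra ne => /forallP h.
  by apply/eqP/enum_val_inj/ffunP=> j; apply/eqP.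
by rewrite (bigD1 j) //= (negPf hj) mul0r.
Qed.

Definition factor_mx (j : 'I_n) (A : A1) : 'M['F_2]_N :=
  tensor_mx 1 (fun l => if l == j then A else 1%:M).

Lemma factor_mxM j A B : factor_mx j A *m factor_mx j B = factor_mx j (A *m B).
Proof.
rewrite /factor_mx tensor_mxM mulg1; apply: eq_tensor_mx => l; rewrite perm1.
by case: ifP => // _; rewrite mulmx1.
Qed.

Lemma factor_mxC j l A B : j != l ->
  factor_mx j A *m factor_mx l B = factor_mx l B *m factor_mx j A.
Proof.
move=> jl; rewrite /factor_mx !tensor_mxM mulg1; apply: eq_tensor_mx => q; rewrite !perm1.
case: (eqVneq q j) => [->|_]; last by case: ifP; rewrite ?mul1mx ?mulmx1.
by rewrite (negPf jl) mulmx1 mul1mx.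
Qed.

Lemma factor_mxD j A B : factor_mx j (A + B) = factor_mx j A + factor_mx j B.
Proof.
apply/matrixP => u v; rewrite !mxE !(bigD1 j (P := xpredT)) //= !eqxx mxE mulrDl.
by congr (_ * _ + _ * _); apply: eq_bigr => l /negPf ->.
Qed.

Lemma factor_mx0 j : factor_mx j 0 = 0.
Proof. by apply/matrixP => u v; rewrite !mxE (bigD1 j) //= eqxx mxE mul0r. Qed.

Lemma tensor_mx_factor s A j B :
  tensor_mx s A *m factor_mx j B =
  tensor_mx s (fun l => if l == j then A l *m B else A l).
Proof.
rewrite /factor_mx tensor_mxM mul1g; apply: eq_tensor_mx => l; rewrite perm1.
by case: ifP => // _; rewrite mulmx1.
Qed.

Lemma factor_tensor_mx (s : 'S_n) A j B :
  factor_mx (s j) B *m tensor_mx s A =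
  tensor_mx s (fun l => if l == j then B *m A l else A l).
Proof.
rewrite /factor_mx tensor_mxM mulg1; apply: eq_tensor_mx => l.
by rewrite (inj_eq perm_inj); case: ifP => // _; rewrite mul1mx.
Qed.

Lemma factor_tensor_mxC (s : 'S_n) A j B : A j *m B = B *m A j ->
  tensor_mx s A *m factor_mx j B = factor_mx (s j) B *m tensor_mx s A.
Proof.
move=> e; rewrite tensor_mx_factor factor_tensor_mx; apply: eq_tensor_mx => l.
by case: eqP => // ->.
Qed.

Lemma factor_tensor_mx1 A j B :
  factor_mx j B *m tensor_mx 1 A =
  tensor_mx 1 (fun l => if l == j then B *m A l else A l).
Proof. by rewrite -factor_tensor_mx perm1. Qed.

Lemma factor_pure_cotensor0 j A c : A *m c j = 0 -> factor_mx j A *m pure_cotensor c = 0.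
Proof.
move=> e; rewrite /factor_mx pure_cotensorM; apply/colP => u; rewrite !mxE.
by rewrite (bigD1 j) //= invg1 perm1 eqxx e mxE mul0r.
Qed.

Lemma tensor_repE w : tensor_rep E w = tensor_mx w.1 (fun j => arep E (w.2 j)).
Proof. by []. Qed.

Lemma tensor_diffE : adiff (tensor_power n E) = \sum_j factor_mx j (adiff E).
Proof.
apply/matrixP => u v; rewrite mxE summxE; apply: eq_bigr => j _.
rewrite mxE (bigD1 j (P := xpredT)) //= eqxx perm1; congr (_ * _).
by apply: eq_bigr => l /negPf ->; rewrite perm1 mxE.
Qed.

Lemma tensor_epsE : aeps (tensor_power n E) = pure_cotensor (fun=> aeps E).
Proof. by []. Qed.

End TensorCalculus.

Section TensorPowerExtension.
Local Open Scope ring_scope.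
Variables (n : nat) (gT : finGroupType) (K : {group gT}) (i : nat).
Variable E : augmented_complex K.
Hypothesis yE : yoneda_extension i E.

(** A contraction of E onto k as a complex of vector spaces. On cycles of augmentation 0, s0 is a
    section of d, and p + d s0 projects onto these cycles. Applying this projection before s0 gives
    d s = d s0 and s d = p + d s0, whose sum is p = 1 + eps eta. *)
Lemma exists_contraction : exists (s : 'M['F_2]_(adim E)) (eta : 'rV_(adim E)),
  [/\ adiff E *m s + s *m adiff E = 1%:M + aeps E *m eta, eta *m adiff E = 0,
    eta *m aeps E = 1%:M & (eta <= homogeneous_mx E 0)%MS].
Proof.
set d := adiff E; set e := aeps E.
have dd : d *m d = 0 := extension_diff_diff yE.
have de : d *m e = 0 := extension_diff_eps yE.
have [a ea] : exists a, e a 0 != 0.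
  case: yE => _ _ _ [+ _] _; rewrite -/e => e0.
  apply/existsP; rewrite -negb_forall; apply: contra e0 => /forallP h.
  by apply/eqP/colP => a; rewrite (eqP (h a)) mxE.
have e1 : e a 0 = 1 by case: (F2_case (e a 0)) ea => ->; rewrite ?eqxx.
pose eta : 'rV['F_2]_(adim E) := delta_mx 0 a.
have ee : eta *m e = 1%:M.
  by rewrite -rowE [LHS]mx11_scalar mxE e1.
have ed : eta *m d = 0.
  apply/rowP => b; rewrite -rowE !mxE; apply/eqP/negP => /negP ab.
  by have [[_ h1 h2] _ _ _ _] := yE; have := h1 _ _ ab; rewrite (h2 _ ea).
pose p := 1%:M + e *m eta.
have pe : p *m e = 0 by rewrite mulmxDl mul1mx -mulmxA ee mulmx1 F2_double.
have pd : p *m d = d by rewrite mulmxDl mul1mx -mulmxA ed mulmx0 addr0.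
have dp : d *m p = d by rewrite mulmxDr mulmx1 mulmxA de mul0mx addr0.
pose s0 := pinvmx d *m p.
have s0e : s0 *m e = 0 by rewrite -mulmxA pe mulmx0.
have s0d m (x : 'M_(m, adim E)) : x *m d = 0 -> x *m e = 0 -> x *m s0 *m d = x.
  move=> xd xe; rewrite mulmxA -[_ *m p *m d]mulmxA pd mulmxKpV //.
  exact: (extension_lift yE).
have dsd : d *m s0 *m d = d by apply: s0d.
have z d' : p + d *m s0 = d' -> d' *m s0 *m d = d'.
  move=> <-; apply: s0d.
    by rewrite mulmxDl pd dsd F2_double.
  by rewrite mulmxDl pe -mulmxA s0e mulmx0 addr0.
exists ((p + d *m s0) *m s0), eta; split=> //; last first.
  apply: homogeneous_sub_coef => r b; rewrite mxE.
  case: (b =P a) => [-> _|_]; last by rewrite andbF eqxx.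
  by have [[_ _ h] _ _ _ _] := yE; apply: h.
rewrite z // -/p mulmxA mulmxDr dp mulmxA dd mul0mx addr0.
by rewrite addrC F2_addK.
Qed.

Notation F := (tensor_power n E).

Lemma tensor_contraction : exists S : 'M['F_2]_(adim F), exists c : 'rV_(adim F),
  adiff F *m S + S *m adiff F = 1%:M + aeps F *m c.
Proof.
have [s [eta [ds ed ee _]]] := exists_contraction.
set d := adiff E in ds ed; set e := aeps E in ds ee.
pose p := e *m eta.
have dp : d *m p = 0 by rewrite mulmxA (extension_diff_eps yE) mul0mx.
have pd : p *m d = 0 by rewrite -mulmxA ed mulmx0.
(* The usual contraction of a tensor product: p before factor l, s in it and the identity after it.
   The sum over l telescopes from the identity to the n-th tensor power of p. *)
pose S (l : nat) := tensor_mx (n := n) (E := E) 1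
  (fun j => if (j < l)%N then p else if j == l :> nat then s else 1%:M).
pose R (l : nat) := tensor_mx (n := n) (E := E) 1 (fun j => if (j < l)%N then p else 1%:M).
have DS (l : 'I_n) : adiff F *m S l + S l *m adiff F = R l + R l.+1.
  rewrite tensor_diffE mulmx_suml mulmx_sumr -big_split /= (bigD1 l) //= big1 => [|j jl].
    have eqR (A : 'I_n -> 'M['F_2]_(adim E)) :
        (forall j, j != l -> A j = if (j < l)%N then p else 1%:M) ->
        tensor_mx 1 A = factor_mx l (A l) *m R l.
      move=> h; rewrite factor_tensor_mx1; apply: eq_tensor_mx => j.
      by case: (eqVneq j l) => [->|/h //]; rewrite ltnn mulmx1.
    have e1 : factor_mx l d *m S l = factor_mx l (d *m s) *m R l.
      rewrite factor_tensor_mx1 eqR ?eqxx ?ltnn // => j jl.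
      by rewrite (negPf jl) (inj_eq val_inj) (negPf jl).
    have e2 : S l *m factor_mx l d = factor_mx l (s *m d) *m R l.
      rewrite tensor_mx_factor eqR ?eqxx ?ltnn // => j jl.
      by rewrite (negPf jl) (inj_eq val_inj) (negPf jl).
    have e3 : R l.+1 = factor_mx l p *m R l.
      rewrite /R eqR ?ltnSn // => j jl.
      by rewrite ltnS leq_eqVlt (inj_eq val_inj) (negPf jl).
    have e4 : R l = factor_mx l 1%:M *m R l.
      by rewrite {1}/R eqR ?ltnn.
    by rewrite addr0 e1 e2 -mulmxDl -factor_mxD ds factor_mxD mulmxDl -e4 -e3.
  have [lt|ge] := ltnP j l.
    rewrite /S tensor_mx_factor factor_tensor_mx1.
    rewrite [X in X + _](_ : _ = 0) ?[X in _ + X](_ : _ = 0) ?addr0 //.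
      by apply/matrixP => u v; rewrite !mxE (bigD1 j) //= eqxx lt pd mxE mul0r.
    by apply/matrixP => u v; rewrite !mxE (bigD1 j) //= eqxx lt dp mxE mul0r.
  rewrite /S factor_tensor_mx1 tensor_mx_factor.
  set T1 := (X in X + _); set T2 := (X in _ + X).
  suff -> : T1 = T2 by rewrite F2_double.
  apply: eq_tensor_mx => q.
  case: eqP => // ->.
  by rewrite ltnNge ge (inj_eq val_inj) (negPf jl) mul1mx mulmx1.
exists (\sum_(l < n) S l), (pure_tensor (fun=> eta)).
rewrite mulmx_suml mulmx_sumr -big_split /= (eq_bigr _ (fun l _ => DS l)).
rewrite -(big_mkord xpredT (fun l => R l + R l.+1)).
rewrite (eq_bigr (fun l => R l.+1 - R l)); last by move=> l _; rewrite F2_opp addrC.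
rewrite telescope_sumr // F2_opp addrC; congr (_ + _).
  by rewrite -tensor_mx1; apply: eq_tensor_mx => j.
rewrite /R; apply/matrixP => u v; rewrite [LHS]mxE [RHS]mxE big_ord1 !mxE -big_split /=.
by apply: eq_bigr => j _; rewrite ltn_ord perm1 mxE big_ord1.
Qed.

Lemma tensor_diff_diff : adiff F *m adiff F = 0.
Proof.
rewrite tensor_diffE mulmx_suml.
rewrite (eq_bigr (fun j => \sum_l factor_mx j (adiff E) *m factor_mx l (adiff E))); last first.
  by move=> j _; rewrite mulmx_sumr.
pose M (j l : 'I_n) : 'M['F_2]_#|{: tensor_index n E}| :=
  factor_mx j (adiff E) *m factor_mx l (adiff E).
have -> : \sum_(j < n) \sum_(l < n) M j l = \sum_(j < n) \sum_(l < n | (l < j)%N) M j l +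
    \sum_(j < n) \sum_(l < n | (j < l)%N) M j l.
  rewrite -big_split /=; apply: eq_bigr => j _.
  rewrite (bigID (fun l : 'I_n => (l < j)%N)) /=; congr (_ + _).
  rewrite [RHS]big_mkcond [LHS]big_mkcond; apply: eq_bigr => l _ /=.
  rewrite -leqNgt leq_eqVlt (inj_eq val_inj).
  case: eqP => [<-|_] //=; rewrite ltnn /M factor_mxM (extension_diff_diff yE).
  exact: factor_mx0.
rewrite [X in _ + X](exchange_big_dep xpredT) //= [X in _ + X](eq_bigr (fun j : 'I_n =>
  \sum_(l < n | (l < j)%N) M j l)) ?F2_double // => j _.
by apply: eq_bigr => l lj; apply: factor_mxC; rewrite neq_ltn lj.
Qed.

Lemma tensor_diff_eps : adiff F *m aeps F = 0.
Proof.
rewrite tensor_diffE tensor_epsE mulmx_suml big1 // => j _.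
by rewrite factor_pure_cotensor0 // (extension_diff_eps yE).
Qed.

(** Exactness concerns vector spaces only, so [tensor_contraction] proves it without being
    equivariant. *)
Lemma tensor_power_extension : yoneda_extension (i * n) F.
Proof.
case: (yE) => -[dg dd de] kd ke [e0 _] [le tp t1].
split.
- split=> [w|u v|u].
  + rewrite inE => /forallP wK u v; rewrite mxE prodf_seq_neq0 => /allP h.
    rewrite /= (reindex_inj (@perm_inj _ w.1)) /=; apply: eq_bigr => j _.
    by apply: (dg _ (wK j)); apply: h; rewrite mem_index_enum.
  + rewrite mxE => nz; have [j hj] : exists j, adiff E (tensor_val u j) (tensor_val v j) *
      \prod_(l < n | l != j) (tensor_val u l == tensor_val v l)%:R != 0 :> 'F_2.
      apply/existsP; rewrite -negb_forall; apply: contra nz => /forallP h.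
      by rewrite big1 // => j _; apply/eqP.
    move: hj; rewrite mulf_eq0 negb_or => /andP[/dd e h].
    rewrite /= (bigD1 j) //= [in RHS](bigD1 j) //= -addSn -e; congr (_ + _)%N.
    apply: eq_bigr => l lj; move: h; rewrite prodf_seq_neq0 => /allP /(_ l (mem_index_enum _)).
    by rewrite lj /=; case: (tensor_val u l =P tensor_val v l) => [->|]; rewrite ?eqxx.
  + rewrite mxE prodf_seq_neq0 => /allP h; rewrite /= big1 // => j _.
    by apply: de; apply: h; rewrite mem_index_enum.
- move=> w; rewrite inE => /forallP wK.
  rewrite -[arep F w]/(tensor_rep E w) tensor_repE tensor_diffE mulmx_sumr mulmx_suml.
  rewrite [RHS](reindex_inj (@perm_inj _ w.1)) /=; apply: eq_bigr => j _.
  by apply: factor_tensor_mxC; rewrite kd.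
- move=> w; rewrite inE => /forallP wK.
  rewrite -[arep F w]/(tensor_rep E w) tensor_repE tensor_epsE pure_cotensorM.
  by apply/colP => u; rewrite !mxE; apply: eq_bigr => j _; rewrite ke.
- split; last first.
    apply/andP; split; last first.
      by rewrite sub_kermx mul_mx_row tensor_diff_diff tensor_diff_eps row_mx0.
    have [S [c DS]] := tensor_contraction.
    have := mulmx_ker (row_mx (adiff F) (aeps F)); set k := kermx _.
    rewrite mul_mx_row -row_mx0 => /eq_row_mx[kd' ke'].
    have := congr1 (mulmx k) DS; rewrite !mulmxDr !mulmxA kd' ke' !mul0mx mulmx1 add0r addr0.
    by move=> <-; apply: submxMl.
  have [a ea] : exists a, aeps E a 0 != 0.
    apply/existsP; rewrite -negb_forall; apply: contra e0 => /forallP h.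
    by apply/eqP/colP => a; rewrite (eqP (h a)) mxE.
  apply/eqP => /colP /(_ (enum_rank [ffun=> a])) /eqP; apply/negP.
  rewrite !mxE prodf_seq_neq0; apply/allP => j _ /=.
  by rewrite /tensor_val enum_rankK ffunE.
have tv (u : 'I_#|{: tensor_index n E}|) : (\sum_(j < n) adeg (tensor_val u j) <= i * n)%N.
  have -> : (i * n = \sum_(j < n) i)%N by rewrite sum_nat_const card_ord mulnC.
  by apply: leq_sum => j _; apply: le.
split=> [u|u|w].
- exact: tv.
- rewrite /= -[u in RHS]enum_valK (inj_eq enum_rank_inj).
  apply/eqP/eqP => [e|]; last first.
    rewrite /tensor_val => ->; under eq_bigr do rewrite ffunE.
    rewrite sum_nat_const card_ord mulnC; congr (_ * _)%N.
    by apply/eqP; rewrite tp.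
  apply/ffunP => j; rewrite ffunE; apply/eqP; rewrite -tp -/(tensor_val u j).
  (* Total degree i n is attained only if no factor falls short of degree i. *)
  have : (\sum_(j < n) (i - adeg (tensor_val u j)) = 0)%N.
    rewrite sumnB ?e; last by move=> l _; apply: le.
    by rewrite sum_nat_const card_ord mulnC subnn.
  move/eqP; rewrite sum_nat_eq0 => /forallP /(_ j) /=; rewrite subn_eq0 => h.
  by rewrite eqn_leq le h.
- rewrite inE => /forallP wK; rewrite mxE big1 // => j _.
  by rewrite /tensor_val enum_rankK !ffunE t1.
Qed.

End TensorPowerExtension.

(** * Restriction of a tensor power to an involution *)

Section TensorPowerCharacter.
Local Open Scope ring_scope.
Variables (n : nat) (gT : finGroupType) (K : {group gT}) (i : nat).
Variable E : augmented_complex K.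
Hypothesis yE : yoneda_extension i E.

Notation F := (tensor_power n E).
Notation N := #|{: tensor_index n E}|.
Notation d := (adiff E).

Lemma factor_mx1 j : factor_mx j 1%:M = 1%:M :> 'M_N.
Proof. by rewrite -tensor_mx1; apply: eq_tensor_mx => l; case: ifP. Qed.

Lemma factor_diff_top m (Y : 'M_(m, N)) a j : (Y *m factor_mx j d) a (atop F) = 0.
Proof.
case: yE => -[_ dd _] _ _ _ [le tp _]; rewrite mxE big1 // => u _.
rewrite [factor_mx _ _ _ _]mxE (bigD1 j) //= eqxx perm1 /tensor_val enum_rankK ffunE.
set c := enum_val u j.
have [->|/dd e] := eqVneq (d c (atop E)) 0; first by rewrite mul0r mulr0.
have := le c; rewrite e; have /eqP -> : adeg (atop E) == i by rewrite tp.
by rewrite ltnn.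
Qed.

Lemma pure_tensor_factor (x : 'I_n -> 'rV_(adim E)) j A :
  pure_tensor x *m factor_mx j A = pure_tensor (fun l => if l == j then x l *m A else x l).
Proof.
rewrite /factor_mx pure_tensorM; apply: eq_pure_tensor => l; rewrite perm1.
by case: ifP; rewrite ?mulmx1.
Qed.

Definition parity_mx : 'M['F_2]_(adim E) :=
  \matrix_(a, b) ((a == b) && odd (adeg b))%:R.

Lemma mul_parity_mx m (x : 'M_(m, adim E)) a b :
  (x *m parity_mx) a b = x a b * (odd (adeg b))%:R.
Proof.
rewrite mxE (bigD1 b) //= mxE eqxx big1 ?addr0 // => c /negPf cb.
by rewrite mxE cb mulr0.
Qed.

Lemma parity_mx_mul m (x : 'M_(adim E, m)) a b :
  (parity_mx *m x) a b = (odd (adeg a))%:R * x a b.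
Proof.
rewrite mxE (bigD1 a) //= mxE eqxx big1 ?addr0 // => c ca.
by rewrite mxE eq_sym (negPf ca) mul0r.
Qed.

Lemma parity_rep g : g \in K -> arep E g *m parity_mx = parity_mx *m arep E g.
Proof.
case: yE => -[dg _ _] _ _ _ _ gL; apply/matrixP => a b.
rewrite mul_parity_mx parity_mx_mul.
have [->|/(dg g gL) ->] := eqVneq (arep E g a b) 0; first by rewrite mulr0 mul0r.
by rewrite mulrC.
Qed.

(** Nonzero entries of d join degrees of opposite parity, so exactly one summand survives. In
    [partial_string_element] this identity cancels the surplus product of d_m with the partial
    differential. *)
Lemma parity_diff : d *m parity_mx + parity_mx *m d = d.
Proof.
case: yE => -[_ dd _] _ _ _ _; apply/matrixP => a b.
rewrite mxE mul_parity_mx parity_mx_mul.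
have [->|/dd ->] := eqVneq (d a b) 0; first by rewrite mulr0 mul0r addr0.
by rewrite [(odd _)%:R * _]mulrC -mulrDr /=; case: odd; rewrite ?addr0 ?add0r mulr1.
Qed.

Definition partial_diff (js : seq 'I_n) : 'M['F_2]_N := \sum_(l <- js) factor_mx l d.
Definition partial_parity (js : seq 'I_n) : 'M['F_2]_N :=
  \sum_(l <- js) factor_mx l parity_mx.

Lemma partial_parity_diff js : uniq js ->
  partial_diff js *m partial_parity js + partial_parity js *m partial_diff js =
  partial_diff js.
Proof.
move=> ujs; rewrite /partial_diff mulmx_suml mulmx_sumr -big_split /=.
apply: eq_big_seq => l ljs.
rewrite mulmx_suml mulmx_sumr -big_split /= (bigD1_seq l) //= big1 ?addr0 => [|j jl].
  by rewrite !factor_mxM -factor_mxD parity_diff.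
by rewrite factor_mxC ?F2_double // eq_sym.
Qed.

Lemma partial_parity_comm js j A : j \notin js ->
  factor_mx j A *m partial_parity js = partial_parity js *m factor_mx j A.
Proof.
move=> jjs; rewrite mulmx_sumr mulmx_suml; apply: eq_big_seq => l ljs.
by apply: factor_mxC; apply: contraNneq jjs => ->.
Qed.

Lemma partial_diff_comm js j A : j \notin js ->
  factor_mx j A *m partial_diff js = partial_diff js *m factor_mx j A.
Proof.
move=> jjs; rewrite mulmx_sumr mulmx_suml; apply: eq_big_seq => l ljs.
by apply: factor_mxC; apply: contraNneq jjs => ->.
Qed.

Section Element.
Variables (s : 'S_n) (k : 'I_n -> gT) (x : 'I_n -> 'rV['F_2]_(adim E)).
Hypothesis kK : forall j, k j \in K.
Hypothesis xe : forall j, x j *m aeps E = 1%:M.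
Hypothesis x_fixed : forall j, s j = j -> x j *m arep E (k j) = x j + x j *m d.
Hypothesis x_moved : forall j, s j != j -> x j *m d = 0.
Hypothesis x_swap : forall j, s j != j -> x (s j) *m arep E (k j) = x j.

(** The k_j act in the moved factors and in those of js, so that the fixed factors can be brought in
    one at a time, starting from a pure tensor. *)
Definition partial_rep (js : seq 'I_n) : 'M['F_2]_N :=
  tensor_mx s (fun j => if (s j != j) || (j \in js) then arep E (k j) else 1%:M).

(* Multiplying by 1 + pi d_m, with pi the parity of the degree in the factors
   of js, turns the factorwise relations x_j k_j = x_j (1 + d_j) into the one for
   the total differential: it is the diagonal e_r |-> sum e_a (x) k^a e_(r-a)
   of the standard resolution. *)
Lemma partial_string_element js : uniq js -> {in js, forall j, s j = j} ->
  exists X : 'rV['F_2]_N, [/\ X *m partial_rep js = X + X *m partial_diff js,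
    forall j, s j = j -> j \notin js ->
      X *m factor_mx j (arep E (k j)) = X + X *m factor_mx j d,
    forall j, s j != j -> X *m factor_mx j d = 0,
    X *m pure_cotensor (fun=> aeps E) = 1%:M
  & X 0 (atop F) = \prod_j x j 0 (atop E)].
Proof.
elim: js => [_ _|m js IH /= /andP[mjs ujs] fjs].
  exists (pure_tensor x); split.
  - rewrite /partial_diff big_nil mulmx0 addr0 pure_tensorM; apply: eq_pure_tensor => j.
    by rewrite orbF; case: ifP => [/x_swap //|/negPn/eqP ->]; rewrite mulmx1.
  - move=> j sj _; rewrite -[X in X + _]mulmx1 -(factor_mx1 j) -mulmxDr -factor_mxD.
    rewrite !pure_tensor_factor; apply: eq_pure_tensor => l.
    by case: (l =P j) => // ->; rewrite x_fixed // mulmxDr mulmx1.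
  - move=> j sj; rewrite pure_tensor_factor; apply/rowP => u; rewrite !mxE.
    by rewrite (bigD1 j) //= eqxx x_moved // mxE mul0r.
  - by rewrite pure_pairing big1 // => j _; rewrite xe mxE eqxx.
  by rewrite mxE; apply: eq_bigr => j _; rewrite /tensor_val enum_rankK ffunE.
have [|X [Xa Xb Xc Xd Xt]] := IH ujs.
  by move=> j jjs; apply: fjs; rewrite inE jjs orbT.
have sm : s m = m by apply: fjs; rewrite inE eqxx.
pose km := factor_mx (n := n) m (arep E (k m)).
pose dm : 'M_N := factor_mx m d.
pose Q : 'M_N := partial_parity js *m dm.
pose D := partial_diff js; pose W := partial_rep js.
have kd := let: And5 _ h _ _ _ := yE in h.
have eW : partial_rep (m :: js) = W *m km.
  rewrite tensor_mx_factor; apply: eq_tensor_mx => l; rewrite inE.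
  by case: (l =P m) => // ->; rewrite sm eqxx (negPf mjs) /= mul1mx.
have dmm : dm *m dm = 0 by rewrite factor_mxM (extension_diff_diff yE) factor_mx0.
have dmD : dm *m D = D *m dm by apply: partial_diff_comm.
have dmP : dm *m partial_parity js = partial_parity js *m dm by apply: partial_parity_comm.
have dmQ : dm *m Q = 0 by rewrite mulmxA dmP -mulmxA dmm mulmx0.
have Qdm : Q *m dm = 0 by rewrite -mulmxA dmm mulmx0.
have WP : W *m partial_parity js = partial_parity js *m W.
  rewrite mulmx_sumr mulmx_suml; apply: eq_big_seq => l ljs.
  have sl : s l = l by apply: fjs; rewrite inE ljs orbT.
  rewrite -{2}sl; apply: factor_tensor_mxC; case: ifP => _.
    by rewrite parity_rep.
  by rewrite mul1mx mulmx1.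
have Wd : W *m dm = dm *m W.
  rewrite [LHS]factor_tensor_mxC ?sm // eqxx (negPf mjs) /=.
  by rewrite mul1mx mulmx1.
have kmP : km *m partial_parity js = partial_parity js *m km by apply: partial_parity_comm.
have kmD : km *m D = D *m km by apply: partial_diff_comm.
have kmd : km *m dm = dm *m km by rewrite !factor_mxM kd.
have QW : Q *m (W *m km) = W *m km *m Q.
  rewrite /Q -[LHS]mulmxA [dm *m (W *m km)]mulmxA -Wd -[W *m dm *m km]mulmxA -kmd.
  rewrite [LHS]mulmxA -WP -[LHS]mulmxA -[RHS]mulmxA; congr (_ *m _).
  by rewrite !mulmxA kmP.
have Qj j A : j != m -> j \notin js -> factor_mx j A *m Q = Q *m factor_mx j A.
  by move=> jm jjs; rewrite mulmxA partial_parity_comm // -!mulmxA factor_mxC.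
exists (X + X *m Q); split.
- rewrite eW mulmxDl -[X *m Q *m _]mulmxA QW [X *m (W *m km *m Q)]mulmxA.
  have -> : X *m (W *m km) = X + X *m dm + (X *m D + X *m dm *m D).
    rewrite mulmxA Xa mulmxDl -[X *m _ *m km]mulmxA -kmD mulmxA.
    by rewrite Xb // mulmxDl.
  have -> : (X + X *m dm + (X *m D + X *m dm *m D)) *m Q = X *m Q + X *m D *m Q.
    rewrite !mulmxDl -[X *m dm *m Q]mulmxA dmQ mulmx0 addr0.
    by rewrite -[X *m dm *m D]mulmxA dmD -!mulmxA dmQ !mulmx0 addr0.
  have -> : partial_diff (m :: js) = dm + D by rewrite /partial_diff big_cons.
  rewrite mulmxDl !mulmxDr -[X *m Q *m dm]mulmxA Qdm mulmx0 add0r.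
  have -> : X *m Q *m D = X *m dm *m D + X *m D *m Q.
    have := partial_parity_diff ujs; rewrite -/D => e.
    rewrite -!mulmxA -mulmxDr; congr (_ *m _).
    rewrite dmD /Q [LHS]mulmxA [D *m (_ *m _)]mulmxA -mulmxDl.
    congr (_ *m _).
    by rewrite -[X in _ = X + _]e addrC addrA F2_double add0r.
  set a := X *m dm; set b := X *m D; set c := X *m Q.
  by rewrite [RHS]addrAC -!addrA [c + _]addrC.
- move=> j sj; rewrite inE negb_or => /andP[jm jjs].
  have XQ A : X *m Q *m factor_mx j A = X *m factor_mx j A *m Q.
    by rewrite -(mulmxA X Q) -(Qj _ _ jm jjs) (mulmxA X).
  by rewrite mulmxDl [(X + _) *m factor_mx j d]mulmxDl !XQ Xb // mulmxDl addrACA.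
- move=> j sj; have jm : j != m by apply: contraNneq sj => ->; rewrite sm.
  have jjs : j \notin js.
    by apply: contraNN sj => jjs; apply/eqP/fjs; rewrite inE jjs orbT.
  by rewrite mulmxDl -(mulmxA X Q) -(Qj _ _ jm jjs) (mulmxA X) Xc // mul0mx addr0.
- rewrite mulmxDl Xd -!mulmxA factor_pure_cotensor0 ?mulmx0 ?addr0 //.
  exact: (extension_diff_eps yE).
(* The correction X Q ends with d_m, which does not reach the top degree. *)
by rewrite mxE mulmxA factor_diff_top addr0.
Qed.

End Element.

End TensorPowerCharacter.

(** * Existence of extensions *)

Section Splice.
Local Open Scope ring_scope.
Variables (gT : finGroupType) (L : {group gT}).

(* As [yoneda_extension], but for an exact sequence ending with a submodule of a
   module k^q instead of k; the field [aeps] of A is ignored. *)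
Definition partial_extension (i q : nat) (rQ : gT -> 'M['F_2]_q)
    (A : augmented_complex L) (e : 'M_(adim A, q)) : Prop :=
  [/\ [/\ {in L, forall g a b, arep A g a b != 0 -> adeg a = adeg b},
          forall a b, adiff A a b != 0 -> adeg a = (adeg b).+1
        & forall a b, e a b != 0 -> adeg a = 0%N],
      {in L, forall g, arep A g *m adiff A = adiff A *m arep A g},
      {in L, forall g, arep A g *m e = e *m rQ g},
      (kermx (row_mx (adiff A) e) == adiff A)%MS
    & [/\ forall a : 'I_(adim A), (adeg a <= i)%N,
          forall a : 'I_(adim A), (adeg a == i) = (a == atop A)
        & {in L, forall g, arep A g (atop A) (atop A) = 1}]].

Section Block.
Variables (p q i : nat) (rM : mx_representation 'F_2 L p) (rQ : gT -> 'M['F_2]_q).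
Variables (A : augmented_complex L) (e : 'M['F_2]_(adim A, p)) (t : 'M['F_2]_(p, q)).

Lemma block_repr : mx_repr L (fun g => block_mx (rM g) 0 0 (arep A g)).
Proof.
split=> [|g h gL hL]; first by rewrite !repr_mx1 -scalar_mx_block.
by rewrite mulmx_block !repr_mxM // !mulmx0 !mul0mx !addr0 !add0r.
Qed.

(** Yoneda splice: the module of rM in degree 0 and A moved up by one degree, joined by e. *)
Definition splice : augmented_complex L := {|
  adim := (p + adim A)%N;
  arep := MxRepresentation block_repr;
  adeg := fun a => if split a is inr b then (adeg b).+1 else 0%N;
  adiff := block_mx 0 0 e (adiff A);
  aeps := 0;
  atop := rshift p (atop A)
|}.

Hypothesis pA : partial_extension i rM e.
Hypothesis et : (kermx t == e)%MS.
Hypothesis kt : {in L, forall g, rM g *m t = t *m rQ g}.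

Lemma splice_adeg (x : 'I_p + 'I_(adim A)) :
  adeg (a := splice) (unsplit x) = if x is inr b then (adeg b).+1 else 0%N.
Proof. by rewrite /= unsplitK. Qed.

Lemma degree0_lift (x : 'rV['F_2]_p) : (x <= e)%MS ->
  exists z : 'rV_(adim A), z *m e = x /\ z *m adiff A = 0.
Proof.
case: pA => -[_ dd de] _ _ _ _ /submxP[z ->].
(* The degree 0 part of a lift is again a lift, as e vanishes in positive degrees, and its boundary
   is 0. *)
exists (\row_a (z 0 a * (adeg a == 0%N)%:R)); split; apply/rowP => b; rewrite !mxE.
  apply: eq_bigr => a _; rewrite mxE.
  have [->|/de ->] := eqVneq (e a b) 0; first by rewrite !mulr0.
  by rewrite mulr1.
apply: big1 => a _; rewrite mxE.
by have [->|/dd ->] := eqVneq (adiff A a b) 0; rewrite ?mulr0 // mul0r.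
Qed.

Lemma splice_partial_extension :
  partial_extension (A := splice) i.+1 rQ (col_mx t (0 : 'M_(adim A, q))).
Proof.
case: (pA) => -[dg dd de] kd ke /andP[ker1 ker2] [le tp t1].
have /andP[et1 et2] := et.
split.
- split=> [g gL a b|a b|a b].
  + rewrite -[a]splitK -[b]splitK !splice_adeg /=.
    case: (split a) (split b) => [a'|a'] [b'|b'] /=; rewrite ?block_mxEul ?block_mxEur
      ?block_mxEdl ?block_mxEdr ?mxE ?eqxx // => /dg -> //.
  + rewrite -[a]splitK -[b]splitK !splice_adeg /=.
    case: (split a) (split b) => [a'|a'] [b'|b'] /=; rewrite ?block_mxEul ?block_mxEur
      ?block_mxEdl ?block_mxEdr ?mxE ?eqxx //; first by move/de->.
    by move/dd->.
  + rewrite -[a]splitK !splice_adeg /=.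
    by case: (split a) => a' /=; rewrite ?col_mxEu ?col_mxEd ?mxE ?eqxx.
- move=> g gL /=; rewrite !mulmx_block !mulmx0 !mul0mx !addr0 !add0r.
  by rewrite kd // ke.
- move=> g gL /=; rewrite mul_block_col mul_col_mx !mulmx0 !mul0mx !addr0.
  by rewrite kt.
- apply/andP; split; last first.
    rewrite sub_kermx /= mul_mx_row mulmx_block mul_block_col.
    have : adiff A *m row_mx (adiff A) e = 0 by apply/eqP; rewrite -sub_kermx.
    rewrite mul_mx_row -row_mx0 => /eq_row_mx[-> ->].
    have -> : e *m t = 0 by apply/eqP; rewrite -sub_kermx.
    by rewrite !mulmx0 !mul0mx !addr0 block_mx0 col_mx0 row_mx0.
  apply/rV_subP => v; rewrite sub_kermx -[v]hsubmxK; set x := lsubmx v; set y := rsubmx v.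
  rewrite /= mul_mx_row mul_row_block mul_row_col !mulmx0 addr0 !add0r.
  rewrite -row_mx0 => /eqP/eq_row_mx[].
  rewrite -row_mx0 => /eq_row_mx[ye yd] xt.
  have xe : (x <= e)%MS by apply: submx_trans et1; rewrite sub_kermx xt.
  have /submxP[y1 ey] : (y <= adiff A)%MS.
    by apply: submx_trans ker1; rewrite sub_kermx mul_mx_row ye yd row_mx0.
  (* y1 has boundary y, but e has to send the preimage to x; z makes up for the difference without
     changing the boundary. *)
  have [|z [ze zd]] := @degree0_lift (x + y1 *m e).
    by rewrite addmx_sub ?submxMl.
  apply/submxP; exists (row_mx 0 (y1 + z)).
  rewrite mul_row_block !mul0mx !add0r !mulmxDl ze zd addr0 -ey.
  by rewrite addrCA F2_double addr0.
split=> [a|a|g gL].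
- rewrite -[a]splitK splice_adeg; case: (split a) => //= b.
- rewrite -[a]splitK splice_adeg /=; case: (split a) => b /=.
    by rewrite eq_lrshift.
  by rewrite eqSS tp eq_rshift.
- by rewrite /= block_mxEdr t1.
Qed.

End Block.

Section ChainMaps.
Variable P : complete_resolution L.

(** [conform_mx] replaces a cast along j = m. *)
Definition at_degree (m r : nat) (M : 'M['F_2]_(cdim P m%:Z, r)) (j : nat) :
    'M['F_2]_(cdim P j%:Z, r) :=
  if j == m then conform_mx 0 M else 0.

Lemma at_degree_id m r (M : 'M_(cdim P m%:Z, r)) : at_degree M m = M.
Proof. by rewrite /at_degree eqxx conform_mx_id. Qed.

Lemma at_degree_off m r (M : 'M_(cdim P m%:Z, r)) j : j != m -> at_degree M j = 0.
Proof. by rewrite /at_degree => /negPf ->. Qed.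

(* phi is a chain map from P_m <- P_(m+1) <- ... to A, over tP and with top
   component a. *)
Definition partial_chain_map (m h q : nat) (A : augmented_complex L)
    (e : 'M['F_2]_(adim A, q)) (tP : 'M['F_2]_(cdim P m%:Z, q))
    (a : 'cV['F_2]_(cdim P h%:Z))
    (phi : forall j : nat, 'M['F_2]_(cdim P j%:Z, adim A)) : Prop :=
  [/\ forall j u b, phi j u b != 0 -> j = (m + adeg b)%N,
      forall j, {in L, forall g, crep P j%:Z g *m phi j = phi j *m arep A g},
      forall j, (m <= j)%N -> cdiff P j.+1%:Z j%:Z *m phi j = phi j.+1 *m adiff A,
      phi m *m e = tP
    & a = col (atop A) (phi h)].

Lemma splice_chain_map (p q i m h : nat) (rM : mx_representation 'F_2 L p)
    (A : augmented_complex L) (e : 'M['F_2]_(adim A, p)) (t : 'M['F_2]_(p, q)) (psi : 'M_(cdim P m%:Z, p)) (a : 'cV_(cdim P h%:Z)) phi :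
  partial_extension i rM e ->
  partial_chain_map e (cdiff P m.+1%:Z m%:Z *m psi) a phi ->
  {in L, forall g, crep P m%:Z g *m psi = psi *m rM g} ->
  partial_chain_map (A := splice rM e) (col_mx t (0 : 'M_(adim A, q))) (psi *m t) a
    (fun j => row_mx (at_degree psi j) (phi j)).
Proof.
move=> [[_ dd de] _ _ _ _] [dphi kphi cphi ephi ea] kpsi.
have phi_m : phi m = 0.
  apply/matrixP => u b; rewrite [RHS]mxE; apply/eqP/negP => /negP /dphi e0; lia.
have phi_e j : j != m.+1 -> phi j *m e = 0.
  move=> jm; apply/matrixP => u b; rewrite [RHS]mxE mxE big1 // => c _.
  have [->|/dphi e1] := eqVneq (phi j u c) 0; first by rewrite mul0r.
  have [->|/de e2] := eqVneq (e c b) 0; first by rewrite mulr0.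
  by rewrite e2 addn0 in e1; rewrite e1 eqxx in jm.
have phi_d : phi m.+1 *m adiff A = 0.
  apply/matrixP => u b; rewrite [RHS]mxE mxE big1 // => c _.
  have [->|/dphi e1] := eqVneq (phi m.+1 u c) 0; first by rewrite mul0r.
  have [->|/dd e2] := eqVneq (adiff A c b) 0; first by rewrite mulr0.
  by move: e1; rewrite e2; lia.
split.
- move=> j u b; rewrite -[b]splitK splice_adeg /=; case: (split b) => c /=.
    rewrite row_mxEl /at_degree addn0; case: (j =P m) => // _.
    by rewrite mxE eqxx.
  by rewrite row_mxEr => /dphi ->; rewrite addnS addSn.
- move=> j g gL; rewrite /= mul_row_block mul_mx_row !mulmx0 addr0 add0r kphi //.
  congr row_mx; have [->|jm] := eqVneq j m; first by rewrite at_degree_id kpsi.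
  by rewrite at_degree_off // mulmx0 mul0mx.
- move=> j mj; rewrite /= mul_row_block mul_mx_row !mulmx0 !add0r.
  have [jm|jm] := eqVneq j m.
    by subst j; rewrite at_degree_id phi_m mulmx0 ephi phi_d.
  by rewrite at_degree_off // mulmx0 phi_e ?eqSS // cphi // ltn_neqAle eq_sym jm.
- by rewrite mul_row_col mulmx0 addr0 at_degree_id.
by rewrite /= ea; apply/colP => u; rewrite !mxE -[rshift _ _]/(unsplit (inr _)) unsplitK.
Qed.

End ChainMaps.
End Splice.

Section ExtensionExistence.
Local Open Scope ring_scope.
Variables (gT : finGroupType) (L : {group gT}).

Lemma trivial_repr : mx_repr L (fun=> 1%:M : 'M['F_2]_1).
Proof. by split=> // g h _ _; rewrite mulmx1. Qed.

Definition trivial_complex : augmented_complex L := {|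
  adim := 1;
  arep := MxRepresentation trivial_repr;
  adeg := fun=> 0%N;
  adiff := 0;
  aeps := 0;
  atop := ord0
|}.

Lemma trivial_partial_extension q (rQ : gT -> 'M['F_2]_q) (e : 'rV_q) :
  e != 0 -> {in L, forall g, e *m rQ g = e} ->
  partial_extension (A := trivial_complex) 0 rQ e.
Proof.
move=> e0 ke; split=> //.
- by split=> // a b; rewrite mxE eqxx.
- by move=> g gL; rewrite mulmx0 mul0mx.
- by move=> g gL; rewrite mul1mx ke.
- apply/andP; split; last exact: sub0mx.
  apply/rV_subP => v; rewrite sub_kermx mul_mx_row mulmx0 -row_mx0 => /eqP/eq_row_mx[_].
  rewrite [v]mx11_scalar mul_scalar_mx => /eqP; rewrite scaler_eq0 (negPf e0) orbF.
  by move=> /eqP ->; rewrite raddf0 sub0mx.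
by split=> [//|a|g gL]; rewrite ?(ord1 a) ?eqxx // mxE eqxx.
Qed.

Variable P : complete_resolution L.

Lemma trivial_chain_map h q (e : 'rV_q) (a : 'cV_(cdim P h%:Z)) : is_cocycle a ->
  partial_chain_map (A := trivial_complex) (m := h) e (a *m e) a (at_degree a).
Proof.
move=> /is_cocycleP[ka da]; split.
- move=> j u b; rewrite /= addn0 /at_degree; case: (j =P h) => // _.
  by rewrite mxE eqxx.
- move=> j g gL; rewrite /= mulmx1; have [->|jh] := eqVneq j h.
    by rewrite at_degree_id ka.
  by rewrite at_degree_off // mulmx0.
- move=> j _; rewrite /= mulmx0; have [->|jh] := eqVneq j h.
    by rewrite at_degree_id da.
  by rewrite at_degree_off // mulmx0.
- by rewrite at_degree_id.
by rewrite at_degree_id; apply/colP => u; rewrite mxE.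
Qed.

(* The quotient of P_m + k identifying (d z, 0) with (0, a z), for z in P_(m+1). *)
Section Pushout.
Variables (m q : nat) (rQ : gT -> 'M['F_2]_q) (tP : 'M['F_2]_(cdim P m%:Z, q)).
Variable a : 'cV['F_2]_(cdim P m.+1%:Z).
Hypothesis ktP : {in L, forall g, crep P m%:Z g *m tP = tP *m rQ g}.
Hypothesis exP : (kermx tP == cdiff P m.+1%:Z m%:Z)%MS.
Hypothesis ca : is_cocycle a.

Lemma sum_repr : mx_repr L (fun g => block_mx (crep P m%:Z g) 0 0 (1%:M : 'M['F_2]_1)).
Proof.
split=> [|g h gL hL]; first by rewrite !repr_mx1 -scalar_mx_block.
by rewrite mulmx_block !repr_mxM // !mulmx0 !mul0mx !addr0 !add0r mulmx1.
Qed.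

Let rS := MxRepresentation sum_repr.
Let R := row_mx (cdiff P m.+1%:Z m%:Z) a.
Let U := <<R>>%MS.

Lemma pushout_module : mxmodule rS U.
Proof.
apply/mxmoduleP => g gL; rewrite genmxE (eqmxMr _ (genmxE _)).
have /is_cocycleP[ka _] := ca.
rewrite /R /= mul_row_block !mulmx0 addr0 add0r mulmx1 -cdiff_equivariant //.
by rewrite -[a in X in (X <= _)%MS](ka g gL) -mul_mx_row submxMl.
Qed.

Let rM := factmod_repr pushout_module.
Let c := col_mx tP (0 : 'M['F_2]_(1, q)).
Let V : 'M_(_, cdim P m%:Z + 1)  := val_factmod (U := U) 1%:M.

Lemma cdiff_tP : cdiff P m.+1%:Z m%:Z *m tP = 0.
Proof. by have /andP[_ h] := exP; apply/eqP; rewrite -sub_kermx. Qed.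

Lemma pushout_factor r (x : 'M_(r, cdim P m%:Z + 1)) :
  in_factmod U x *m (V *m c) = x *m c.
Proof.
rewrite -[x in RHS](add_sub_fact_mod U) mulmxDl mulmxA -val_factmodE.
suff -> : val_submod (in_submod U x) *m c = 0 by rewrite add0r.
have : (val_submod (in_submod U x) <= R)%MS.
  by rewrite (submx_trans (val_submodP _)) // genmxE.
case/submxP => y ->; rewrite -mulmxA mul_row_col cdiff_tP mulmx0 addr0.
by rewrite mulmx0.
Qed.

Lemma mul_in_factmod r r' (A : 'M_(r, r')) (x : 'M_(r', _)) :
  A *m in_factmod U x = in_factmod U (A *m x).
Proof. by rewrite /in_factmod /= mulmxA. Qed.

Lemma pushout_surj (y : 'rV_(\rank (cokermx U))) : exists x, y = in_factmod U x.
Proof. by exists (val_factmod y); rewrite val_factmodK. Qed.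

Lemma in_pushout0 r (x : 'M_(r, _)) : (x <= R)%MS -> in_factmod U x = 0.
Proof. by move=> xR; apply/eqP; rewrite in_factmod_eq0 genmxE. Qed.

Let e : 'rV_(\rank (cokermx U)) := in_factmod U (row_mx 0 (1%:M : 'M['F_2]_1)).
Let t := V *m c.
Let psi := in_factmod U (row_mx (1%:M : 'M['F_2]_(cdim P m%:Z)) 0).

(** If (0, 1) = (z d, z a), then z is a boundary by exactness, and the cocycle a kills it. *)
Lemma pushout_e_neq0 : e != 0.
Proof.
rewrite in_factmod_eq0 genmxE; apply/negP => /submxP[z].
rewrite /R mul_mx_row => /eq_row_mx[/esym zd za].
have /is_cocycleP[_ da] := ca.
have /submxP[z' ez] := cdiff_lift (Posz_succ m) (Posz_succ m.+1) zd.
move: za; rewrite ez -mulmxA da mulmx0 => /matrixP /(_ 0 0) /eqP.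
by rewrite !mxE eqxx oner_eq0.
Qed.

Lemma pushout_e_invariant : {in L, forall g, e *m rM g = e}.
Proof.
move=> g gL; rewrite -in_factmodJ //; congr in_factmod.
by rewrite /= mul_row_block !mulmx0 !mul0mx !add0r mulmx1.
Qed.

Lemma pushout_kernel : (kermx t == e)%MS.
Proof.
apply/andP; split.
  apply/rV_subP => y; rewrite sub_kermx; have [x ->] := pushout_surj y.
  rewrite pushout_factor -[x]hsubmxK mul_row_col mulmx0 addr0 => /eqP x1.
  have /submxP[z ez] : (lsubmx x <= cdiff P m.+1%:Z m%:Z)%MS.
    by have /andP[h _] := exP; apply: submx_trans h; rewrite sub_kermx x1.
  apply/submxP; exists (rsubmx x - z *m a).
  have -> : row_mx (lsubmx x) (rsubmx x) =
      z *m R + row_mx 0 (rsubmx x - z *m a).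
    by rewrite mul_mx_row add_row_mx addr0 -ez addrC subrK.
  rewrite linearD /= in_pushout0 ?submxMl // add0r.
  by rewrite /e /in_factmod /= mulmxA mul_mx_row mulmx0 mulmx1.
by rewrite sub_kermx pushout_factor mul_row_col mul0mx mulmx0 addr0.
Qed.

Lemma pushout_t_equivariant : {in L, forall g, rM g *m t = t *m rQ g}.
Proof.
move=> g gL; apply/row_matrixP => r; rewrite !rowE.
have [x ->] := pushout_surj (delta_mx 0 r).
have -> : in_factmod U x *m (rM g *m t) = in_factmod U (x *m rS g) *m t.
  by rewrite (in_factmodJ pushout_module) // mulmxA.
have -> : in_factmod U x *m (t *m rQ g) = in_factmod U x *m t *m rQ g by rewrite mulmxA.
rewrite !pushout_factor -!mulmxA; congr (_ *m _).
by rewrite /= mul_block_col mul_col_mx !mulmx0 !mul0mx !addr0 ktP.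
Qed.

Lemma pushout_psi_equivariant : {in L, forall g, crep P m%:Z g *m psi = psi *m rM g}.
Proof.
move=> g gL; rewrite -in_factmodJ // /psi /in_factmod /= mulmxA; congr (_ *m _).
by rewrite mul_mx_row mul_row_block !mulmx0 !mul0mx !mulmx1 !mul1mx !addr0.
Qed.

Lemma pushout_psi_t : psi *m t = tP.
Proof. by rewrite pushout_factor mul_row_col mul1mx mul0mx addr0. Qed.

Lemma pushout_relation : a *m e = cdiff P m.+1%:Z m%:Z *m psi.
Proof.
apply/eqP; rewrite -subr_eq0 F2_opp /e /psi !mul_in_factmod -linearD /=.
rewrite !mul_mx_row !mulmx0 !mulmx1 add_row_mx add0r addr0.
by rewrite in_pushout0.
Qed.

Lemma pushout_t_sub : (t <= tP)%MS.
Proof. by rewrite /t -[V]hsubmxK mul_row_col mulmx0 addr0 submxMl. Qed.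

Lemma pushout_extension : exists (A : augmented_complex L) (e' : 'M_(adim A, q)) phi,
  [/\ partial_extension 1 rQ e', partial_chain_map e' tP a phi & (e' <= tP)%MS].
Proof.
have pe := trivial_partial_extension pushout_e_neq0 pushout_e_invariant.
exists (splice rM (A := trivial_complex) e), (col_mx t 0),
  (fun j => row_mx (at_degree psi j) (at_degree a j)); split.
- exact: splice_partial_extension pe pushout_kernel pushout_t_equivariant.
- rewrite -pushout_psi_t; apply: splice_chain_map pe _ pushout_psi_equivariant.
  by rewrite -pushout_relation; apply: trivial_chain_map.
by rewrite col_mx_sub pushout_t_sub sub0mx.
Qed.

End Pushout.

(** The extension is the resolution from P_m to P_(h-1), with P_(h-1) replaced by its pushout along
    a; the induction splices on one module at a time. The bound e <= tP and the chain map over tP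
    give e and tP the same row space, which is the exactness needed for the next splice. *)
Lemma exists_partial_extension i : forall m h q (rQ : gT -> 'M['F_2]_q)
    (tP : 'M['F_2]_(cdim P m%:Z, q)) (a : 'cV['F_2]_(cdim P h%:Z)),
  h = (m + i.+1)%N -> is_cocycle a ->
  {in L, forall g, crep P m%:Z g *m tP = tP *m rQ g} ->
  (kermx tP == cdiff P m.+1%:Z m%:Z)%MS ->
  exists (A : augmented_complex L) (e : 'M_(adim A, q)) phi,
  [/\ partial_extension i.+1 rQ e, partial_chain_map e tP a phi & (e <= tP)%MS].
Proof.
elim: i => [|i IH] m h q rQ tP a.
  by rewrite addn1 => eh; subst h => ca ktP exP; apply: pushout_extension.
rewrite addnS -addSn => eh ca ktP exP.
have [||A [e [phi [pA pphi le]]]] :=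
  IH m.+1 h _ (crep P m%:Z) (cdiff P m.+1%:Z m%:Z) a eh ca.
- by move=> g gL; rewrite cdiff_equivariant.
- apply/andP; split.
    by apply: (cdiff_lift (Posz_succ m) (Posz_succ m.+1)); apply: mulmx_ker.
  by rewrite sub_kermx cdiff_cdiff.
exists (splice (crep P m%:Z) e), (col_mx tP 0),
  (fun j => row_mx (at_degree (1%:M : 'M_(cdim P m%:Z)) j) (phi j)); split.
- apply: splice_partial_extension pA _ ktP.
  have /andP[k1 k2] := exP; apply/andP; split; last exact: submx_trans le k2.
  apply: submx_trans k1 _; case: pphi => _ _ _ <- _; exact: submxMl.
- rewrite -[tP in partial_chain_map _ tP]mul1mx.
  apply: (splice_chain_map _ pA); first by rewrite mulmx1.
  by move=> g gL; rewrite mulmx1 mul1mx.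
by rewrite col_mx_sub submx_refl sub0mx.
Qed.

Lemma exists_extension i (a : 'cV_(cdim P i.+1%:Z)) : is_cocycle a ->
  exists2 E : augmented_complex L, yoneda_extension i.+1 E & extension_cocycle E a.
Proof.
move=> ca.
have [|||A [e [phi [pA [dphi kphi cphi ephi ea] _]]]] :=
  @exists_partial_extension i 0 i.+1 1 (fun=> 1%:M) (ceps P) a _ ca.
- by [].
- by move=> g gL; rewrite ceps_equivariant // mulmx1.
- exact: ceps_exact.
case: pA => -[dg dd de] kd ke ex tp.
exists (AugmentedComplex (arep A) (adeg (a := A)) (adiff A) e (atop A)).
  split=> //=.
  - by split=> // b eb; apply: (de b 0).
  - by move=> g gL; rewrite ke // mulmx1.
  split=> //; apply: contra_neq (ceps_neq0 P) => e0.
  by rewrite -ephi e0 mulmx0.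
exists phi; split=> //= j; last exact: cphi.
by move=> u b /dphi; rewrite add0n.
Qed.

End ExtensionExistence.

Section TensorPowerClass.
Local Open Scope ring_scope.
Variables (n : nat) (gT : finGroupType) (K : {group gT}).
Variables (PK : complete_resolution K) (PW : complete_resolution (wreath_group n K)).

Lemma tensor_power_class_represented i (x : cohomology PK ordinary i.+1%:Z) :
  exists (E : augmented_complex K) a b,
  [/\ yoneda_extension i.+1 E, extension_cocycle E a, represented x a,
      extension_cocycle (tensor_power n E) b
    & represented (tensor_power_class PW x) b].
Proof.
have [a xa] := represented_ex x.
have [E yE ea] := exists_extension (represented_cocycle xa).
have yF := tensor_power_extension n yE.
have [b eb] := exists_extension_cocycle PW yF.
have [y yb] := cocycle_represents ordinary (extension_cocycle_cocycle yF eb).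
have ex : exists y : cohomology PW ordinary (i.+1 * n)%N%:Z,
  exists (E : augmented_complex K) a b,
  [/\ yoneda_extension i.+1 E, extension_cocycle E a, represented x a,
      extension_cocycle (tensor_power n E) b & represented y b].
  by exists y, E, a, b.
exact: (classical_sets.xgetPex 0 ex).
Qed.

Lemma tensor_power_class_degree0 (x : cohomology PK ordinary 0%:Z) c :
  represented x (c *: ceps PK) ->
  represented (tensor_power_class PW x : cohomology PW ordinary 0%:Z) (c ^+ n *: ceps PW).
Proof.
move=> xc; have [y yc] := cocycle_represents ordinary (cocycle_ceps PW (c ^+ n)).
have ex : exists y : cohomology PW ordinary 0%:Z,
  exists2 c : 'F_2, represented x (c *: ceps PK) & represented y (c ^+ n *: ceps PW).
  by exists y, c.
have [c' xc' yc'] := classical_sets.xgetPex 0 ex.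
suff -> : c = c' by [].
have := represented_degree0_inj xc xc' => /(congr1 (mulmx (augmentation1 PK))).
rewrite -!scalemxAr augmentation1P => /matrixP /(_ 0 0).
by rewrite !mxE eqxx !mulr1.
Qed.

(* The double coset formula for the restriction of a tensor power to an
   involution: the orbits of length 2 contribute norms from the trivial group,
   which vanish in positive degree. *)
Lemma chi_tensor_power i (x : cohomology PK ordinary i.+1%:Z) w :
  w \in wreath_group n K -> (w * w)%g = 1%g ->
  chi w (tensor_power_class PW x) =
    if w.1 == 1%g then \prod_j chi (w.2 j) x else 0.
Proof.
move=> wW ww; have [E [a [b [yE ea xa eb yb]]]] := tensor_power_class_represented x.
have wK : forall j, w.2 j \in K by move: wW; rewrite inE => /forallP.
have w1 j : w.1 (w.1 j) = j by rewrite -permM -[(w.1 * w.1)%g]/((w * w)%g).1 ww perm1.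
have w2 j : (w.2 (w.1 j) * w.2 j = 1)%g.
  by have := congr1 (fun u : wreath n gT => u.2 j) ww; rewrite /= !ffunE.
have ex_str j : exists X : 'rV['F_2]_(adim E), w.1 j = j ->
    [/\ X *m arep E (w.2 j) = X + X *m adiff E,
    X *m aeps E = 1%:M & chi (w.2 j) x = X 0 (atop E)].
  have [wj|wj] := eqVneq (w.1 j) j; last by exists 0 => e; rewrite e eqxx in wj.
  have kk : (w.2 j * w.2 j = 1)%g by have := w2 j; rewrite wj.
  by have [X hX] := exists_string_element yE (wK j) kk ea xa; exists X.
have [X hX] := fin_all_exists ex_str.
have [s [eta [_ etad etae eta0]]] := exists_contraction yE.
have [[_ _ _] kd ke _ [_ tp _]] := yE.
(* Of two indices exchanged by w, the smaller carries eta, a cycle of degree 0 and augmentation 1,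
   and the larger its translate, so that w swaps them. *)
pose y j := if w.1 j == j then X j else
  if (j < w.1 j)%N then eta else eta *m arep E (w.2 j).
have ye j : y j *m aeps E = 1%:M.
  rewrite /y; case: eqP => [/hX[]//|_]; case: ifP => // _.
  by rewrite -mulmxA ke.
have yfix j : w.1 j = j -> y j *m arep E (w.2 j) = y j + y j *m adiff E.
  by move=> wj; rewrite /y wj eqxx; have [] := hX j wj.
have ymov j : w.1 j != j -> y j *m adiff E = 0.
  move=> wj; rewrite /y (negPf wj); case: ifP => // _.
  by rewrite -mulmxA kd // mulmxA etad mul0mx.
have yswap j : w.1 j != j -> y (w.1 j) *m arep E (w.2 j) = y j.
  move=> wj; rewrite /y w1 [j == _]eq_sym (negPf wj).
  have [lt|gt|e] := ltngtP j (w.1 j).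
  - by rewrite -mulmxA -repr_mxM // w2 repr_mx1 mulmx1.
  - by [].
  by case/eqP: wj; apply: val_inj.
pose js := [seq j <- enum 'I_n | w.1 j == j].
have ujs : uniq js by rewrite filter_uniq ?enum_uniq.
have fjs : {in js, forall j, w.1 j = j} by move=> j; rewrite mem_filter => /andP[/eqP].
have [Z [Za _ Zc Zd Zt]] := partial_string_element yE wK ye yfix ymov yswap ujs fjs.
have Zrep : Z *m arep (tensor_power n E) w = Z + Z *m adiff (tensor_power n E).
  rewrite tensor_diffE mulmx_sumr (bigID (fun j => w.1 j == j)) /=.
  rewrite [X in Z + (_ + X)]big1; last by move=> j; apply: Zc.
  rewrite addr0 -mulmx_sumr.
  have -> : \sum_(j | w.1 j == j) factor_mx j (adiff E) = partial_diff E js.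
    by rewrite /partial_diff big_filter big_enum_cond.
  rewrite -Za; congr (_ *m _).
  transitivity (tensor_rep E w); first by [].
  rewrite tensor_repE; apply: eq_tensor_mx => j.
  by rewrite mem_filter mem_enum andbT orNb.
rewrite (chi_extension (tensor_power_extension n yE) wW ww eb yb Zrep Zd) Zt.
case: eqP => [e1|ne].
  by apply: eq_bigr => j _; rewrite /y e1 perm1 eqxx; have [|_ _ ->] := hX j; rewrite ?e1 ?perm1.
have [j wj] : exists j, w.1 j != j.
  apply/existsP; rewrite -negb_forall; apply/negP => /forallP h; apply: ne.
  by apply/permP => j; rewrite perm1; apply/eqP; have := h j.
rewrite (bigD1 j) //= [y j _ _](_ : _ = 0) ?mul0r //.
(* This is where the degree has to be positive: eta has degree 0 and the top of E degree i + 1. *)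
have top0 : eta 0 (atop E) = 0.
  apply/eqP/negP => /negP /(homogeneous_coef eta0) => e.
  by have /eqP := tp (atop E); rewrite e eqxx.
by rewrite /y (negPf wj); case: ifP => // _; rewrite (top_rep yE).
Qed.

(** For sigma = 1, the elements of square 1 are the tuples of elements of K of square 1, and the
    distributive law turns the sum of products into an n-th power. *)
Lemma chi_sum_tensor_power i (x : cohomology PK ordinary i.+1%:Z) :
  chi_sum (tensor_power_class PW x) = chi_sum x ^+ n.
Proof.
rewrite /chi_sum (eq_bigr (fun w : wreath n gT =>
  if w.1 == 1%g then \prod_j chi (w.2 j) x else 0)); last first.
  by move=> w /andP[wW /eqP ww]; apply: chi_tensor_power.
rewrite -big_mkcondr /=.
rewrite (reindex_onto (fun f : {ffun 'I_n -> gT} => (1%g, f) : wreath n gT)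
  (fun w => w.2)) /=; last by move=> [s f] /= /andP[_ /eqP ->].
have -> (c : 'F_2) : c ^+ n = \prod_(j < n) c by rewrite prodr_const card_ord.
rewrite (bigA_distr_big _ (fun (_ : 'I_n) k => chi k x)) /=.
apply: eq_bigl => f; rewrite !eqxx !andbT inE /=.
apply/andP/ffun_onP => [[/forallP fK /eqP/(congr1 snd)/= e] j|h].
  apply/andP; split; first exact: fK.
  by move/ffunP/(_ j): e; rewrite !ffunE perm1 => ->.
split; first by apply/forallP => j; have /andP[] := h j.
apply/eqP; congr (_, _); first by rewrite /= mulg1.
by apply/ffunP => j; rewrite !ffunE perm1; have /andP[_ /eqP] := h j.
Qed.

(** For n > 0, a constant tuple of an involution with sigma = 1 has order 2. *)
Lemma even_wreath : (0 < n)%N -> ~~ odd #|K| -> ~~ odd #|wreath_group n K|.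
Proof.
move=> n0 evK; have [|t tK ot] := Cauchy (p := 2%N) isT (G := K).
  by rewrite dvdn2.
pose w : wreath n gT := (1%g, [ffun=> t]).
have wW : w \in wreath_group n K by rewrite inE; apply/forallP => j; rewrite ffunE.
have := order_dvdG wW; suff -> : #[w]%g = 2%N by rewrite dvdn2.
apply: nt_prime_order => //.
  rewrite expgS expg1; congr (_, _); first by rewrite /= mulg1.
  by apply/ffunP => j; rewrite !ffunE -[(t * t)%g]/(t ^+ 2)%g -ot expg_order.
apply/eqP => /(congr1 (fun u : wreath n gT => u.2 (Ordinal n0))).
by rewrite !ffunE => t1; move: ot; rewrite t1 order1.
Qed.

End TensorPowerClass.

(** * The norm to a group with K as central factor *)

Section Embedding.
Local Open Scope group_scope.
Variables (gT : finGroupType) (G K : {group gT}) (n : nat) (r : 'I_n -> gT).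
Hypotheses (sKG : K \subset G) (hr : coset_representatives G K r).

Notation iota := (wreath_embedding K r).

Lemma coset_representatives_inj j l : r l \in r j *: K -> l = j.
Proof.
case: hr => rG uniq_r rl; have [i [_ ui]] := uniq_r _ (rG l).
by rewrite -(ui l) ?lcoset_refl // -(ui j).
Qed.

(** On G the [pick] succeeds, since g permutes the cosets r_j K. *)
Lemma wreath_embeddingP g : g \in G ->
  iota g \in wreath_group n K /\
  forall j, g * r j = r ((iota g).1 j) * (iota g).2 j.
Proof.
case: hr => rG uniq_r gG; rewrite /wreath_embedding.
case: pickP => [w /andP[wW /forallP h]|none] /=.
  by split=> // j; apply/eqP; apply: h.
have ex_s j : exists l, g * r j \in r l *: K.
  by have [l [hl _]] := uniq_r _ (groupM gG (rG j)); exists l.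
have [s hs] := fin_all_exists ex_s.
have s_inj : injective s.
  move=> j l e; apply: coset_representatives_inj.
  have := hs j; have := hs l; rewrite e !mem_lcoset => hl hj.
  have := groupM (groupVr hl) hj.
  by rewrite !invMg invgK !mulgA mulgK mulgKV.
pose w : wreath n gT := (perm s_inj, [ffun j => (r (s j))^-1 * (g * r j)]).
have wW : w \in wreath_group n K.
  by rewrite inE; apply/forallP => j; rewrite ffunE -mem_lcoset.
have := none w; rewrite wW => /negbT/negP[]; apply/forallP => j.
by rewrite /= ffunE permE mulKVg.
Qed.

Lemma wreath_embedding_uniq g w : g \in G -> w \in wreath_group n K ->
  (forall j, g * r j = r (w.1 j) * w.2 j) -> iota g = w.
Proof.
move=> gG wW hw; have [iW hi] := wreath_embeddingP gG.
have mem (u : wreath n gT) j : u \in wreath_group n K ->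
    g * r j = r (u.1 j) * u.2 j -> g * r j \in r (u.1 j) *: K.
  by rewrite inE => /forallP uK ->; rewrite mem_lcoset mulKg.
have [_ uniq_r] := hr.
have e1 j : (iota g).1 j = w.1 j.
  case: hr => rG _; have [l [_ ul]] := uniq_r _ (groupM gG (rG j)).
  by rewrite -(ul _ (mem _ _ iW (hi j))) -(ul _ (mem _ _ wW (hw j))).
rewrite [iota g]surjective_pairing [w]surjective_pairing; congr (_, _).
  exact/permP.
apply/ffunP => j; apply: (mulgI (r (w.1 j))).
by rewrite -hw -e1 hi.
Qed.

Lemma wreath_embeddingM : {in G &, {morph iota : g h / g * h}}.
Proof.
move=> g h gG hG; have [gW hg] := wreath_embeddingP gG.
have [hW hh] := wreath_embeddingP hG.
apply: wreath_embedding_uniq; rewrite ?groupM // => j.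
by rewrite /= ffunE permM -mulgA hh mulgA hg !mulgA.
Qed.

Hypothesis cK : central_factor G K.

Lemma central_factor_conj x g : x \in G -> g \in K ->
  exists2 k, k \in K & g ^ x = g ^ k.
Proof.
rewrite cK => /mulsgP[k c kK /setIP[_ cC] ->] gK; exists k => //.
by rewrite conjgM (conjgE (g ^ k)) -(centP cC) ?groupJ // mulKg.
Qed.

Hypothesis n0 : (0 < n)%N.

(** K is normal, so g fixes one coset r_j K exactly if it lies in K, and then fixes all of them; n >
    0 supplies a coset to test. *)
Lemma wreath_embedding_fixed g : g \in G -> ((iota g).1 == 1) = (g \in K).
Proof.
move=> gG; have [iW hi] := wreath_embeddingP gG; case: (hr) => rG _.
apply/eqP/idP => [e|gK].
  pose j := Ordinal n0; move: iW; rewrite inE => /forallP/(_ j) iK.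
  have := hi j; rewrite e perm1 => eg.
  have [k kK ek] := central_factor_conj (groupVr (rG j)) iK.
  have -> : g = (iota g).2 j ^ (r j)^-1.
    by rewrite conjgE invgK mulgA -eg mulgK.
  by rewrite ek groupJ.
apply/permP => j; rewrite perm1; apply: esym; apply: coset_representatives_inj.
have [k kK ek] := central_factor_conj (rG j) gK.
have : g ^ r j \in K by rewrite ek groupJ.
move: iW; rewrite inE => /forallP/(_ j) iK gr.
rewrite mem_lcoset; have := groupM iK (groupVr gr).
have -> : (iota g).2 j = (r ((iota g).1 j))^-1 * (g * r j) by rewrite hi mulKg.
by rewrite conjgE !invMg !invgK !mulgA mulgK mulgK.
Qed.

Lemma wreath_embedding_factor g j : g \in K ->
  exists2 k, k \in K & (iota g).2 j = g ^ k.
Proof.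
move=> gK; have gG := subsetP sKG g gK.
have [_ /(_ j)] := wreath_embeddingP gG; case: hr => rG _.
have /eqP -> : (iota g).1 == 1 by rewrite wreath_embedding_fixed.
rewrite perm1 => e; have [k kK ek] := central_factor_conj (rG j) gK.
by exists k; rewrite // -ek conjgE e mulKg.
Qed.

End Embedding.

Section Norm.
Local Open Scope ring_scope.
Variables (gT : finGroupType) (G K : {group gT}) (n : nat) (r : 'I_n -> gT).
Hypotheses (sKG : K \subset G) (hr : coset_representatives G K r).
Hypotheses (cK : central_factor G K) (n0 : (0 < n)%N).
Variables (PG : complete_resolution G) (PK : complete_resolution K).
Variable PW : complete_resolution (wreath_group n K).

Lemma evens_norm_degree0 (x : cohomology PK ordinary 0%:Z) c :
  represented x (c *: ceps PK) ->
  represented (evens_norm PG PW r x : cohomology PG ordinary 0%:Z) (c *: ceps PG).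
Proof.
move=> /(tensor_power_class_degree0 PW); rewrite F2_exp //.
apply: restrict_degree0; last exact: wreath_embeddingM.
by move=> g gG; have [] := wreath_embeddingP hr gG.
Qed.

(** Each g in K with g^2 = 1 contributes n equal factors chi g x, whose product is chi g x again
    over F_2. *)
Lemma chi_sum_evens_norm i (x : cohomology PK ordinary i.+1%:Z) :
  chi_sum (evens_norm PG PW r x) = chi_sum x.
Proof.
rewrite /chi_sum (eq_bigr (fun g => if g \in K then chi g x else 0)).
  rewrite -big_mkcondr; apply: eq_bigl => g.
  case gK: (g \in K); last by rewrite andbF.
  by rewrite (subsetP sKG _ gK) andbT.
move=> g /andP[gG /eqP gg]; have [iW _] := wreath_embeddingP hr gG.
rewrite (chi_restrict PG _ (wreath_embeddingM hr)) //; last first.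
  by move=> h hG; have [] := wreath_embeddingP hr hG.
have ii : (wreath_embedding K r g * wreath_embedding K r g)%g = 1%g.
  rewrite -(wreath_embeddingM hr) // gg.
  apply: (mulgI (wreath_embedding K r 1)).
  by rewrite -(wreath_embeddingM hr) ?group1 // !mulg1.
rewrite chi_tensor_power // (wreath_embedding_fixed hr cK n0) //; case: ifP => // gK.
rewrite (eq_bigr (fun=> chi g x)) ?prodr_const ?card_ord ?F2_exp // => j _.
have [k kK ->] := wreath_embedding_factor sKG hr cK n0 j gK.
by rewrite chi_conj.
Qed.

End Norm.

Theorem theorem5p1 (gT : finGroupType) (G K : {group gT}) (n : nat)
    (PK : complete_resolution K) (thK : dual_power_system PK)
    (PG : complete_resolution G) (thG : dual_power_system PG)
    (PW : complete_resolution (wreath_group n K)) (thW : dual_power_system PW)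
    (sKG : K \subset G) (evenK : ~~ odd #|K|) (indexK : #|G : K|%g = n) :
  [/\ forall (i : nat) (x : cohomology PK ordinary i),
        Q_dual thW (i * n) 0 (tensor_power_class PW x) =
        tensor_power_class PW (Q_dual thK i 0 x),
      central_factor G K ->
      forall r : 'I_n -> gT, coset_representatives G K r ->
      forall (i : nat) (x : cohomology PK ordinary i),
        evens_norm PG PW r (Q_dual thK i 0 x) =
        Q_dual thG (i * n) 0 (evens_norm PG PW r x)
    & forall (i : nat) (x : cohomology PK ordinary i),
        Q_dual thK i 0 x = Q_dual thK (n * i) 0 (power n x)].
Proof.
have n0 : 0 < n by rewrite -indexK indexg_gt0.
have evenW := even_wreath n0 evenK.
have evenG : ~~ odd #|G|.
  by rewrite -dvdn2 (dvdn_trans _ (cardSg sKG)) // dvdn2.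
have QK := Q_dual_chi_sum thK evenK.
split=> [i x|cK r hr i x|i x].
- apply: represented_fun (Q_dual_chi_sum thW evenW _) _.
  have := tensor_power_class_degree0 PW (QK i x).
  case: i x => [|i] x; last by rewrite chi_sum_tensor_power.
  (* In degree 0 both sides vanish, the right one because 0^n = 0 for n > 0. *)
  have [c xc] := represented_degree0 x.
  rewrite (chi_sum_degree0 evenK xc) GRing.expr0n eqn0Ngt n0.
  by rewrite (chi_sum_degree0 evenW (tensor_power_class_degree0 PW xc)).
- apply: represented_fun _ (Q_dual_chi_sum thG evenG _).
  have := evens_norm_degree0 hr n0 PG PW (QK i x).
  case: i x => [|i] x; last by rewrite (chi_sum_evens_norm sKG hr cK n0).
  have [c xc] := represented_degree0 x.
  rewrite (chi_sum_degree0 evenK xc).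
  by rewrite (chi_sum_degree0 evenG (evens_norm_degree0 hr n0 PG PW xc)).
apply: represented_fun (QK i x) _.
have := QK (n * i)%N (power n x).
by rewrite (chi_sum_power (theta0 thK)).
Qed.
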